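(* Let $n\ge 5$. The set of convex $n$-gons $P$ in the affine plane $\mathbb{R}^2$ such that $S^k(P)$ is convex for every $k\ge 0$, where $S$ is the inverse pentagram map, is an algebraic subvariety of codimension two in the $2n$-dimensional space of all convex $n$-gons.
   Context: The affine plane $\mathbb{R}^2$ is regarded as a chart of the real projective plane $\mathbb{P}^2$. A polygon ($n$-gon) is a cyclic sequence of points (vertices) $p_i$, $i\in\mathbb{Z}/n$, in $\mathbb{P}^2$; its sides are the lines $p_ip_{i+1}$. A polygon is convex (in the affine plane) if all its vertices lie in the affine plane and for each $i$ all vertices other than $p_i,p_{i+1}$ lie strictly on one side of the line $p_ip_{i+1}$. The space of convex $n$-gons is the open subset of $(\mathbb{R}^2)^n=\mathbb{R}^{2n}$ consisting of the vertex tuples $(p_1,\dots,p_n)$ of convex $n$-gons. An algebraic subvariety of it is a subset cut out by polynomial equations in the coordinates of the vertices; codimension two means its dimension is $2n-2$. Inverse pentagram map: $S(P)$ is the polygon whose vertices are the intersection points of second nearest sides of $P$; i.e. with $\ell_i=p_ip_{i+1}$, the vertices of $S(P)$ are, in cyclic order, $\ell_{i-1}\cap\ell_{i+1}$ (points of $\mathbb{P}^2$; they may be at infinity). For a convex polygon $P$ with at least five vertices all iterates $S^k(P)$ are well-defined polygons in $\mathbb{P}^2$. *)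

(* Defs.v *)
From mathcomp Require Import all_boot all_order all_algebra.
From mathcomp Require Import mpoly.
From mathcomp Require Import classical_sets reals.

Set Implicit Arguments.
Unset Strict Implicit.
Unset Printing Implicit Defensive.

Import Order.TTheory GRing.Theory Num.Theory.

Local Open Scope classical_set_scope.
Local Open Scope ring_scope.

(** Polygons in the affine plane: row [i] of [P : 'M[R]_(n, 2)] is the vertex
    [p_i]; the cyclic successor and predecessor of an index are [ordS] and
    [ord_pred]. *)

(** Twice the signed area of the triangle [abc]: its sign tells on which side
    of the line [ab] the point [c] lies, and it is [0] when [a = b]. *)
Definition orient (R : realType) (a b c : 'rV[R]_2) : R :=
  (b 0 0 - a 0 0) * (c 0 1 - a 0 1) - (b 0 1 - a 0 1) * (c 0 0 - a 0 0).

Definition convex_polygon (R : realType) (n : nat) : set 'M[R]_(n, 2) :=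
  [set P | forall i : 'I_n,
    (forall j, j != i -> j != ordS i ->
       0 < orient (row i P) (row (ordS i) P) (row j P)) \/
    (forall j, j != i -> j != ordS i ->
       orient (row i P) (row (ordS i) P) (row j P) < 0)].

(** The projective plane is the set of lines through the origin of [R^3]:
    points are subspaces of dimension 1, lines are subspaces of dimension 2,
    the line through two distinct points is their sum, and two distinct lines
    meet at their intersection. *)
Definition proj_subspace (R : realType) := {vspace 'rV[R]_(2 + 1)}.

Definition proj_polygon (R : realType) (n : nat) := 'I_n -> proj_subspace R.

(** The affine chart [(x, y) |-> [x : y : 1]]. *)
Definition chart (R : realType) (p : 'rV[R]_2) : proj_subspace R :=
  <[row_mx p (const_mx 1)]>%VS.

Definition to_proj (R : realType) (n : nat) (P : 'M[R]_(n, 2)) :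
  proj_polygon R n := fun i => chart (row i P).

Definition proj_convex (R : realType) (n : nat) (Q : proj_polygon R n) : Prop :=
  exists2 P : 'M[R]_(n, 2), convex_polygon P & forall i, Q i = to_proj P i.

Definition side (R : realType) (n : nat) (Q : proj_polygon R n) (i : 'I_n) :
  proj_subspace R := (Q i + Q (ordS i))%VS.

(** This is total; on degenerate input the values need not be points. *)
Definition inv_pentagram (R : realType) (n : nat) (Q : proj_polygon R n) :
  proj_polygon R n := fun i => (side Q (ord_pred i) :&: side Q (ordS i))%VS.

Definition forever_convex (R : realType) (n : nat) : set 'M[R]_(n, 2) :=
  [set P | convex_polygon P /\
           forall k, proj_convex (iter k (@inv_pentagram R n) (to_proj P))].

(** Value of a polynomial at the [n * 2] coordinates of the vertices. *)
Definition peval (R : realType) (n : nat) (p : {mpoly R[n * 2]})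
  (P : 'M[R]_(n, 2)) : R := p.@[fun k => mxvec P 0 k].

(** [V] is cut out of [X] by polynomial equations. These are also the closed
    subsets of [X] for the topology induced by the Zariski topology. *)
Definition algebraic_in (R : realType) (n : nat) (X V : set 'M[R]_(n, 2)) :
  Prop :=
  exists F : set {mpoly R[n * 2]},
    V = [set P | X P /\ forall p, F p -> peval p P = 0].

Definition zariski_irreducible (R : realType) (n : nat)
  (Z : set 'M[R]_(n, 2)) : Prop :=
  Z !=set0 /\
  forall A B : set 'M[R]_(n, 2), algebraic_in Z A -> algebraic_in Z B ->
    Z = A `|` B -> Z = A \/ Z = B.

(** [Z_0], ..., [Z_d] is a strictly increasing chain of irreducible closed
    subsets of [V]. *)
Definition irreducible_chain (R : realType) (n : nat) (V : set 'M[R]_(n, 2))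
  (d : nat) (Z : 'I_d.+1 -> set 'M[R]_(n, 2)) : Prop :=
  (forall i, algebraic_in V (Z i) /\ zariski_irreducible (Z i)) /\
  (forall i j : 'I_d.+1, (i < j)%N -> Z i `<` Z j).

(** Krull dimension of [V] for the Zariski topology. *)
Definition zariski_dim (R : realType) (n : nat) (V : set 'M[R]_(n, 2))
  (d : nat) : Prop :=
  (exists Z, @irreducible_chain R n V d Z) /\
  (forall m Z, @irreducible_chain R n V m Z -> (m <= d)%N).

(* Main.v *)
Require Import Defs.
From mathcomp Require Import all_boot all_order all_algebra.
From mathcomp Require Import mpoly.
From mathcomp Require Import classical_sets boolp reals.
From mathcomp Require Import topology normedtype derive.
From mathcomp Require Import ring lra zify.

(** Write [p_i] for the vertices of a convex polygon [P] and [A_i] for the signed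
    double area of the triangle [p_(i-1) p_i p_(i+1)].  A polygon stays convex
    forever if and only if the vector [F(P) = sum_i (p_(i+1) - p_(i-1)) / A_i]
    vanishes.  This vector comes from Glick's operator
      [(M g)(z) = sum_i g(p_i) [p_(i-1), p_(i+1), z] / A_i]
    on affine forms [g], which is the same for [P] and for its image [S(P)]:
    [F(P) = 0] says that the constant form, i.e. the line at infinity, is an
    eigenvector of [M].

    If [F(P) = 0], let [B_i] be the cross product of the edges [d_(i-1)] and
    [d_(i+1)]; then [sum_i (B_i / (A_i A_(i+1))) d_i = F(P) = 0], and taking the
    cross product with a suitable edge forces [B_i > 0] for all [i], which is
    convexity of [S(P)]; and [F(S(P)) = F(P)].  Conversely, if all [S^k(P)] are
    convex, positivity of [M] on each of them yields a Harnack inequality for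
    the forms nonnegative on [S^(k+2)(P)], with a constant independent of [k].
    Iterating it shows that the form [M 1], which is nonnegative on all [S^k(P)],
    is constant, so [F(P) = 0].

    Upper bound for the dimension: the differentials of the two components of [F]
    are independent at every point of the variety, already along infinitesimal
    projective transformations, because a dependence would give a second
    eigenvector or a Jordan block for the eigenvalue of the constant form,
    against positivity of [M] at a vertex where the form is minimal.  So a chain
    of length [d] yields [d + 2] algebraically independent polynomials in [2 n]
    variables.

    Lower bound: every convex polygon is the projective image of one with
    [F = 0], since [M + 1] has a positive eigenvector by a Perron-Frobenius
    argument.  So three vertices and the [2 n - 8] projective coordinates of the
    polygon can be prescribed independently, and slicing along these [2 n - 2]
    coordinates produces a chain of irreducible sets. *)

Set Implicit Arguments.
Unset Strict Implicit.
Unset Printing Implicit Defensive.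

Import Order.TTheory GRing.Theory Num.Theory.
Import numFieldNormedType.Exports.

Local Open Scope ring_scope.

(** * Arithmetic of cyclic indices *)

Section CyclicIndices.
Variables (n : nat) (hn : (5 <= n)%N).

Lemma val_iter_ordS k (i : 'I_n) : val (iter k (@ordS n) i) = ((i + k) %% n)%N.
Proof.
elim: k => [|k IH] /=; first by rewrite addn0 modn_small.
by rewrite IH addnS -[in LHS]addn1 -[in RHS]addn1 modnDml.
Qed.

Lemma iter_ordS_neq k (i : 'I_n) : (0 < k < n)%N -> iter k (@ordS n) i != i.
Proof.
move=> /andP[k0 kn]; apply/eqP => /(congr1 val); rewrite val_iter_ordS => /eqP.
rewrite -[X in _ == X](modn_small (ltn_ord i)) -[X in _ == X %[mod n]]addn0.
by rewrite eqn_modDl mod0n modn_small // -leqn0 leqNgt k0.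
Qed.

End CyclicIndices.

(** Separates two indices obtained from one index by [ordS] and [ord_pred]: applying [ordS] three
    times clears the predecessors, injectivity strips the common successors, and the remaining shift
    has at most four steps, fewer than [n]. *)
Ltac ord_neq :=
  let H := fresh "H" in
  apply/eqP => H;
  have {H} := congr1 (fun z => ordS (ordS (ordS z))) H;
  rewrite /= ?ord_predK => H;
  repeat (move/(@ordS_inj _): H => H);
  first
  [ by move/eqP: H; apply/negP; exact: (@iter_ordS_neq _ 1)
  | by move/eqP: H; apply/negP; apply: (@iter_ordS_neq _ 1 _); lia
  | by move/eqP: H; apply/negP; apply: (@iter_ordS_neq _ 2 _); lia
  | by move/eqP: H; apply/negP; apply: (@iter_ordS_neq _ 3 _); lia
  | by move/eqP: H; apply/negP; apply: (@iter_ordS_neq _ 4 _); lia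
  | by move/esym/eqP: H; apply/negP; apply: (@iter_ordS_neq _ 1 _); lia
  | by move/esym/eqP: H; apply/negP; apply: (@iter_ordS_neq _ 2 _); lia
  | by move/esym/eqP: H; apply/negP; apply: (@iter_ordS_neq _ 3 _); lia
  | by move/esym/eqP: H; apply/negP; apply: (@iter_ordS_neq _ 4 _); lia ].

(** * Convex polygons and their inverse pentagram image *)

Section Polygon.
Variables (R : realFieldType) (n : nat) (hn : (5 <= n)%N).

Local Notation s := (@ordS n).
Local Notation q := (@ord_pred n).

Section Definitions.
Variables (S : comNzRingType) (x y : 'I_n -> S).
(** Over any commutative ring, because the same expressions reappear over [{poly R}] and [{mpoly
    R[n * 2]}]. *)
Definition edgex i : S := x (s i) - x i.
Definition edgey i : S := y (s i) - y i.
Definition edge_cross i j : S := edgex i * edgey j - edgey i * edgex j.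
Definition side_form i (u v : S) : S := edgex i * (v - y i) - edgey i * (u - x i).
Definition ear i : S := edge_cross (q i) i.
(** In a positively oriented polygon, [turn2 i > 0] says that the sides [q i] and [s i] meet beyond
    the side [i], away from the polygon. *)
Definition turn2 i : S := edge_cross (q i) (s i).
Definition diag_form i (u v : S) : S :=
  (x (s i) - x (q i)) * (v - y (q i)) - (y (s i) - y (q i)) * (u - x (q i)).
End Definitions.

Section RealDefinitions.
Variables x y : 'I_n -> R.
(** Convex and counterclockwise; the clockwise case is reduced to this one by negating [y]. *)
Definition pos_polygon : Prop :=
  forall i j, j != i -> j != s i -> 0 < side_form x y i (x j) (y j).
(* The linear part of the image of the constant form [1] under Glick's operator,
   rotated by a right angle. *)
Definition obstruction_x : R := \sum_i (x (s i) - x (q i)) / ear x y i.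
Definition obstruction_y : R := \sum_i (y (s i) - y (q i)) / ear x y i.
End RealDefinitions.

Ltac unfold_poly :=
  rewrite /turn2 /ear /diag_form /side_form /edge_cross /edgex /edgey ?ord_predK ?ordSK.

Section Convex.
Variables x y : 'I_n -> R.
Hypothesis pos : pos_polygon x y.

Local Notation W := (side_form x y).
Local Notation A := (ear x y).
Local Notation B := (turn2 x y).
Local Notation cr := (edge_cross x y).
Local Notation D := (diag_form x y).

Lemma side_form_src i : W i (x i) (y i) = 0.
Proof. by unfold_poly; ring. Qed.

Lemma side_form_tgt i : W i (x (s i)) (y (s i)) = 0.
Proof. by unfold_poly; ring. Qed.

Lemma side_form_ge0 i j : 0 <= W i (x j) (y j).
Proof.
have [->|ji] := eqVneq j i; first by rewrite side_form_src.
have [->|jsi] := eqVneq j (s i); first by rewrite side_form_tgt.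
exact/ltW/pos.
Qed.

Lemma side_form_vertex_eq0 i j : W i (x j) (y j) <= 0 -> (j == i) || (j == s i).
Proof.
move=> h; apply/negPn/negP; rewrite negb_or => /andP[ji jsi].
by have := pos ji jsi; lra.
Qed.

Lemma side_form_pred i : W i (x (q i)) (y (q i)) = A i.
Proof. by unfold_poly; ring. Qed.

Lemma ear_gt0 i : 0 < A i.
Proof. by rewrite -side_form_pred; apply: pos; ord_neq. Qed.

Lemma ear_neq0 i : A i != 0.
Proof. by rewrite gt_eqF // ear_gt0. Qed.

(** The point lies in the cone at the vertex [i] bounded by its two sides. This cone is generated by
    the edge [i] and the reversed edge [q i], on both of which the linear form is nonnegative. *)
Lemma local_min_is_min i (a b u v : R) :
  0 <= W (q i) u v -> 0 <= W i u v ->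
  0 <= a * edgex x i + b * edgey y i ->
  a * edgex x (q i) + b * edgey y (q i) <= 0 ->
  a * x i + b * y i <= a * u + b * v.
Proof.
move=> hq hi hs hp; have A0 := ear_gt0 i.
have E : A i * (a * u + b * v - (a * x i + b * y i)) =
  W (q i) u v * (a * edgex x i + b * edgey y i) -
  W i u v * (a * edgex x (q i) + b * edgey y (q i)) by unfold_poly; ring.
rewrite -subr_ge0 -(pmulr_rge0 _ A0) E subr_ge0.
by apply: (@le_trans _ _ 0); [exact: mulr_ge0_le0 | exact: mulr_ge0].
Qed.

Lemma side_local_min i l j :
  0 <= cr l i -> cr l (q i) <= 0 -> W l (x i) (y i) <= W l (x j) (y j).
Proof.
move=> h1 h2.
have := @local_min_is_min i (- edgey y l) (edgex x l) (x j) (y j)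
   (side_form_ge0 _ _) (side_form_ge0 _ _).
have -> : - edgey y l * edgex x i + edgex x l * edgey y i = cr l i by rewrite /edge_cross; ring.
have -> : - edgey y l * edgex x (q i) + edgex x l * edgey y (q i) = cr l (q i)
  by rewrite /edge_cross; ring.
by move=> /(_ h1 h2); rewrite /side_form; lra.
Qed.

(** Three-term Plücker relation for the vertices [q i], [i], [s i], [s j] seen from [j]: a
    nonpositive value would put the vertex [s i] on the side [j]. *)
Lemma diag_form_gt0 i j : j != q i -> j != i -> j != s i -> 0 < D i (x j) (y j).
Proof.
move=> jq ji js; rewrite ltNge; apply/negP => D0.
have E : W i (x j) (y j) * W j (x (q i)) (y (q i)) +
         W (q i) (x j) (y j) * W j (x (s i)) (y (s i)) =
         D i (x j) (y j) * W j (x i) (y i) by unfold_poly; ring.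
have D1 : D i (x j) (y j) * W j (x i) (y i) <= 0 by rewrite mulr_le0_ge0 ?side_form_ge0.
have W1 : 0 < W i (x j) (y j) by exact: pos.
have W2 : 0 < W (q i) (x j) (y j) by apply: pos; rewrite ?ord_predK.
have P1 : 0 <= W i (x j) (y j) * W j (x (q i)) (y (q i)).
  by rewrite mulr_ge0 ?side_form_ge0.
have P2 : 0 <= W (q i) (x j) (y j) * W j (x (s i)) (y (s i)).
  by rewrite mulr_ge0 ?side_form_ge0.
have Z1 : W j (x (q i)) (y (q i)) <= 0 by rewrite -(pmulr_rle0 _ W1); lra.
have Z2 : W j (x (s i)) (y (s i)) <= 0 by rewrite -(pmulr_rle0 _ W2); lra.
have /orP[/eqP h|/eqP h] := side_form_vertex_eq0 Z2; first by rewrite h eqxx in js.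
by move/ordS_inj: h ji => ->; rewrite eqxx.
Qed.

(** If the edges turn by at least a half circle from [q i] to [s i], then all edges but [i] lie
    within the half circle that starts at [s i]. Without angles: if [cr j (s i) > 0], either the
    side form [j] has its minimum over the polygon at [s i] or [i], where it is positive, or three
    positive cross products contradict [turn2 i <= 0]. *)
Lemma turn2_le0_edge_cross i j : B i <= 0 -> j != i -> cr j (s i) <= 0.
Proof.
move=> B0 ji; have [->|jq] := eqVneq j (q i); first by [].
have [->|js] := eqVneq j (s i); first by rewrite /edge_cross mulrC subrr.
rewrite leNgt; apply/negP => c3.
have [c2|c2] := leP (cr j i) 0.
  have := @side_local_min (s i) j j (ltW c3); rewrite ordSK => /(_ c2).
  rewrite side_form_src => /side_form_vertex_eq0 /orP[/eqP h|/eqP /ordS_inj h].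
    by rewrite h eqxx in js.
  by rewrite h eqxx in ji.
have [c1|c1] := leP (cr j (q i)) 0.
  have := @side_local_min i j j (ltW c2) c1.
  rewrite side_form_src => /side_form_vertex_eq0 /orP[/eqP h|/eqP h].
    by rewrite h eqxx in ji.
  by rewrite h ordSK eqxx in jq.
have E : B i * cr j i = cr j (q i) * A (s i) + cr j (s i) * A i.
  by rewrite /turn2 /ear ordSK /edge_cross; ring.
have h1 : 0 < cr j (q i) * A (s i) by rewrite mulr_gt0 ?ear_gt0.
have h2 : 0 < cr j (s i) * A i by rewrite mulr_gt0 ?ear_gt0.
have h3 : B i * cr j i <= 0 by rewrite mulr_le0_ge0 // ltW.
by lra.
Qed.

Lemma edge_crossC i j : cr i j = - cr j i.
Proof. by rewrite /edge_cross; ring. Qed.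

(** The half-circle constraints at [i] and at [j] make the edges [s i] and [s j] parallel. If
    [s (s j)] is not [i], the constraint at [i] applies to it too and makes [j] parallel to [s i],
    so that two consecutive edges are parallel. *)
Lemma turn2_le0_nonadjacent i j :
  B i <= 0 -> B j <= 0 -> j != i -> j != s i -> i != s j -> s (s j) = i.
Proof.
move=> Bi Bj ji js ij; apply/eqP/negPn/negP => h.
have k1 : cr (s j) (s i) <= 0 by apply: turn2_le0_edge_cross; rewrite // eq_sym.
have k2 : cr (s i) (s j) <= 0 by apply: turn2_le0_edge_cross; rewrite // eq_sym.
have par : cr (s j) (s i) = 0.
  by apply/eqP; rewrite eq_le k1 -oppr_le0 -edge_crossC k2.
have Ai := ear_gt0 (s i); have Aj := ear_gt0 (s j); have Aj' := ear_gt0 (s (s j)).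
rewrite /ear !ordSK in Ai Aj Aj'.
have cj : cr j (s i) <= 0 by apply: turn2_le0_edge_cross.
have c2 : cr (s (s j)) (s i) <= 0 by apply: turn2_le0_edge_cross.
have P : cr j (s j) * cr (s (s j)) (s i) - cr j (s (s j)) * cr (s j) (s i)
           + cr j (s i) * cr (s j) (s (s j)) = 0 by rewrite /edge_cross; ring.
have Q : cr i (s i) * cr j (s j) = cr j (s i) * cr i (s j) - cr (s j) (s i) * cr i j.
  by rewrite /edge_cross; ring.
have m1 : cr j (s j) * cr (s (s j)) (s i) <= 0 by rewrite pmulr_rle0.
have m2 : cr j (s i) * cr (s j) (s (s j)) <= 0 by rewrite pmulr_lle0.
have /eqP : cr j (s i) * cr (s j) (s (s j)) = 0.
  by rewrite par mulr0 in P; lra.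
rewrite mulf_eq0 [X in _ || X]gt_eqF // orbF => /eqP cj0.
have : 0 < cr i (s i) * cr j (s j) by rewrite mulr_gt0.
by rewrite Q par cj0; lra.
Qed.

(** Otherwise, by symmetry, [s (s j) = i] and [s (s i) = j]: a cycle of length four, excluded by
    [n >= 5]. *)
Lemma turn2_gt0_nonadjacent i j :
  B i <= 0 -> j != i -> j != s i -> i != s j -> 0 < B j.
Proof.
move=> Bi ji js ij; rewrite ltNge; apply/negP => Bj.
have h := turn2_le0_nonadjacent Bi Bj ji js ij; subst i.
have : s (s (s (s j))) = j by apply: turn2_le0_nonadjacent; rewrite // eq_sym.
by apply/eqP; ord_neq.
Qed.

(* [turn2 i] times the value of the side form [l] at the vertex [i] of the
   inverse pentagram image, which is [x i + ear (s i) / turn2 i * edge (q i)]. *)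
Definition side_form_next l i := B i * W l (x i) (y i) + A (s i) * cr l (q i).

(** Otherwise the form [l] decreases along the edge [q i] and increases along [s i], so its minimum
    over the polygon is at [i] or [s i]. It is positive there, but it vanishes at the vertex [l]. *)
Lemma side_form_next_gt0 l i : 0 < B i -> l != i -> l != s i -> l != q i ->
  0 < side_form_next l i.
Proof.
move=> Bi li ls lq; rewrite ltNge; apply/negP => S0.
have E : side_form_next l i = B i * W l (x (s i)) (y (s i)) - A i * cr l (s i).
  by rewrite /side_form_next /side_form; unfold_poly; ring.
have isl : i != s l by apply: contra_neq lq => ->; rewrite ordSK.
have sil : s i != s l by rewrite (inj_eq (@ordS_inj _)) eq_sym.
have W1 : 0 < W l (x i) (y i) by apply: pos; rewrite // eq_sym.
have W2 : 0 < W l (x (s i)) (y (s i)) by apply: pos; rewrite // eq_sym.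
have A1 := ear_gt0 (s i); have A0 := ear_gt0 i.
have W1' := mulr_gt0 Bi W1; have W2' := mulr_gt0 Bi W2.
have c1 : cr l (q i) < 0.
  by rewrite -(pmulr_rlt0 _ A1); move: S0; rewrite /side_form_next; lra.
have c2 : 0 < cr l (s i) by rewrite -(pmulr_rgt0 _ A0); move: S0; rewrite E; lra.
have [c|c] := leP 0 (cr l i).
  by have := side_local_min l c (ltW c1); rewrite side_form_src; lra.
have := @side_local_min (s i) l l (ltW c2); rewrite ordSK side_form_src => /(_ (ltW c)).
by lra.
Qed.

End Convex.

Section Obstruction.
Variables x y : 'I_n -> R.
Hypothesis pos : pos_polygon x y.

Local Notation W := (side_form x y).
Local Notation A := (ear x y).
Local Notation B := (turn2 x y).
Local Notation cr := (edge_cross x y).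
Local Notation D := (diag_form x y).

Lemma sum_ordS (f : 'I_n -> R) : \sum_i f (s i) = \sum_i f i.
Proof. by rewrite [RHS](reindex_inj (@ordS_inj n)). Qed.

(** Each diagonal is a sum of two edges. Regrouping them as
    [edge (q i) / A i + edge (s i) / A (s i)] gives a multiple of the edge [i], by the linear
    relation between three vectors of the plane. *)
Lemma obstruction_edges :
  obstruction_x x y = \sum_i B i / (A i * A (s i)) * edgex x i /\
  obstruction_y x y = \sum_i B i / (A i * A (s i)) * edgey y i.
Proof.
have neq0 i : A i != 0 := ear_neq0 pos i.
split.
- transitivity (\sum_i (edgex x (q i) / A i + edgex x i / A i)).
    apply: eq_bigr => i _; rewrite -mulrDl /edgex ord_predK.
    by congr (_ / _); ring.
  rewrite big_split /= -[X in _ + X]sum_ordS -big_split /=.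
  apply: eq_bigr => i _; have := neq0 i; have := neq0 (s i).
  by rewrite /turn2 /ear ordSK /edge_cross => h1 h2; field; rewrite h1 h2.
- transitivity (\sum_i (edgey y (q i) / A i + edgey y i / A i)).
    apply: eq_bigr => i _; rewrite -mulrDl /edgey ord_predK.
    by congr (_ / _); ring.
  rewrite big_split /= -[X in _ + X]sum_ordS -big_split /=.
  apply: eq_bigr => i _; have := neq0 i; have := neq0 (s i).
  by rewrite /turn2 /ear ordSK /edge_cross => h1 h2; field; rewrite h1 h2.
Qed.

Hypothesis ox0 : obstruction_x x y = 0.
Hypothesis oy0 : obstruction_y x y = 0.

(** If [turn2 i <= 0], the cross product of the edge [s i] with the edge expansion of the
    obstruction has only nonnegative terms, and the term of [s (s i)] is positive. *)
Lemma turn2_gt0_of_pred i : 0 < B (q i) -> 0 < B i.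
Proof.
move=> Bq; rewrite ltNge; apply/negP => Bi.
have [ex ey] := obstruction_edges.
have : \sum_j B j / (A j * A (s j)) * cr (s i) j = 0.
  transitivity (edgex x (s i) * obstruction_y x y - edgey y (s i) * obstruction_x x y).
    rewrite ex ey !mulr_sumr -sumrB; apply: eq_bigr => j _.
    by rewrite /edge_cross; ring.
  by rewrite ox0 oy0 !mulr0 subrr.
have AA j : 0 < (A j * A (s j))^-1 by rewrite invr_gt0 mulr_gt0 ?ear_gt0.
have Bpos j : j != i -> j != s i -> 0 < B j.
  move=> ji js; have [->//|jq] := eqVneq j (q i).
  by apply: turn2_gt0_nonadjacent Bi ji js _ => //; apply: contra_neq jq => ->; rewrite ordSK.
have term j : 0 <= B j / (A j * A (s j)) * cr (s i) j.
  have [->|js] := eqVneq j (s i); first by rewrite /edge_cross [edgex _ _ * _]mulrC subrr mulr0.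
  have [->|ji] := eqVneq j i.
    rewrite edge_crossC mulr_le0 // ?pmulr_lle0 // oppr_le0.
    by have := ear_gt0 pos (s i); rewrite /ear ordSK => /ltW.
  rewrite mulr_ge0 //; first by rewrite ltW // mulr_gt0 // Bpos.
  by rewrite edge_crossC oppr_ge0; apply: turn2_le0_edge_cross.
rewrite (bigD1 (s (s i))) //= => /eqP; rewrite paddr_eq0 //; last exact: sumr_ge0.
case/andP => /eqP h _; move: h; apply/eqP; rewrite gt_eqF // mulr_gt0 //.
  by rewrite mulr_gt0 // Bpos //; ord_neq.
by have := ear_gt0 pos (s (s i)); rewrite /ear ordSK.
Qed.

(** Two nonadjacent indices cannot both have [turn2 <= 0]; hence some index shortly before [i] has
    [turn2 > 0], and positivity propagates to [i]. *)
Lemma turn2_gt0_of_obstruction i : 0 < B i.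
Proof.
have [Bq|Bq] := leP (B (q i)) 0; last exact: turn2_gt0_of_pred.
have : 0 < B (q (q i)).
  have := leP (B i) 0; case=> Bi.
    by apply: (turn2_gt0_nonadjacent pos Bi); ord_neq.
  have [Bqq|//] := leP (B (q (q i))) 0.
  have : 0 < B (q (q (q i))) by apply: (turn2_gt0_nonadjacent pos Bq); ord_neq.
  by move/turn2_gt0_of_pred; rewrite ltNge Bqq.
by move/turn2_gt0_of_pred => h; apply: turn2_gt0_of_pred.
Qed.

End Obstruction.

(** * The next polygon and the invariance of Glick's operator *)

Section Next.
Variables x y : 'I_n -> R.
Local Notation W := (side_form x y).
Local Notation A := (ear x y).
Local Notation B := (turn2 x y).
Local Notation cr := (edge_cross x y).
Local Notation D := (diag_form x y).

Definition nextx i : R := x i + A (s i) / B i * edgex x (q i).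
Definition nexty i : R := y i + A (s i) / B i * edgey y (q i).

(* Glick's operator (minus [n] times the identity) in its action on affine
   forms: the image of [a x + b y + c], evaluated at [(u, v)]. *)
Definition glick_op (a b c u v : R) : R :=
  \sum_i (a * x i + b * y i + c) * D i u v / A i.

Hypothesis B0 : forall i, B i != 0.

Lemma next_tgt i :
  nextx i = x (s i) - A i / B i * edgex x (s i) /\
  nexty i = y (s i) - A i / B i * edgey y (s i).
Proof.
have := B0 i; rewrite /nextx /nexty; unfold_poly => h.
by split; field.
Qed.

(** The diagonal from [q i] to [s i] of the next polygon lies along the side [i]; this is the ratio
    of the two. *)
Definition stretch i : R := 1 + A (s (s i)) / B (s i) + A (q i) / B (q i).

Lemma next_diag i :
  nextx (s i) - nextx (q i) = stretch i * edgex x i /\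
  nexty (s i) - nexty (q i) = stretch i * edgey y i.
Proof.
have [-> ->] := next_tgt (q i).
rewrite /nextx /nexty !ord_predK ordSK /stretch /edgex /edgey.
by split; ring.
Qed.

Lemma side_form_at_next l i : W l (nextx i) (nexty i) * B i = side_form_next x y l i.
Proof.
have := B0 i; rewrite /nextx /nexty /side_form_next /side_form.
by move=> h; rewrite /edge_cross; field.
Qed.

Lemma side_form_next_self i : W i (nextx i) (nexty i) = - (A i * A (s i) / B i).
Proof.
apply: (mulIf (B0 i)); rewrite side_form_at_next mulNr divfK // /side_form_next.
by unfold_poly; ring.
Qed.

Lemma side_form_next_succ i : W (s i) (nextx i) (nexty i) = 0.
Proof.
have [-> ->] := next_tgt i; rewrite /side_form; ring.
Qed.

Lemma side_form_next_pred i : W (q i) (nextx i) (nexty i) = 0.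
Proof.
rewrite /nextx /nexty /side_form /edgex /edgey ord_predK; ring.
Qed.

(** The new side joins the intersection of [q i] and [s i] to that of [i] and [s (s i)], so it
    belongs to both pencils. This expansion uses the first pencil, the following one the second;
    with positive ears and turns all coefficients are positive. *)
Lemma side_form_of_next i u v :
  side_form nextx nexty i u v =
    A (s i) * A (s (s i)) / (B i * B (s i)) * W (q i) u v +
    A i * (A (s (s i)) + B (s i)) / (B i * B (s i)) * W (s i) u v.
Proof.
have := B0 i; have := B0 (s i); rewrite /side_form /nextx /nexty; unfold_poly => h1 h2.
by field; rewrite h1 h2.
Qed.

Lemma side_form_of_next' i u v :
  side_form nextx nexty i u v =
    A (s (s i)) * (A i + B i) / (B i * B (s i)) * W i u v +
    A i * A (s i) / (B i * B (s i)) * W (s (s i)) u v.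
Proof.
have := B0 i; have := B0 (s i); rewrite /side_form /nextx /nexty; unfold_poly => h1 h2.
by field; rewrite h1 h2.
Qed.

Lemma diag_form_next i u v : diag_form nextx nexty i u v = stretch i * W i u v.
Proof.
have [ex ey] := next_diag i; have := side_form_next_succ (q i).
rewrite ord_predK /diag_form ex ey /side_form => h.
transitivity (stretch i * (edgex x i * (v - y i) - edgey y i * (u - x i) -
 (edgex x i * (nexty (q i) - y i) - edgey y i * (nextx (q i) - x i)))); first by ring.
by rewrite h; ring.
Qed.

Lemma ear_next i : ear nextx nexty i = stretch i * (A i * A (s i) / B i).
Proof.
have -> : ear nextx nexty i = - diag_form nextx nexty i (nextx i) (nexty i).
  by unfold_poly; ring.
by rewrite diag_form_next side_form_next_self mulrN opprK.
Qed.

Hypothesis A0 : forall i, A i != 0.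

(** Barycentric coordinates of [(u, v)] in the triangle formed by the vertices [i], [s i] and the
    new vertex [i]. *)
Lemma side_expansion i a b c u v :
  (a * nextx i + b * nexty i + c) * W i u v * B i / (A i * A (s i)) =
  - (a * u + b * v + c) + (a * x (s i) + b * y (s i) + c) * W (q i) u v / A i
  + (a * x i + b * y i + c) * W (s i) u v / A (s i).
Proof.
have := A0 i; have := A0 (s i); have := B0 i.
rewrite /nextx /nexty; unfold_poly => h1 h2 h3.
by field; rewrite h1 h2 h3.
Qed.

(** Both sums consist of barycentric expansions: in the ear triangle at [i] on the left, in the
    triangle erected on the side [i] on the right. A shift of the index matches them. *)
Lemma glick_op_sides a b c u v :
  glick_op a b c u v =
  \sum_i (a * nextx i + b * nexty i + c) * W i u v * B i / (A i * A (s i)).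
Proof.
under [RHS]eq_bigr => i _ do rewrite side_expansion.
rewrite big_split /=.
have -> : \sum_i (a * x i + b * y i + c) * W (s i) u v / A (s i) =
  \sum_i (a * x (q i) + b * y (q i) + c) * W i u v / A i.
  by rewrite -[RHS]sum_ordS; apply: eq_bigr => i _; rewrite ordSK.
rewrite -big_split /=; apply: eq_bigr => i _.
by have := A0 i; unfold_poly => h; field.
Qed.

(** The diagonals of the next polygon are the sides of the old one, so its operator is the
    expression of [glick_op_sides]; the factor [stretch] cancels. *)
Lemma glick_op_next a b c u v : (forall i, stretch i != 0) ->
  \sum_i (a * nextx i + b * nexty i + c) * diag_form nextx nexty i u v / ear nextx nexty i =
  glick_op a b c u v.
Proof.
move=> st0; rewrite glick_op_sides; apply: eq_bigr => i _.
rewrite diag_form_next ear_next.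
have := st0 i; have := A0 i; have := A0 (s i); have := B0 i => h1 h2 h3 h4.
by field; rewrite h1 h2 h3 h4.
Qed.

End Next.

Section NextConvex.
Variables x y : 'I_n -> R.
Hypothesis pos : pos_polygon x y.

Local Notation W := (side_form x y).
Local Notation A := (ear x y).
Local Notation B := (turn2 x y).
Local Notation cr := (edge_cross x y).
Local Notation nx := (nextx x y).
Local Notation ny := (nexty x y).

Lemma incident_next i u v : W (q i) u v = 0 -> W (s i) u v = 0 ->
  [/\ B i != 0, u = nx i & v = ny i].
Proof.
move=> wq ws.
(* At a common point of the sides [q i] and [s i] only the term in [B i] survives on the left, so
   [B i] cannot vanish. *)
have E : A (s i) * W (q i) u v + A i * W (s i) u v - B i * W i u v = A i * A (s i).
  by unfold_poly; ring.
have AA : 0 < A i * A (s i) by rewrite mulr_gt0 ?ear_gt0.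
have Bi : B i != 0 by apply/eqP => Z; move: AA; rewrite -E wq ws Z; lra.
have Ex : B i * (u - x i) = (A (s i) - W (s i) u v) * edgex x (q i) + W (q i) u v * edgex x (s i).
  by unfold_poly; ring.
have Ey : B i * (v - y i) = (A (s i) - W (s i) u v) * edgey y (q i) + W (q i) u v * edgey y (s i).
  by unfold_poly; ring.
rewrite wq ws subr0 mul0r addr0 in Ex; rewrite wq ws subr0 mul0r addr0 in Ey.
split=> //; apply: (mulfI Bi).
  by rewrite /nextx mulrDr mulrA [B i * (_ / _)]mulrC divfK // -Ex; ring.
by rewrite /nexty mulrDr mulrA [B i * (_ / _)]mulrC divfK // -Ey; ring.
Qed.

(** The sign [e] is the orientation of the next polygon. If [turn2 l <= 0], then
    [turn2 (s (s l)) > 0] and the new vertex [s (s l)] is on the positive side of the line [l], a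
    diagonal of the next polygon. The new vertex [l] is then on the negative side, which means
    [turn2 l > 0]. *)
Lemma turn2_gt0_of_next_convex (e : R) :
  (forall i, B i != 0) ->
  (forall i j, j != q i -> j != i -> j != s i -> 0 < e * diag_form nx ny i (nx j) (ny j)) ->
  (forall i, e * diag_form nx ny i (nx i) (ny i) < 0) ->
  forall i, 0 < B i.
Proof.
move=> B0 hD hE l; rewrite ltNge; apply/negP => Bl.
have Bj : 0 < B (s (s l)) by apply: (turn2_gt0_nonadjacent pos Bl); ord_neq.
have := hD l (s (s l)); rewrite diag_form_next // => /(_ _ _ _) h.
have Wj : 0 < W l (nx (s (s l))) (ny (s (s l))).
  rewrite -(pmulr_lgt0 _ Bj) side_form_at_next //.
  by apply: side_form_next_gt0 => //; ord_neq.
have {h} : 0 < e * (stretch x y l * W l (nx (s (s l))) (ny (s (s l)))) by apply: h; ord_neq.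
rewrite mulrA pmulr_lgt0 // => es.
have := hE l; rewrite diag_form_next // mulrA pmulr_rlt0 // side_form_next_self // oppr_lt0.
by rewrite pmulr_rgt0 ?mulr_gt0 ?ear_gt0 // invr_gt0; lra.
Qed.

Hypothesis Bgt0 : forall i, 0 < B i.

Let B0 i : B i != 0. Proof. by rewrite gt_eqF. Qed.
Let A0 i : A i != 0. Proof. by rewrite gt_eqF // ear_gt0. Qed.

Lemma stretch_gt0 i : 0 < stretch x y i.
Proof. by rewrite !addr_gt0 // divr_gt0 // ear_gt0. Qed.

Lemma side_form_at_next_gt0 l i : l != i -> l != s i -> l != q i -> 0 < W l (nx i) (ny i).
Proof.
move=> li ls lq; rewrite -(pmulr_lgt0 _ (Bgt0 i)) side_form_at_next //.
exact: side_form_next_gt0.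
Qed.

Lemma side_form_at_next_ge0 l i : l != i -> 0 <= W l (nx i) (ny i).
Proof.
move=> li; have [->|ls] := eqVneq l (s i); first by rewrite side_form_next_succ.
have [->|lq] := eqVneq l (q i); first by rewrite side_form_next_pred.
exact/ltW/side_form_at_next_gt0.
Qed.

Lemma next_pos : pos_polygon nx ny.
Proof.
move=> i j ji js.
have BB : 0 < (B i * B (s i))^-1 by rewrite invr_gt0 mulr_gt0.
(* At the new vertex [q i] the form of the side [q i] is negative, so the other expansion is used
   there. *)
have [->|jq] := eqVneq j (q i).
  rewrite side_form_of_next' //.
  have -> : W i (nx (q i)) (ny (q i)) = 0.
    by have := side_form_next_succ B0 (q i); rewrite ord_predK.
  rewrite mulr0 add0r mulr_gt0 ?mulr_gt0 ?ear_gt0 //.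
  by apply: side_form_at_next_gt0; ord_neq.
rewrite side_form_of_next //.
have c1 : 0 < A (s i) * A (s (s i)) / (B i * B (s i)) by rewrite !mulr_gt0 ?ear_gt0.
have c2 : 0 < A i * (A (s (s i)) + B (s i)) / (B i * B (s i)).
  rewrite mulr_gt0 // mulr_gt0 ?ear_gt0 //.
  by apply: addr_gt0; rewrite ?ear_gt0.
have [jqq|jqq] := eqVneq (q i) (s j).
  rewrite ltr_wpDl //; first by rewrite mulr_ge0 ?(ltW c1) // side_form_at_next_ge0 // eq_sym.
  rewrite mulr_gt0 // side_form_at_next_gt0 //; first by rewrite eq_sym.
    by rewrite -jqq; ord_neq.
  by rewrite -[j]ordSK -jqq; ord_neq.
rewrite ltr_pwDl //; last by rewrite mulr_ge0 ?(ltW c2) // side_form_at_next_ge0 // eq_sym.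
rewrite mulr_gt0 // side_form_at_next_gt0 //; first by rewrite eq_sym.
by rewrite (can_eq (@ord_predK n)) eq_sym.
Qed.

Lemma glick_op_nextE a b c u v : glick_op nx ny a b c u v = glick_op x y a b c u v.
Proof.
by apply: glick_op_next => // i; rewrite gt_eqF // stretch_gt0.
Qed.

Lemma vertex_between_next i :
  exists2 t, 0 <= t <= 1 &
  x i = t * nx (q i) + (1 - t) * nx (s i) /\ y i = t * ny (q i) + (1 - t) * ny (s i).
Proof.
(* In units of the edge [i], the new vertices [q i] and [s i] lie at distance [e] before [i] and [f]
   beyond [s i]. *)
pose e := A (q i) / B (q i); pose f := A (s (s i)) / B (s i).
have e0 : 0 < e by rewrite divr_gt0 ?ear_gt0.
have f0 : 0 < f by rewrite divr_gt0 ?ear_gt0.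
have ef : 1 + e + f != 0 by rewrite gt_eqF // !addr_gt0.
have [ex ey] := next_tgt B0 (q i); rewrite !ord_predK in ex ey.
have h : 0 <= (1 + f) / (1 + e + f) <= 1.
  rewrite divr_ge0 ?addr_ge0 ?ler01 ?(ltW e0) ?(ltW f0) //=.
  by rewrite ler_pdivrMr ?mul1r ?addr_gt0 //; lra.
exists ((1 + f) / (1 + e + f)) => //.
rewrite ex ey -/e /nextx /nexty ordSK -/f /edgex /edgey.
by split; field.
Qed.

Lemma affine_ge0_of_next (a b c : R) :
  (forall i, 0 <= a * nx i + b * ny i + c) -> forall i, 0 <= a * x i + b * y i + c.
Proof.
move=> h i; have [t /andP[t0 t1] [-> ->]] := vertex_between_next i.
have -> : a * (t * nx (q i) + (1 - t) * nx (s i)) +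
   b * (t * ny (q i) + (1 - t) * ny (s i)) + c =
   t * (a * nx (q i) + b * ny (q i) + c) + (1 - t) * (a * nx (s i) + b * ny (s i) + c) by ring.
by rewrite addr_ge0 // mulr_ge0 // subr_ge0.
Qed.

End NextConvex.

Lemma glick_op_one x y u v :
  glick_op x y 0 0 1 u v =
  glick_op x y 0 0 1 0 0 + v * obstruction_x x y - u * obstruction_y x y.
Proof.
rewrite /glick_op /obstruction_x /obstruction_y !mulr_sumr -big_split -sumrB /=.
by apply: eq_bigr => i _; rewrite /diag_form; ring.
Qed.

End Polygon.

(** * Infinite convex orbits *)

Lemma geometric_small (R : archiRealFieldType) (e d D : R) :
  0 < e <= 1 -> (forall r : nat, d <= (1 - e) ^+ r * D) -> 0 <= D -> d <= 0.
Proof.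
move=> /andP[e0 e1] hd D0; rewrite leNgt; apply/negP => d0.
have bern r : (1 - e) ^+ r * (1 + r%:R * e) <= 1.
  elim: r => [|r IH]; first by rewrite expr0 mul0r addr0 mulr1.
  apply: le_trans IH; rewrite exprS -mulrA mulrCA; apply: ler_wpM2l.
    by apply: exprn_ge0; lra.
  have r0 : 0 <= r%:R * e :> R by rewrite mulr_ge0 ?ler0n // ltW.
  rewrite -natr1; nra.
have := archi_boundP (divr_ge0 D0 (ltW (mulr_gt0 d0 e0))).
set r := Num.bound _ => hr.
have r0 : 0 <= r%:R * e by rewrite mulr_ge0 ?ler0n // ltW.
have := bern r; have := hd r; set Q := (1 - e) ^+ r => h1 h2.
have h3 : D < r%:R * (d * e) by rewrite -ltr_pdivrMr // mulr_gt0.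
have Q0 : 0 <= Q by apply: exprn_ge0; lra.
have : d * (1 + r%:R * e) <= D.
  apply: (@le_trans _ _ (Q * (1 + r%:R * e) * D)); last by rewrite -[leRHS]mul1r ler_wpM2r.
  by rewrite mulrAC; apply: ler_wpM2r => //; lra.
by nra.
Qed.

Section Sequence.
Variables (R : archiRealFieldType) (n : nat) (hn : (5 <= n)%N).
Variables px py : nat -> 'I_n -> R.

Local Notation s := (@ordS n).
Local Notation q := (@ord_pred n).
Local Notation W k := (side_form (px k) (py k)).
Local Notation A k := (ear (px k) (py k)).
Local Notation B k := (turn2 (px k) (py k)).
Local Notation cr k := (edge_cross (px k) (py k)).
Local Notation nx k := (nextx (px k) (py k)).
Local Notation ny k := (nexty (px k) (py k)).

Hypothesis pos : forall k, pos_polygon (px k) (py k).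
Hypothesis Bgt0 : forall k i, 0 < B k i.
Hypothesis pxS : forall k i, px k.+1 i = nx k i.
Hypothesis pyS : forall k i, py k.+1 i = ny k i.

Let B0 k i : B k i != 0. Proof. by rewrite gt_eqF. Qed.
Let A0 k i : A k i != 0. Proof. by rewrite gt_eqF // ear_gt0. Qed.

Lemma glick_op_const k a b c u v :
  glick_op (px k) (py k) a b c u v = glick_op (px 0) (py 0) a b c u v.
Proof.
elim: k => // k <-; rewrite -(glick_op_nextE hn (pos k)) //.
apply: eq_bigr => i _; rewrite /diag_form /ear /edge_cross /edgex /edgey.
by rewrite !pxS !pyS.
Qed.

Lemma affine_ge0_pred k a b c :
  (forall i, 0 <= a * px k.+1 i + b * py k.+1 i + c) ->
  forall i, 0 <= a * px k i + b * py k i + c.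
Proof.
move=> h; apply: affine_ge0_of_next => // i; by rewrite -pxS -pyS.
Qed.

Lemma affine_ge0_start k a b c :
  (forall i, 0 <= a * px k i + b * py k i + c) ->
  forall i, 0 <= a * px 0 i + b * py 0 i + c.
Proof. by elim: k => // k IH /affine_ge0_pred. Qed.

(** The centroid of the first polygon is the reference point of the Harnack inequality for all
    [k]. *)
Let ox : R := (\sum_i px 0 i) / n%:R.
Let oy : R := (\sum_i py 0 i) / n%:R.

Let n0 : n%:R != 0 :> R. Proof. by rewrite pnatr_eq0; lia. Qed.

Lemma affine_centroid a b c :
  a * ox + b * oy + c = (\sum_i (a * px 0 i + b * py 0 i + c)) / n%:R.
Proof.
rewrite !big_split /= -!mulr_sumr sumr_const card_ord -mulr_natr /ox /oy.
by field.
Qed.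

Lemma side_form_affine k l u v :
  W k l u v = - edgey (py k) l * u + edgex (px k) l * v +
              (edgey (py k) l * px k l - edgex (px k) l * py k l).
Proof. by rewrite /side_form; ring. Qed.

Lemma affine_eq0 k i a b c :
  a * px k i + b * py k i + c = 0 ->
  a * px k (s i) + b * py k (s i) + c = 0 ->
  a * px k (q i) + b * py k (q i) + c = 0 -> a = 0 /\ b = 0.
Proof.
move=> h1 h2 h3.
have Ea : a * A k i =
  edgey (py k) i * ((a * px k i + b * py k i + c) - (a * px k (q i) + b * py k (q i) + c)) -
  edgey (py k) (q i) * ((a * px k (s i) + b * py k (s i) + c) - (a * px k i + b * py k i + c)).
  by rewrite /ear /edge_cross /edgex /edgey ord_predK; ring.
have Eb : b * A k i =
  edgex (px k) (q i) * ((a * px k (s i) + b * py k (s i) + c) - (a * px k i + b * py k i + c)) -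
  edgex (px k) i * ((a * px k i + b * py k i + c) - (a * px k (q i) + b * py k (q i) + c)).
  by rewrite /ear /edge_cross /edgex /edgey ord_predK; ring.
rewrite h1 h2 h3 !subrr !mulr0 subrr in Ea; rewrite h1 h2 h3 !subrr !mulr0 subrr in Eb.
by split; apply/eqP; [move/eqP: Ea|move/eqP: Eb]; rewrite mulf_eq0 (negPf (A0 k i)) orbF.
Qed.

Lemma side_form_start_ge0 k l i : 0 <= W k l (px 0 i) (py 0 i).
Proof.
rewrite side_form_affine; apply: (@affine_ge0_start k) => j.
by rewrite -side_form_affine side_form_ge0.
Qed.

Lemma side_form_centroid_gt0 k l : 0 < W k l ox oy.
Proof.
rewrite lt_neqAle; apply/andP; split; last first.
  rewrite side_form_affine affine_centroid divr_ge0 ?ler0n // sumr_ge0 // => i _.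
  by rewrite -side_form_affine side_form_start_ge0.
apply/eqP => /esym; rewrite side_form_affine affine_centroid => /eqP.
rewrite mulf_eq0 invr_eq0 (negPf n0) orbF psumr_eq0; last first.
  by move=> i _; rewrite -side_form_affine side_form_start_ge0.
move=> /allP h.
have z i : - edgey (py k) l * px 0 i + edgex (px k) l * py 0 i +
              (edgey (py k) l * px k l - edgex (px k) l * py k l) = 0.
  by apply/eqP; apply: h; rewrite mem_index_enum.
have [/eqP ey /eqP ex] := affine_eq0 (z l) (z (s l)) (z (q l)).
have := pos k (i := l) (j := q l).
rewrite side_form_affine; rewrite oppr_eq0 in ey; rewrite (eqP ey) (eqP ex).
rewrite oppr0 !mul0r subrr !addr0 ltxx => H.
suff: false by []. by apply: H; ord_neq.
Qed.

(** Bounds [M g + g] by [g] at the centroid, for [g] nonnegative on the first polygon. It serves all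
    [k] at once because [M] is the same for all polygons of the orbit; the factor [n] undoes the
    averaging in the centroid. *)
Definition glick_bound : R := n%:R * (\sum_i `|diag_form (px 0) (py 0) i ox oy / A 0 i|) + 1.
Local Notation C := glick_bound.

Lemma glick_bound_ge0 : 0 <= C.
Proof. by rewrite addr_ge0 // mulr_ge0 ?ler0n // sumr_ge0. Qed.

Lemma glick_op_centroid_le a b c :
  (forall i, 0 <= a * px 0 i + b * py 0 i + c) ->
  glick_op (px 0) (py 0) a b c ox oy + (a * ox + b * oy + c) <= C * (a * ox + b * oy + c).
Proof.
move=> h; rewrite /C mulrDl mul1r lerD2r mulrAC affine_centroid mulrCA divff // mulr1.
rewrite mulr_suml ler_sum // => i _; rewrite -mulrA ler_wpM2l //.
apply: le_trans (ler_norm _) _.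
by rewrite (bigD1 i) //= lerDl sumr_ge0.
Qed.

(** Apply [glick_op_centroid_le] to the side form [l] and expand by sides: the term [l] is minus the
    form itself and the others are nonnegative, so each of them obeys the bound. *)
Lemma cross_value_bound k l j : l != j ->
  W k l (nx k j) (ny k j) * W k j ox oy * B k j / (A k j * A k (s j)) <= C * W k l ox oy.
Proof.
move=> lj.
have := glick_op_centroid_le (a := - edgey (py k) l) (b := edgex (px k) l)
  (c := edgey (py k) l * px k l - edgex (px k) l * py k l).
rewrite -(glick_op_const k) glick_op_sides // -side_form_affine => /(_ _).
have E i : (- edgey (py k) l * nx k i + edgex (px k) l * ny k i +
    (edgey (py k) l * px k l - edgex (px k) l * py k l)) = W k l (nx k i) (ny k i).
  by rewrite -side_form_affine.
under eq_bigr => i _ do rewrite E.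
rewrite (bigD1 l) //= side_form_next_self // (bigD1 j) 1?eq_sym //= => h.
apply: le_trans (h _); last first.
  by move=> i; rewrite -side_form_affine side_form_start_ge0.
have -> : - (A k l * A k (s l) / B k l) * W k l ox oy * B k l / (A k l * A k (s l)) = - W k l ox oy.
  by have := A0 k l; have := A0 k (s l); have := B0 k l => h1 h2 h3; field; rewrite h1 h2 h3.
rewrite [leRHS]addrAC addNr add0r lerDl sumr_ge0 // => i /andP[il ij].
apply: divr_ge0; last by rewrite mulr_ge0 // ltW // ear_gt0.
rewrite mulr_ge0 ?(ltW (Bgt0 _ _)) // mulr_ge0 ?(ltW (side_form_centroid_gt0 _ _)) //.
by rewrite side_form_at_next_ge0 // eq_sym.
Qed.

(** The differences of the two sides sum to zero over [l], since the edges do. *)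
Lemma far_side k u v : exists l, W k l ox oy <= W k l u v.
Proof.
have i0 : 'I_n by exact: (@Ordinal n 0 ltac:(lia)).
apply/existsP; rewrite -[X in is_true X]negbK negb_exists; apply/negP => /forallP H.
have lt l : 0 < W k l ox oy - W k l u v.
  by rewrite subr_gt0 ltNge H.
have : 0 < \sum_l (W k l ox oy - W k l u v).
  rewrite (bigD1 i0) //= ltr_pwDl // sumr_ge0 // => i _; exact: ltW.
rewrite (eq_bigr (fun l => (oy - v) * (px k (s l) - px k l) - (ox - u) * (py k (s l) - py k l))).
  rewrite sumrB -!mulr_sumr !sumrB (sum_ordS (px k)) (sum_ordS (py k)).
  by rewrite !subrr !mulr0 subrr ltxx.
by move=> l _; rewrite /side_form /edgex /edgey; ring.
Qed.

(** A barycentric coordinate of the centroid is bounded uniformly in [k]: take a side [l] whose form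
    is at least as large at the vertex [j] as at the centroid, and insert the barycentric expansion
    of that form into [cross_value_bound]. *)
Lemma succ_coef_le k j : W k (s j) ox oy / A k (s j) <= 1 + C.
Proof.
have [l hl] := far_side k (px k j) (py k j).
have lj : l != j.
  by apply: contraTneq hl => ->; rewrite side_form_src -ltNge side_form_centroid_gt0.
have Wl : 0 < W k l (px k j) (py k j) := lt_le_trans (side_form_centroid_gt0 k l) hl.
have := cross_value_bound k lj.
have := side_expansion (B0 k) (A0 k) j (- edgey (py k) l) (edgex (px k) l)
  (edgey (py k) l * px k l - edgex (px k) l * py k l) ox oy.
rewrite -!side_form_affine => ->.
have : 0 <= W k l (px k (s j)) (py k (s j)) * W k (q j) ox oy / A k j.
  by rewrite divr_ge0 ?(ltW (ear_gt0 _ _ _)) // mulr_ge0 ?side_form_ge0 // ltW // side_form_centroid_gt0.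
have C0 := glick_bound_ge0; have Wo := side_form_centroid_gt0 k l.
have C1 : 0 <= 1 + C by lra.
move=> h1 h2; rewrite -(ler_pM2l Wl) mulrA; have := ler_wpM2l C1 hl; lra.
Qed.

Lemma pred_coef_le k j : W k (q j) ox oy / A k j <= 1 + C.
Proof.
have [l hl] := far_side k (px k (s j)) (py k (s j)).
have lj : l != j.
  by apply: contraTneq hl => ->; rewrite side_form_tgt -ltNge side_form_centroid_gt0.
have Wl : 0 < W k l (px k (s j)) (py k (s j)) := lt_le_trans (side_form_centroid_gt0 k l) hl.
have := cross_value_bound k lj.
have := side_expansion (B0 k) (A0 k) j (- edgey (py k) l) (edgex (px k) l)
  (edgey (py k) l * px k l - edgex (px k) l * py k l) ox oy.
rewrite -!side_form_affine => ->.
have : 0 <= W k l (px k j) (py k j) * W k (s j) ox oy / A k (s j).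
  by rewrite divr_ge0 ?(ltW (ear_gt0 _ _ _)) // mulr_ge0 ?side_form_ge0 // ltW // side_form_centroid_gt0.
have C0 := glick_bound_ge0; have Wo := side_form_centroid_gt0 k l.
have C1 : 0 <= 1 + C by lra.
move=> h1 h2; rewrite -(ler_pM2l Wl) mulrA; have := ler_wpM2l C1 hl; lra.
Qed.

(** In the barycentric expansion of the centroid the new vertex contributes a nonpositive term, and
    the two other coordinates are at most [1 + C]. *)
Lemma centroid_le_edge k j a b c :
  (forall i, 0 <= a * px k.+1 i + b * py k.+1 i + c) ->
  a * ox + b * oy + c <=
  (1 + C) * ((a * px k j + b * py k j + c) + (a * px k (s j) + b * py k (s j) + c)).
Proof.
move=> h; have h0 := affine_ge0_pred h.
have := side_expansion (B0 k) (A0 k) j a b c ox oy.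
have : 0 <= (a * nx k j + b * ny k j + c) * W k j ox oy * B k j / (A k j * A k (s j)).
  apply: divr_ge0; last by rewrite mulr_ge0 // ltW // ear_gt0.
  rewrite mulr_ge0 ?(ltW (Bgt0 _ _)) // mulr_ge0 ?(ltW (side_form_centroid_gt0 _ _)) //.
  by rewrite -pxS -pyS.
have := ler_wpM2l (h0 j) (succ_coef_le k j).
have := ler_wpM2l (h0 (s j)) (pred_coef_le k j).
rewrite !mulrA; lra.
Qed.

(** The Harnack inequality. If the form is no larger at a neighbour of [j] than at [j], use the edge
    joining them. Otherwise it is no larger than at [j] at the new vertices [q j] and [j], which lie
    on the two sides extended beyond [j]; use the edge joining these in the next polygon. *)
Lemma centroid_le_vertex k j a b c :
  (forall i, 0 <= a * px k.+2 i + b * py k.+2 i + c) ->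
  a * ox + b * oy + c <= 2 * (1 + C) * (a * px k j + b * py k j + c).
Proof.
move=> h2; have h1 := affine_ge0_pred h2; have h0 := affine_ge0_pred h1.
have C0 := glick_bound_ge0.
have C1 : 0 <= 1 + C by lra.
have [c1|c1] := leP (a * px k (s j) + b * py k (s j) + c) (a * px k j + b * py k j + c).
  have := centroid_le_edge j h1; have := ler_wpM2l C1 c1; lra.
have [c2|c2] := leP (a * px k (q j) + b * py k (q j) + c) (a * px k j + b * py k j + c).
  have := centroid_le_edge (q j) h1; rewrite ord_predK; have := ler_wpM2l C1 c2; lra.
have := centroid_le_edge (q j) h2; rewrite ord_predK => h; apply: (le_trans h).
rewrite [2 * _]mulrC -mulrA; apply: ler_wpM2l => //.
rewrite !pxS !pyS; have [-> ->] := next_tgt (B0 k) (q j).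
rewrite ord_predK /nextx /nexty /edgex /edgey ord_predK.
set t := A k (q j) / _; set r := A k (s j) / _.
have t0 : 0 <= t by rewrite divr_ge0 // ltW // ear_gt0.
have r0 : 0 <= r by rewrite divr_ge0 // ltW // ear_gt0.
have k1 : 0 <= t * ((a * px k (s j) + b * py k (s j) + c) - (a * px k j + b * py k j + c)).
  by rewrite mulr_ge0 // subr_ge0 ltW.
have k2 : 0 <= r * ((a * px k (q j) + b * py k (q j) + c) - (a * px k j + b * py k j + c)).
  by rewrite mulr_ge0 // subr_ge0 ltW.
lra.
Qed.

Theorem obstruction0_of_iterates :
  obstruction_x (px 0) (py 0) = 0 /\ obstruction_y (px 0) (py 0) = 0.
Proof.
pose a := - obstruction_y (px 0) (py 0); pose b := obstruction_x (px 0) (py 0).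
pose c := glick_op (px 0) (py 0) 0 0 1 0 0.
have fE u v : glick_op (px 0) (py 0) 0 0 1 u v = a * u + b * v + c.
  by rewrite glick_op_one /a /b /c; ring.
have f0 k i : 0 <= a * px k i + b * py k i + c.
  rewrite -fE -(glick_op_const k) glick_op_sides // sumr_ge0 // => j _.
  rewrite !mul0r !add0r mul1r divr_ge0 //; last by rewrite mulr_ge0 // ltW // ear_gt0.
  by rewrite mulr_ge0 ?side_form_ge0 // ltW.
have C0 := glick_bound_ge0.
(* The inverse of the Harnack constant. Applied to the form minus its current lower bound, the
   inequality brings this bound closer to the centroid value [D] by the factor [1 - e]. *)
pose e := (2 * (1 + C))^-1.
have e01 : 0 < e <= 1.
  have h : 1 <= 2 * (1 + C) by lra.
  by rewrite invr_gt0 invf_le1 ?(lt_le_trans ltr01).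
have [e0 e1] := andP e01.
pose D := a * ox + b * oy + c.
have key r : forall k i, D - (1 - e) ^+ r * D <= a * px k i + b * py k i + c.
  elim: r => [|r IH] k i; first by rewrite expr0 mul1r subrr.
  have := @centroid_le_vertex k i a b (c - (D - (1 - e) ^+ r * D)).
  have -> : a * ox + b * oy + (c - (D - (1 - e) ^+ r * D)) = (1 - e) ^+ r * D by rewrite /D; ring.
  move=> /(_ _) h.
  have : (1 - e) ^+ r * D <= 2 * (1 + C) * (a * px k i + b * py k i + (c - (D - (1 - e) ^+ r * D))).
    by apply: h => j; rewrite addrA subr_ge0.
  rewrite -ler_pdivrMl ?mulr_gt0 //; last by lra.
  rewrite -/e exprS; lra.
have D0 : 0 <= D.
  by rewrite /D affine_centroid divr_ge0 // sumr_ge0.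
have ge i : D <= a * px 0 i + b * py 0 i + c.
  rewrite -subr_le0; apply: (geometric_small e01 _ D0) => r.
  by have := key r 0 i; lra.
(* The lower bound [D] is also the mean over the vertices, so it is attained at all of them. *)
have : \sum_i (a * px 0 i + b * py 0 i + c - D) = 0.
  rewrite sumrB sumr_const card_ord -mulr_natr /D affine_centroid divfK // subrr //.
move=> /eqP; rewrite psumr_eq0; last by move=> i _; rewrite subr_ge0.
move=> /allP z.
have {}z i : a * px 0 i + b * py 0 i + (c - D) = 0.
  by apply/eqP; rewrite addrA; apply: z; rewrite mem_index_enum.
have i0 : 'I_n by exact: (@Ordinal n 0 ltac:(lia)).
have [ha hb] := affine_eq0 (z i0) (z (s i0)) (z (q i0)).
by split => //; apply/eqP; rewrite -oppr_eq0 -/a ha.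
Qed.

End Sequence.

Lemma ordS_ind n (Q : 'I_n -> Prop) : (forall i, Q i -> Q (ordS i)) -> forall i j, Q i -> Q j.
Proof.
move=> h i j Qi; suff -> : j = iter (j + (n - i)) (@ordS n) i.
  by elim: (j + (n - i))%N => //= k; exact: h.
apply: val_inj; rewrite val_iter_ordS addnCA subnKC ?modnDr ?modn_small //.
exact: ltnW.
Qed.

(** * Projective polygons *)

Section Flip.
Variables (R : realFieldType) (n : nat) (hn : (5 <= n)%N).
Variables x y : 'I_n -> R.
Local Notation yN := (fun i => - y i).

Lemma side_form_flip i u v : side_form x yN i u (- v) = - side_form x y i u v.
Proof. by rewrite /side_form /edgex /edgey; ring. Qed.

Lemma edge_cross_flip i j : edge_cross x yN i j = - edge_cross x y i j.
Proof. by rewrite /edge_cross /edgex /edgey; ring. Qed.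

Lemma obstruction_x_flip : obstruction_x x yN = - obstruction_x x y.
Proof.
by rewrite /obstruction_x -sumrN; apply: eq_bigr => i _; rewrite /ear edge_cross_flip invrN mulrN.
Qed.

Lemma obstruction_y_flip : obstruction_y x yN = obstruction_y x y.
Proof.
rewrite /obstruction_y; apply: eq_bigr => i _.
by rewrite /ear edge_cross_flip invrN mulrN -mulNr; congr (_ / _); ring.
Qed.
End Flip.

Section Link.
Variables (R : realType) (n : nat) (hn : (5 <= n)%N).
Implicit Types P Q : 'M[R]_(n, 2).

Definition coordx P (i : 'I_n) : R := P i 0.
Definition coordy P (i : 'I_n) : R := P i 1.

Lemma orient_side_form P i j :
  orient (row i P) (row (ordS i) P) (row j P) =
  side_form (coordx P) (coordy P) i (coordx P j) (coordy P j).
Proof. by rewrite /orient !mxE. Qed.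

(** The sign could a priori depend on the side, but the sides [i] and [s i] share the triangle [i],
    [s i], [s (s i)]. *)
Lemma convex_polygonP P : convex_polygon P <->
  pos_polygon (coordx P) (coordy P) \/ pos_polygon (coordx P) (fun i => - coordy P i).
Proof.
set x := coordx P; set y := coordy P.
split; last first.
  case=> h i; [left|right] => j ji js; rewrite orient_side_form; first exact: h.
  by have := h i j ji js; rewrite side_form_flip oppr_gt0.
move=> h.
have step i : (forall j, j != i -> j != ordS i -> 0 < side_form x y i (x j) (y j)) ->
   (forall j, j != ordS i -> j != ordS (ordS i) -> 0 < side_form x y (ordS i) (x j) (y j)).
  move=> hi; have h1 : 0 < side_form x y i (x (ordS (ordS i))) (y (ordS (ordS i))).
    by apply: hi; ord_neq.
  case: (h (ordS i)) => h' j ji js; have := h' j ji js; rewrite orient_side_form // => _.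
  have : side_form x y (ordS i) (x i) (y i) < 0.
    by rewrite -orient_side_form; apply: h'; ord_neq.
  have -> : side_form x y (ordS i) (x i) (y i) = side_form x y i (x (ordS (ordS i))) (y (ordS (ordS i))).
    by rewrite /side_form /edgex /edgey; ring.
  by move/(lt_trans h1); rewrite ltxx.
have [[i hi]|no] := pselect (exists i, forall j, j != i -> j != ordS i -> 0 < side_form x y i (x j) (y j)).
  by left=> j; exact: (@ordS_ind n (fun i => forall j, j != i -> j != ordS i -> 0 < side_form x y i (x j) (y j)) step i j hi).
right=> i j ji js; rewrite side_form_flip oppr_gt0.
case: (h i) => h'; last by rewrite -orient_side_form; exact: h'.
by case: no; exists i => k ki ks; rewrite -orient_side_form; apply: h'.
Qed.

Definition lift (p : 'rV[R]_2) : 'rV[R]_(2 + 1) := row_mx p (const_mx 1).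

Lemma lift0 p : lift p 0 (lshift 1 0) = p 0 0. Proof. by rewrite row_mxEl. Qed.
Lemma lift1 p : lift p 0 (lshift 1 1) = p 0 1. Proof. by rewrite row_mxEl. Qed.
Lemma lift2 p : lift p 0 (rshift 2 0) = 1. Proof. by rewrite row_mxEr mxE. Qed.

Lemma scaleE k p f : (k *: lift p) 0 f = k * lift p 0 f.
Proof. by rewrite mxE. Qed.
Lemma combE k l p r f : (k *: lift p + l *: lift r) 0 f = k * lift p 0 f + l * lift r 0 f.
Proof. by rewrite mxE !scaleE. Qed.

Lemma rV3P (u v : 'rV[R]_(2 + 1)) :
  u 0 (lshift 1 0) = v 0 (lshift 1 0) -> u 0 (lshift 1 1) = v 0 (lshift 1 1) ->
  u 0 (rshift 2 0) = v 0 (rshift 2 0) -> u = v.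
Proof.
move=> h0 h1 h2; apply/rowP => k; have [j ->|j ->] := split_ordP k; last by rewrite ord1.
case: j => -[|[|//]] hj.
  by rewrite (_ : Ordinal hj = 0) //; apply: val_inj.
by rewrite (_ : Ordinal hj = 1) //; apply: val_inj.
Qed.

Lemma mem_chart_add (a b : 'rV[R]_2) v :
  reflect (exists k l, v = k *: lift a + l *: lift b) (v \in (chart a + chart b)%VS).
Proof.
apply: (iffP memv_addP) => [[u /vlineP[k ->] [w /vlineP[l ->] ->]]|[k [l ->]]].
  by exists k, l.
exists (k *: lift a); first exact/vlineP/ex_intro.
by exists (l *: lift b) => //; apply/vlineP; exists l.
Qed.

Section OnePolygon.
Variable P : 'M[R]_(n, 2).
Local Notation x := (coordx P).
Local Notation y := (coordy P).

Lemma inv_pentagram_incident i (z : 'rV[R]_2) : inv_pentagram (to_proj P) i = chart z ->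
  side_form x y (ord_pred i) (z 0 0) (z 0 1) = 0 /\
  side_form x y (ordS i) (z 0 0) (z 0 1) = 0.
Proof.
rewrite /inv_pentagram /side /to_proj ord_predK => E.
have : lift z \in chart z by exact: memv_line.
rewrite -E memv_cap => /andP[/mem_chart_add[k [l e1]] /mem_chart_add[k' [l' e2]]].
have ev (f : 'I_(2+1)) : forall u w : 'rV[R]_(2+1), u = w -> u 0 f = w 0 f by move=> u w ->.
have := ev (lshift 1 0) _ _ e1; have := ev (lshift 1 1) _ _ e1; have := ev (rshift 2 0) _ _ e1.
have := ev (lshift 1 0) _ _ e2; have := ev (lshift 1 1) _ _ e2; have := ev (rshift 2 0) _ _ e2.
rewrite !combE !lift0 !lift1 !lift2 ![row _ _ _ _]mxE.
rewrite /side_form /edgex /edgey ord_predK /coordx /coordy => h1 h2 h3 h4 h5 h6.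
rewrite h2 h3; split; last first.
  by rewrite (_ : k' = 1 - l'); [ring | move: h1; lra].
rewrite -h2 -h3 h5 h6 (_ : k = 1 - l); [ring | move: h4; lra].
Qed.

(** The point is an affine combination along both sides. Conversely, a vector in both planes
    satisfies the homogeneous equations [wq] and [ws], whose solutions form a line because
    [turn2 i != 0]. *)
Lemma inv_pentagram_next i (z : 'rV[R]_2) : turn2 x y i != 0 ->
  z 0 0 = nextx x y i -> z 0 1 = nexty x y i ->
  inv_pentagram (to_proj P) i = chart z.
Proof.
move=> Bi z0 z1; rewrite /inv_pentagram /side /to_proj ord_predK.
have zt : z 0 0 = x (ordS i) - ear x y i / turn2 x y i * edgex x (ordS i) /\
   z 0 1 = y (ordS i) - ear x y i / turn2 x y i * edgey y (ordS i).
  by rewrite z0 z1 /nextx /nexty; move: Bi;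
    rewrite /turn2 /ear /edge_cross /edgex /edgey ?ord_predK ?ordSK => h; split; field.
apply/eqP; rewrite eqEsubv; apply/andP; split; last first.
  apply/subvP => _ /vlineP[c ->]; apply: memvZ; rewrite memv_cap.
  apply/andP; split; apply/mem_chart_add.
    set t := ear x y (ordS i) / turn2 x y i.
    exists (- t), (1 + t); apply: rV3P;
      rewrite ?combE ?scaleE ?lift0 ?lift1 ?lift2 ?[row _ _ _ _]mxE.
    + by rewrite z0 /nextx -/t /edgex ord_predK /coordx; ring.
    + by rewrite z1 /nexty -/t /edgey ord_predK /coordy; ring.
    + ring.
  case: zt; set t := ear x y i / turn2 x y i => zt0 zt1.
  exists (1 + t), (- t); apply: rV3P;
      rewrite ?combE ?scaleE ?lift0 ?lift1 ?lift2 ?[row _ _ _ _]mxE.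
  + by rewrite zt0 /edgex /coordx; ring.
  + by rewrite zt1 /edgey /coordy; ring.
  + ring.
apply/subvP => v; rewrite memv_cap => /andP[/mem_chart_add[k [l e1]] /mem_chart_add[k' [l' e2]]].
have ev (f : 'I_(2+1)) : forall u w : 'rV[R]_(2+1), u = w -> u 0 f = w 0 f by move=> u w ->.
have := ev (lshift 1 0) _ _ e1; have := ev (lshift 1 1) _ _ e1; have := ev (rshift 2 0) _ _ e1.
have := ev (lshift 1 0) _ _ e2; have := ev (lshift 1 1) _ _ e2; have := ev (rshift 2 0) _ _ e2.
rewrite !combE !lift0 !lift1 !lift2 ![row _ _ _ _]mxE.
rewrite -/(coordx P _) -/(coordy P _).
set v2 := v 0 (rshift 2 0); set v1 := v 0 (lshift 1 1); set v0 := v 0 (lshift 1 0) => h3 h2 h1 h6 h5 h4.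
have wq : edgex x (ord_pred i) * (v1 - y i * v2) - edgey y (ord_pred i) * (v0 - x i * v2) = 0.
  by rewrite h4 h5 h6 /edgex /edgey ord_predK /coordx /coordy; ring.
have ws : edgex x (ordS i) * (v1 - y (ordS i) * v2) - edgey y (ordS i) * (v0 - x (ordS i) * v2) = 0.
  by rewrite h1 h2 h3 /edgex /edgey /coordx /coordy; ring.
have Ex : turn2 x y i * (v0 - x i * v2) = ear x y (ordS i) * v2 * edgex x (ord_pred i).
  move: wq ws; rewrite /turn2 /ear ordSK /edge_cross => wq ws.
  transitivity (((edgex x i * edgey y (ordS i) - edgey y i * edgex x (ordS i)) * v2 -
     (edgex x (ordS i) * (v1 - y (ordS i) * v2) - edgey y (ordS i) * (v0 - x (ordS i) * v2))) * edgex x (ord_pred i)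
     + (edgex x (ord_pred i) * (v1 - y i * v2) - edgey y (ord_pred i) * (v0 - x i * v2)) * edgex x (ordS i)).
    by rewrite /edgex /edgey ord_predK; ring.
  by rewrite wq ws mul0r addr0 subr0.
have Ey : turn2 x y i * (v1 - y i * v2) = ear x y (ordS i) * v2 * edgey y (ord_pred i).
  move: wq ws; rewrite /turn2 /ear ordSK /edge_cross => wq ws.
  transitivity (((edgex x i * edgey y (ordS i) - edgey y i * edgex x (ordS i)) * v2 -
     (edgex x (ordS i) * (v1 - y (ordS i) * v2) - edgey y (ordS i) * (v0 - x (ordS i) * v2))) * edgey y (ord_pred i)
     + (edgex x (ord_pred i) * (v1 - y i * v2) - edgey y (ord_pred i) * (v0 - x i * v2)) * edgey y (ordS i)).
    by rewrite /edgex /edgey ord_predK; ring.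
  by rewrite wq ws mul0r addr0 subr0.
apply/vlineP; exists v2; apply: rV3P; rewrite ?scaleE ?lift0 ?lift1 ?lift2.
- rewrite -/v0 z0 /nextx; apply: (mulfI Bi).
  rewrite mulrCA mulrDr mulrA [turn2 x y i * (_ / _)]mulrC divfK //.
  by move: Ex; rewrite mulrBr => /eqP; rewrite subr_eq => /eqP ->; ring.
- rewrite -/v1 z1 /nexty; apply: (mulfI Bi).
  rewrite mulrCA mulrDr mulrA [turn2 x y i * (_ / _)]mulrC divfK //.
  by move: Ey; rewrite mulrBr => /eqP; rewrite subr_eq => /eqP ->; ring.
- by rewrite -/v2 mulr1.
Qed.

End OnePolygon.
End Link.

Section NextObstruction.
Variables (R : realFieldType) (n : nat) (hn : (5 <= n)%N).
Variables x y : 'I_n -> R.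
Local Notation yN := (fun i => - y i).

Lemma next_flip : (forall i, turn2 x y i != 0) ->
  (nextx x yN = nextx x y) /\ (nexty x yN = fun i => - nexty x y i).
Proof.
move=> B0; split; apply: funext => i; have b := B0 i.
  by rewrite /nextx /ear /turn2 !edge_cross_flip invrN mulrNN.
rewrite /nexty /ear /turn2 !edge_cross_flip invrN mulrNN /edgey; ring.
Qed.

Lemma obstruction_next : pos_polygon x y -> (forall i, 0 < turn2 x y i) ->
  obstruction_x (nextx x y) (nexty x y) = obstruction_x x y /\
  obstruction_y (nextx x y) (nexty x y) = obstruction_y x y.
Proof.
move=> pos B0; have E u v := glick_op_nextE hn pos B0 0 0 1 u v.
have := E 0 0; have := E 0 1; have := E 1 0.
rewrite !(glick_op_one _ _ _ 1) !(glick_op_one _ _ 1 _); lra.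
Qed.

Lemma convex_incident_next (x' y' : 'I_n -> R) : pos_polygon x y ->
  pos_polygon x' y' \/ pos_polygon x' (fun i => - y' i) ->
  (forall i, side_form x y (ord_pred i) (x' i) (y' i) = 0) ->
  (forall i, side_form x y (ordS i) (x' i) (y' i) = 0) ->
  [/\ forall i, 0 < turn2 x y i, x' = nextx x y & y' = nexty x y].
Proof.
move=> pos conv w1 w2.
have ex : x' = nextx x y by apply: funext => i; have [] := incident_next hn pos (w1 i) (w2 i).
have ey : y' = nexty x y by apply: funext => i; have [] := incident_next hn pos (w1 i) (w2 i).
split=> //.
have B0 i : turn2 x y i != 0 by have [] := incident_next hn pos (w1 i) (w2 i).
rewrite ex ey in conv.
have self u v i : diag_form u v i (u i) (v i) = - ear u v i.
  by rewrite /diag_form /ear /edge_cross /edgex /edgey ord_predK; ring.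
case: conv => conv.
  apply: (turn2_gt0_of_next_convex hn pos (e := 1)) => // [i j *|i].
    by rewrite mul1r; apply: diag_form_gt0.
  by rewrite mul1r self oppr_lt0 ear_gt0.
apply: (turn2_gt0_of_next_convex hn pos (e := -1)) => // [i j a b c|i].
  have := diag_form_gt0 conv a b c; rewrite /diag_form; lra.
have := ear_gt0 hn conv i; rewrite mulN1r self opprK /ear edge_cross_flip; lra.
Qed.

End NextObstruction.

(** * Convexity of all iterates is equivalent to the vanishing of the obstruction *)

Section ForeverConvex.
Variables (R : realType) (n : nat) (hn : (5 <= n)%N).
Implicit Types P Q : 'M[R]_(n, 2).

Lemma obstruction0_of_incident_sequence (X Y : nat -> 'I_n -> R) :
  pos_polygon (X 0) (Y 0) ->
  (forall k, pos_polygon (X k) (Y k) \/ pos_polygon (X k) (fun i => - Y k i)) ->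
  (forall k i, side_form (X k) (Y k) (ord_pred i) (X k.+1 i) (Y k.+1 i) = 0) ->
  (forall k i, side_form (X k) (Y k) (ordS i) (X k.+1 i) (Y k.+1 i) = 0) ->
  obstruction_x (X 0) (Y 0) = 0 /\ obstruction_y (X 0) (Y 0) = 0.
Proof.
move=> p0 conv w1 w2.
have pos k : pos_polygon (X k) (Y k).
  elim: k => // k IH.
  have [B ex ey] := convex_incident_next hn IH (conv k.+1) (w1 k) (w2 k).
  by rewrite ex ey; apply: next_pos.
have st k := convex_incident_next hn (pos k) (conv k.+1) (w1 k) (w2 k).
apply: (obstruction0_of_iterates hn pos) => [k|k i|k i]; first by have [] := st k.
  by have [_ ->] := st k.
by have [_ _ ->] := st k.
Qed.

Definition obstruction0 P : Prop :=
  obstruction_x (coordx P) (coordy P) = 0 /\ obstruction_y (coordx P) (coordy P) = 0.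

Lemma obstruction0_forever P : forever_convex P -> obstruction0 P.
Proof.
move=> [convP it].
have /choice[PS hPS] : forall k, exists Q, convex_polygon Q /\
    iter k (@inv_pentagram R n) (to_proj P) = to_proj Q.
  by move=> k; have [Q cQ eQ] := it k; exists Q; split=> //; apply: funext => i; exact: eQ.
(* The polygon chosen at index [0] is not known to be [P], hence the replacement. *)
pose PT k := if k is 0 then P else PS k.
have cT k : convex_polygon (PT k) by case: k => [//|k]; have [] := hPS k.+1.
have eT k : iter k (@inv_pentagram R n) (to_proj P) = to_proj (PT k).
  by case: k => [//|k]; have [] := hPS k.+1.
have inc k i := @inv_pentagram_incident R n (PT k) i (row i (PT k.+1)).
have {}inc k i : side_form (coordx (PT k)) (coordy (PT k)) (ord_pred i) (coordx (PT k.+1) i) (coordy (PT k.+1) i) = 0 /\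
   side_form (coordx (PT k)) (coordy (PT k)) (ordS i) (coordx (PT k.+1) i) (coordy (PT k.+1) i) = 0.
  by have := inc k i; rewrite -eT -/(iter k.+1 _ _) eT !mxE; apply.
have /(convex_polygonP hn)[p0|p0] := convP.
  apply: (@obstruction0_of_incident_sequence (fun k => coordx (PT k)) (fun k => coordy (PT k))) => //.
  - by move=> k; apply/(convex_polygonP hn).
  - by move=> k i; have [] := inc k i.
  - by move=> k i; have [] := inc k i.
have [] := @obstruction0_of_incident_sequence (fun k => coordx (PT k)) (fun k i => - coordy (PT k) i) p0.
- move=> k; have /(convex_polygonP hn)[h|h] := cT k; [right|left] => //.
  by rewrite (_ : (fun i => _) = coordy (PT k)) //; apply: funext => i; rewrite opprK.
- by move=> k i; have [h _] := inc k i; rewrite side_form_flip h oppr0.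
- by move=> k i; have [_ h] := inc k i; rewrite side_form_flip h oppr0.
rewrite obstruction_x_flip obstruction_y_flip => /eqP; rewrite oppr_eq0 => /eqP.
by split.
Qed.

Lemma obstruction0_step P : convex_polygon P -> obstruction0 P ->
  exists2 Q, convex_polygon Q /\ obstruction0 Q & inv_pentagram (to_proj P) = to_proj Q.
Proof.
move=> convP; rewrite /obstruction0; set x := coordx P; set y := coordy P => -[ox oy].
pose Q : 'M[R]_(n, 2) := \matrix_(i, j) if j == 0 then nextx x y i else nexty x y i.
have Qx : coordx Q = nextx x y by apply: funext => i; rewrite /coordx mxE.
have Qy : coordy Q = nexty x y by apply: funext => i; rewrite /coordy mxE.
have fin : (forall i, turn2 x y i != 0) -> inv_pentagram (to_proj P) = to_proj Q.
  move=> B0; apply: funext => i; apply: inv_pentagram_next => //; rewrite mxE.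
    by rewrite -/(coordx Q i) Qx.
  by rewrite -/(coordy Q i) Qy.
have /(convex_polygonP hn)[pos|pos] := convP.
  have B0 := turn2_gt0_of_obstruction hn pos ox oy.
  have [e1 e2] := obstruction_next hn pos B0.
  exists Q; last by apply: fin => i; rewrite gt_eqF.
  rewrite Qx Qy e1 e2; split=> //; apply/(convex_polygonP hn); left; rewrite Qx Qy.
  exact: next_pos.
have ox' : obstruction_x x (fun i => - y i) = 0 by rewrite obstruction_x_flip ox oppr0.
have oy' : obstruction_y x (fun i => - y i) = 0 by rewrite obstruction_y_flip.
have Bn := turn2_gt0_of_obstruction hn pos ox' oy'.
have B0 i : turn2 x y i != 0.
  by rewrite -oppr_eq0 -edge_cross_flip gt_eqF // Bn.
have [e1 e2] := obstruction_next hn pos Bn.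
have p' := next_pos hn pos Bn.
have [f1 f2] := next_flip B0.
rewrite f1 f2 obstruction_x_flip ox' in e1; rewrite f1 f2 obstruction_y_flip oy' in e2.
rewrite f1 f2 in p'.
exists Q; last exact: fin.
split; first by apply/(convex_polygonP hn); right; rewrite Qx Qy.
by rewrite Qx Qy; split=> //; apply/eqP; rewrite -oppr_eq0 e1.
Qed.

Lemma forever_convexP P : forever_convex P <-> convex_polygon P /\ obstruction0 P.
Proof.
split=> [h|[cP oP]]; first by split; [case: h | exact: obstruction0_forever].
split=> // k.
have [Q [cQ _] ->] : exists2 Q, convex_polygon Q /\ obstruction0 Q &
   iter k (@inv_pentagram R n) (to_proj P) = to_proj Q.
  elim: k => [|k [Q [cQ oQ] eQ]]; first by exists P.
  have [Q' hQ' eQ'] := obstruction0_step cQ oQ.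
  by exists Q' => //=; rewrite eQ.
by exists Q.
Qed.

End ForeverConvex.

Local Open Scope classical_set_scope.

(** * Upper bound for the dimension *)

Section PrimeSets.
Variables (R : realType) (n : nat).
Implicit Types (Z : set 'M[R]_(n, 2)) (p : {mpoly R[n * 2]}).

Definition vanishes_on Z p := forall P, Z P -> peval p P = 0.

Lemma pevalM p p' P : peval (p * p') P = peval p P * peval p' P.
Proof. exact: mevalM. Qed.

Lemma pevalX p k P : peval (p ^+ k) P = peval p P ^+ k.
Proof. by rewrite /peval rmorphXn. Qed.

Lemma irreducible_prime Z p p' : zariski_irreducible Z ->
  vanishes_on Z (p * p') -> vanishes_on Z p \/ vanishes_on Z p'.
Proof.
move=> [_ irr] pp.
have alg r : algebraic_in Z [set P | Z P /\ peval r P = 0].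
  exists [set r]; apply/seteqP; split=> P /= [zP h]; split=> //; first by move=> _ ->.
  exact: h.
case: (irr _ _ (alg p) (alg p')) => [|h|h].
- apply/seteqP; split=> [P zP|P [[]|[]]//].
  have /eqP := pp P zP; rewrite pevalM mulf_eq0.
  by case/orP=> /eqP; [left|right].
- by left=> P; rewrite h => -[].
- by right=> P; rewrite h => -[].
Qed.

Lemma irreducible_cancel Z p p' k : zariski_irreducible Z ->
  ~ vanishes_on Z p -> vanishes_on Z (p ^+ k * p') -> vanishes_on Z p'.
Proof.
move=> irr np /(irreducible_prime irr)[h|//]; case: np => P zP.
by have := h P zP; rewrite pevalX => /eqP; rewrite expf_eq0 => /andP[_ /eqP].
Qed.

(* A flag [Z 0 < ... < Z m] of irreducible sets, with [f i] vanishing on [Z i]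
   but not on [Z i.+1], makes the [f i] algebraically independent on [Z m]:
   divide a relation by the least power of the last function, then restrict. *)
Lemma flag_monomials_free (A : finType) (e : A -> nat -> nat) (c : A -> R)
    (Z : nat -> set 'M[R]_(n, 2)) (f : nat -> {mpoly R[n * 2]}) m :
  Z 0%N !=set0 ->
  (forall i, (i < m)%N -> [/\ zariski_irreducible (Z i.+1), Z i `<=` Z i.+1,
      vanishes_on (Z i) (f i) & ~ vanishes_on (Z i.+1) (f i)]) ->
  forall S : pred A,
  (forall a b, S a -> S b -> (forall j, (j < m)%N -> e a j = e b j) -> a = b) ->
  vanishes_on (Z m) (\sum_(a | S a) c a *: \prod_(j < m) f j ^+ e a j) ->
  forall a, S a -> c a = 0.
Proof.
move=> Z0; elim: m => [|m IH] flag S inj van a Sa.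
  have [P ZP] := Z0; have := van P ZP; rewrite (big_pred1 a).
    by rewrite big_ord0 /peval mevalZ meval1 mulr1.
  move=> b /=; apply/idP/eqP => [Sb|->//]; exact: inj.
apply/eqP/negPn/negP => ca.
pose T b := S b && (c b != 0).
have Ta : T a by rewrite /T Sa.
have [b0 Tb0 minb0] := arg_minnP (fun b => e b m) Ta.
set r := e b0 m in minb0.
have [irr sub van_m nvan_m] := flag m (ltnSn m).
pose g := \sum_(b | T b) c b *: ((\prod_(j < m) f j ^+ e b j) * f m ^+ (e b m - r)).
have gv : vanishes_on (Z m.+1) g.
  apply: (irreducible_cancel (k := r) irr nvan_m) => P ZP.
  rewrite -[RHS](van P ZP); congr peval; rewrite /g mulr_sumr.
  rewrite [RHS](bigID (fun b => c b != 0)) /= [X in _ = _ + X]big1 ?addr0; last first.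
    by move=> b /andP[_ /negPn/eqP->]; rewrite scale0r.
  apply: eq_bigr => b Tb; rewrite -scalerAr big_ord_recr /= mulrCA -exprD subnKC //.
  exact: minb0.
pose T' b := T b && (e b m == r).
have T'b0 : T' b0 by rewrite /T' Tb0 eqxx.
have : c b0 = 0.
  apply: (IH _ T') => //.
  - by move=> i im; apply: flag; rewrite ltnS ltnW.
  - move=> b b' /andP[/andP[Sb _] /eqP eb] /andP[/andP[Sb' _] /eqP eb'] h.
    apply: inj => // j; rewrite ltnS leq_eqVlt => /orP[/eqP->|]; last exact: h.
    by rewrite eb eb'.
  - move=> P ZP; rewrite -[RHS](gv P (sub _ ZP)) /g /peval !raddf_sum /=.
    rewrite [RHS](bigID (fun b => e b m == r)) /= [X in _ = _ + X]big1 ?addr0.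
      apply: eq_bigr => b /andP[_ /eqP ->]; rewrite subnn expr0 mulr1 //.
    move=> b /andP[Tb eb]; rewrite mevalZ mevalM -!/(peval _ _) pevalX van_m //.
    rewrite expr0n subn_eq0 leqNgt ltn_neqAle eq_sym eb minb0 //= !mulr0 //.
by case/andP: Tb0 => _ /eqP.
Qed.

End PrimeSets.

(** * Algebraic dependence by counting monomials *)

Section MonomialCount.
Variable (R : fieldType).

Lemma msizeM_le_pred N (f g : {mpoly R[N]}) : (msize (f * g) <= (msize f + msize g).-1)%N.
Proof.
have [->|f0] := eqVneq f 0; first by rewrite mul0r msize0.
have [->|g0] := eqVneq g 0; first by rewrite mulr0 msize0.
by rewrite msizeM.
Qed.

Lemma msizeX_le N (f : {mpoly R[N]}) d k : (msize f <= d.+1)%N -> (msize (f ^+ k) <= (k * d).+1)%N.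
Proof.
move=> fd; elim: k => [|k IH]; first by rewrite expr0 msize1.
rewrite exprS; apply: leq_trans (msizeM_le_pred _ _) _.
by rewrite mulSn; lia.
Qed.

Lemma msize_prod_le N M (f : 'I_M -> {mpoly R[N]}) d :
  (forall i, msize (f i) <= d.+1)%N -> (msize (\prod_i f i) <= (M * d).+1)%N.
Proof.
elim: M f => [|M IH] f fd; first by rewrite big_ord0 msize1.
rewrite big_ord_recr /=; apply: leq_trans (msizeM_le_pred _ _) _.
have /= := IH (fun i => f (widen_ord (leqnSn M) i)) (fun i => fd _).
by move: (fd ord_max); rewrite [(M.+1 * d)%N]mulSn; lia.
Qed.

(* There are [k ^ M] monomials in the [f i] with exponents below [k], but only
   [O(k ^ N)] coefficients. *)
Lemma algebraic_dependence N M (f : 'I_M -> {mpoly R[N]}) : (N < M)%N ->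
  exists k (c : {ffun 'I_M -> 'I_k} -> R),
    (exists a, c a != 0) /\ \sum_a c a *: \prod_i f i ^+ (a i) = 0.
Proof.
move=> NM.
have [d fd] : exists d, forall i, (msize (f i) <= d.+1)%N.
  exists (\max_i msize (f i)) => i; apply: leqW.
  exact: (@leq_bigmax _ (fun i => msize (f i)) i).
(* As [D <= k * (M * d).+1], this [k] gives [D ^ N < k ^ N.+1 <= k ^ M]. *)
pose k := ((M * d).+1 ^ N).+1; pose D := (M * (k * d)).+1.
pose A := {ffun 'I_M -> 'I_k}; pose B := {ffun 'I_N -> 'I_D}.
pose F (a : A) := \prod_i f i ^+ (a i).
have card : (#|B| < #|A|)%N.
  rewrite !card_ffun !card_ord.
  have DN : (D ^ N <= (k * (M * d).+1) ^ N)%N.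
    by case: (N) => // N'; rewrite leq_exp2r // /D mulnS mulnCA -add1n leq_add2r.
  apply: leq_ltn_trans DN _; rewrite expnMn.
  apply: (@leq_trans (k ^ N * k)); first by rewrite ltn_pmul2l ?expn_gt0.
  by rewrite -expnSr leq_pexp2l.
pose mon (b : B) : 'X_{1..N} := [multinom nat_of_ord (b i) | i < N].
pose Mx : 'M[R]_(#|A|, #|B|) := \matrix_(i, j) (F (enum_val i))@_(mon (enum_val j)).
have ker0 : kermx Mx != 0.
  rewrite kermx_eq0 /row_free; apply/eqP => h.
  by have := rank_leq_col Mx; rewrite h leqNgt card.
have [i ri] : exists i, row i (kermx Mx) != 0.
  apply/existsP; apply: contraNT ker0 => /existsPn h.
  apply/eqP/row_matrixP => i; rewrite row0; apply/eqP/negPn; exact: h.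
pose u := row i (kermx Mx).
have uM : u *m Mx = 0 by rewrite /u -row_mul mulmx_ker row0.
exists k, (fun a => u 0 (enum_rank a)); split.
  have [j uj] : exists j, u 0 j != 0.
    apply/existsP; apply: contraNT ri => /existsPn h.
    by apply/eqP/rowP => j; rewrite [RHS]mxE; apply/eqP/negPn; exact: h.
  by exists (enum_val j); rewrite enum_valK.
apply/mpolyP => m; rewrite mcoeff0 raddf_sum /=.
have [mD|mD] := boolP [forall j, m j < D]%N.
  pose b : B := [ffun j => Ordinal (forallP mD j)].
  have -> : m = mon b by apply/mnmP => j; rewrite mnmE ffunE.
  have E := congr1 (fun w : 'rV_#|B| => w 0 (enum_rank b)) uM.
  rewrite mxE [RHS]mxE in E; rewrite -[RHS]E.
  rewrite (reindex (@enum_val A A)) /=; last first.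
    by exists enum_rank => [x _|x _]; rewrite ?enum_valK ?enum_rankK.
  by apply: eq_bigr => a _; rewrite mcoeffZ enum_valK [Mx _ _]mxE enum_rankK.
rewrite big1 // => a _; rewrite mcoeffZ memN_msupp_eq0 ?mulr0 //.
apply: msize_mdeg_ge; have /forallPn[j] := mD; rewrite -leqNgt => Dj.
apply: (@leq_trans D); last first.
  by apply: leq_trans Dj _; rewrite mdegE (bigD1 j) //= leq_addr.
apply: msize_prod_le => l; apply: leq_trans (msizeX_le _ (fd l)) _.
by rewrite ltnS leq_mul2r ltnW ?orbT.
Qed.

End MonomialCount.

(** * Numerators of the obstruction and their variation under projective maps *)

Section Numerators.
Variable n : nat.
Local Notation s := (@ordS n).
Local Notation q := (@ord_pred n).

Section Ring.
Variable S : comNzRingType.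
Variables x y z : 'I_n -> S.

(** A component of the obstruction, for [z = x] or [z = y], multiplied by the product of all ears.
    The next two definitions are the terms of degree one and two in [(a, b)] that arise from a
    projective map. *)
Definition obstruction_num : S :=
  \sum_i (z (s i) - z (q i)) * \prod_(j | j != i) ear x y j.

Variables a b : S.
Local Notation xi i := (a * x i + b * y i).

Definition dobstruction_num : S :=
  \sum_i (xi i * (z (s i) - z (q i)) + xi (q i) * z (s i) - xi (s i) * z (q i)) *
    \prod_(j | j != i) ear x y j.

Definition ddobstruction_num : S :=
  \sum_i (xi i * (xi (q i) * z (s i) - xi (s i) * z (q i))) * \prod_(j | j != i) ear x y j.

Local Notation d i := (1 + xi i).

(* The projective map [p |-> p / (1 + xi p)], rescaled by the common denominator. *)
Definition proj_curve i : S := z i * \prod_(j | j != i) d j.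
End Ring.

(** The projective map divides the area of a triangle by the product of the three denominators; the
    square comes from the rescaling. *)
Lemma ear_proj_curve (S : comNzRingType) (x y : 'I_n -> S) (a b : S) i :
  (1 + (a * x (q i) + b * y (q i))) * (1 + (a * x i + b * y i)) *
  (1 + (a * x (s i) + b * y (s i))) *
  ear (proj_curve x y x a b) (proj_curve x y y a b) i =
  (\prod_i (1 + (a * x i + b * y i))) ^+ 2 * ear x y i.
Proof.
set d := fun i => 1 + (a * x i + b * y i); set PI := \prod_i _.
have dE z k : d k * proj_curve x y z a b k = PI * z k.
  by rewrite /proj_curve /PI [in RHS](bigD1 k) //= /d; ring.
rewrite -/(d (q i)) -/(d i) -/(d (s i)).
have X := dE x; have Y := dE y.
transitivity (
  (d i * proj_curve x y x a b i) * (d (s i) * proj_curve x y y a b (s i)) * d (q i)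
  - (d i * proj_curve x y x a b i) * (d (q i) * proj_curve x y y a b (q i)) * d (s i)
  - (d (q i) * proj_curve x y x a b (q i)) * (d (s i) * proj_curve x y y a b (s i)) * d i
  - (d i * proj_curve x y y a b i) * (d (s i) * proj_curve x y x a b (s i)) * d (q i)
  + (d i * proj_curve x y y a b i) * (d (q i) * proj_curve x y x a b (q i)) * d (s i)
  + (d (q i) * proj_curve x y y a b (q i)) * (d (s i) * proj_curve x y x a b (s i)) * d i).
  by rewrite /ear /edge_cross /edgex /edgey ord_predK; ring.
by rewrite !X !Y /d /ear /edge_cross /edgex /edgey ord_predK; ring.
Qed.

(** Up to powers of the common denominator, the term [i] becomes [d i * (d (q i) * z (s i) - d (s i)
    * z (q i)) / ear i]; its parts of degree zero, one and two in [(a, b)] give the three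
    numerators. *)
Lemma obstruction_num_curve (S : comNzRingType) (x y z : 'I_n -> S) (a b : S) :
  (1 <= n)%N ->
  (\prod_i (1 + (a * x i + b * y i))) ^+ 3 *
  obstruction_num (proj_curve x y x a b) (proj_curve x y y a b) (proj_curve x y z a b) =
  (\prod_i (1 + (a * x i + b * y i))) ^+ (2 * n - 1) *
  (obstruction_num x y z + dobstruction_num x y z a b + ddobstruction_num x y z a b).
Proof.
move=> n1; set d := fun i => 1 + (a * x i + b * y i).
rewrite -/(\prod_i d i); set PI := \prod_i _.
have dE k : d k * proj_curve x y z a b k = PI * z k.
  by rewrite /proj_curve /PI [in RHS](bigD1 k) //= /d; ring.
have P3 : \prod_i (d (q i) * d i * d (s i)) = PI ^+ 3.
  have e1 : \prod_i d (s i) = PI by rewrite /PI [RHS](reindex_inj (@ordS_inj n)).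
  have e2 : \prod_i d (q i) = PI by rewrite /PI [RHS](reindex_inj (can_inj (@ord_predK n))).
  rewrite !big_split /= e1 e2 -/PI.
  by rewrite !exprS expr0; ring.
rewrite /obstruction_num /dobstruction_num /ddobstruction_num -!big_split /= !mulr_sumr.
apply: eq_bigr => i _; rewrite -P3 (bigD1 i) //=.
transitivity ((d i * (d (q i) * (d (s i) * proj_curve x y z a b (s i))
                      - d (s i) * (d (q i) * proj_curve x y z a b (q i)))) *
   \prod_(j | j != i) (d (q j) * d j * d (s j) *
     ear (proj_curve x y x a b) (proj_curve x y y a b) j)).
  by rewrite [X in _ = _ * X]big_split /=; ring.
rewrite (eq_bigr (fun j => PI ^+ 2 * ear x y j)); last by move=> j _; exact: ear_proj_curve.
rewrite big_split /= prodr_const cardC1 card_ord !dE -exprM.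
have -> : (2 * n - 1)%N = (2 * n.-1).+1 by lia.
by rewrite exprS /d; ring.
Qed.

Lemma sum_prod_others (F : fieldType) (A t : 'I_n -> F) : (forall i, A i != 0) ->
  \sum_i t i * \prod_(j | j != i) A j = (\sum_i t i / A i) * \prod_i A i.
Proof.
move=> A0; rewrite mulr_suml; apply: eq_bigr => i _.
by rewrite [in RHS](bigD1 i) //= mulrA divfK.
Qed.

Lemma obstruction_num_morph (S S' : comNzRingType) (phi : {rmorphism S -> S'}) x y z :
  phi (obstruction_num x y z) = obstruction_num (phi \o x) (phi \o y) (phi \o z).
Proof.
rewrite /obstruction_num rmorph_sum; apply: eq_bigr => i _.
rewrite rmorphM rmorphB rmorph_prod; congr (_ * _); apply: eq_bigr => j _.
by rewrite /ear /edge_cross /edgex /edgey /= rmorphB !rmorphM !rmorphB.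
Qed.

End Numerators.

(** * Independence of the differentials of the obstruction *)

Section Transversality.
Variables (R : realFieldType) (n : nat) (hn : (5 <= n)%N).
Local Notation s := (@ordS n).
Local Notation q := (@ord_pred n).

Section Positive.
Variables x y : 'I_n -> R.
Hypothesis pos : pos_polygon x y.
Local Notation A := (ear x y).
Local Notation M := (glick_op x y).

Let A0 i : A i != 0. Proof. by rewrite gt_eqF // ear_gt0. Qed.

Lemma affine_eq0_far i j (a b c : R) : j != i -> j != s i ->
  a * x i + b * y i + c = 0 -> a * x (s i) + b * y (s i) + c = 0 ->
  a * x j + b * y j + c = 0 -> a = 0 /\ b = 0.
Proof.
move=> ji js h1 h2 h3; have W0 := pos ji js.
have Ea : a * side_form x y i (x j) (y j) =
  (a * x (s i) + b * y (s i) + c - (a * x i + b * y i + c)) * (y j - y i) -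
  (a * x j + b * y j + c - (a * x i + b * y i + c)) * edgey y i.
  by rewrite /side_form /edgex /edgey; ring.
have Eb : b * side_form x y i (x j) (y j) =
  (a * x j + b * y j + c - (a * x i + b * y i + c)) * edgex x i -
  (a * x (s i) + b * y (s i) + c - (a * x i + b * y i + c)) * (x j - x i).
  by rewrite /side_form /edgex /edgey; ring.
move: Ea Eb; rewrite h1 h2 h3 !subrr !mul0r subrr => /eqP + /eqP.
by rewrite !mulf_eq0 !(gt_eqF W0) !orbF => /eqP -> /eqP ->.
Qed.

(* At a vertex minimizing [a x + b y] the shifted form is nonnegative on the
   polygon, and the operator only sees the vertices away from that one. *)
Lemma glick_op_offset_gt0 (a b mu k : R) :
  (forall j, M a b 0 (x j) (y j) = mu * (a * x j + b * y j) + k) ->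
  (forall j, M 0 0 1 (x j) (y j) = mu) -> (a, b) != 0 -> 0 < k.
Proof.
move=> hk hmu ab0.
have i0 : 'I_n by exact: (@Ordinal n 0 ltac:(lia)).
have [j _ jmin] := @Order.TotalTheory.arg_minP _ R _ i0 xpredT (fun i => a * x i + b * y i) isT.
pose c := - (a * x j + b * y j).
have g0 i : 0 <= a * x i + b * y i + c by rewrite subr_ge0 jmin.
have E : k = \sum_i (a * x i + b * y i + c) * (diag_form x y i (x j) (y j) / A i).
  have := hk j; have := hmu j.
  have -> : \sum_i (a * x i + b * y i + c) * (diag_form x y i (x j) (y j) / A i) =
     M a b 0 (x j) (y j) + c * M 0 0 1 (x j) (y j).
    by rewrite mulr_sumr -big_split /=; apply: eq_bigr => i _; ring.
  by move=> -> ->; rewrite /c; ring.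
have D0 i : i != j -> 0 <= diag_form x y i (x j) (y j) / A i.
  move=> ij; rewrite divr_ge0 ?(ltW (ear_gt0 hn pos i)) //.
  have [e|jq] := eqVneq j (q i); first by rewrite e /diag_form !subrr !mulr0 subrr.
  have [e|js] := eqVneq j (s i); first by rewrite e /diag_form mulrC subrr.
  by rewrite ltW // diag_form_gt0 // eq_sym.
have t0 i : 0 <= (a * x i + b * y i + c) * (diag_form x y i (x j) (y j) / A i).
  have [->|ij] := eqVneq i j; first by rewrite /c subrr mul0r.
  by rewrite mulr_ge0 // D0.
rewrite E lt_neqAle sumr_ge0 // andbT eq_sym psumr_eq0 //; apply/negP => /allP h.
have z i : j != i -> j != q i -> j != s i -> a * x i + b * y i + c = 0.
  move=> ji jq js; have /h := mem_index_enum i.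
  rewrite mulf_eq0 [X in _ || X]gt_eqF ?orbF; first by move/eqP.
  by rewrite divr_gt0 ?ear_gt0 // diag_form_gt0.
have z1 := z (s (s j)); have z2 := z (s (s (s j))).
have [a0 b0] : a = 0 /\ b = 0.
  apply: (@affine_eq0_far (s (s j)) j a b c); last by rewrite /c subrr.
  - by ord_neq.
  - by ord_neq.
  - by apply: z1; ord_neq.
  - by apply: z2; ord_neq.
by move: ab0; rewrite a0 b0 eqxx.
Qed.

Hypothesis ox0 : obstruction_x x y = 0.
Hypothesis oy0 : obstruction_y x y = 0.

Definition dobstruction (z : 'I_n -> R) a b : R :=
  \sum_i ((a * x i + b * y i) * (z (s i) - z (q i)) + (a * x (q i) + b * y (q i)) * z (s i)
     - (a * x (s i) + b * y (s i)) * z (q i)) / A i.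

(** The hypotheses say that [M] maps [a x + b y] to [mu] times itself plus a constant, [mu] being
    the eigenvalue of the constant form. By [glick_op_offset_gt0], applied to this form and to its
    negative, both the constant and its opposite are positive unless [a = b = 0]. *)
Lemma dobstruction_inj a b : dobstruction x a b = 0 -> dobstruction y a b = 0 -> a = 0 /\ b = 0.
Proof.
move=> dx0 dy0.
set mu := M 0 0 1 0 0.
have hmu j : M 0 0 1 (x j) (y j) = mu by rewrite glick_op_one ox0 oy0 !mulr0 addr0 subr0.
have Phi j : M a b 0 (x j) (y j) = mu * (a * x j + b * y j) + M a b 0 0 0.
  have -> : mu * (a * x j + b * y j) + M a b 0 0 0 = mu * (a * x j + b * y j) + M a b 0 0 0
    + y j * dobstruction x a b - x j * dobstruction y a b.
    by rewrite dx0 dy0 !mulr0 addr0 subr0.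
  rewrite /dobstruction !mulr_sumr mulr_suml -!big_split -sumrB /=; apply: eq_bigr => i _.
  by rewrite /diag_form; ring.
have [/pair_equal_spec[]//|ab0] := eqVneq (a, b) 0.
have k1 := glick_op_offset_gt0 Phi hmu ab0.
have opp u v : M (- a) (- b) 0 u v = - M a b 0 u v.
  by rewrite -sumrN; apply: eq_bigr => i _; ring.
have : 0 < - M a b 0 0 0.
  apply: (@glick_op_offset_gt0 (- a) (- b) mu _ _ hmu).
    by move=> j; rewrite opp Phi; ring.
  apply: contra_neq ab0 => -[/eqP + /eqP]; rewrite !oppr_eq0 => /eqP -> /eqP ->.
  by [].
by lra.
Qed.

End Positive.
End Transversality.

(** * Equations of the variety and curves transverse to it *)

Section UpperBound.
Variables (R : realType) (n : nat) (hn : (5 <= n)%N).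
Implicit Types P : 'M[R]_(n, 2).
Local Notation s := (@ordS n).
Local Notation q := (@ord_pred n).

Lemma ear_convex_neq0 P i : convex_polygon P -> ear (coordx P) (coordy P) i != 0.
Proof.
move=> /(convex_polygonP hn)[pos|pos]; have := ear_gt0 hn pos i.
  by move/gt_eqF => ->.
by rewrite /ear edge_cross_flip oppr_gt0 => /lt_eqF ->.
Qed.

Lemma prod_ear_convex_neq0 P : convex_polygon P ->
  \prod_i ear (coordx P) (coordy P) i != 0.
Proof. by move=> cP; apply/prodf_neq0 => i _; exact: ear_convex_neq0. Qed.

Lemma obstruction0_numP P : convex_polygon P ->
  obstruction0 P <->
  obstruction_num (coordx P) (coordy P) (coordx P) = 0 /\
  obstruction_num (coordx P) (coordy P) (coordy P) = 0.
Proof.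
move=> cP; have A0 i := ear_convex_neq0 i cP; have PA := prod_ear_convex_neq0 cP.
rewrite /obstruction_num !sum_prod_others // /obstruction0 /obstruction_x /obstruction_y.
split=> [[-> ->]|[/eqP + /eqP]]; first by rewrite !mul0r.
by rewrite !mulf_eq0 !(negPf PA) !orbF => /eqP -> /eqP ->.
Qed.

Lemma dobstruction_convex_inj P a b : convex_polygon P -> obstruction0 P ->
  dobstruction (coordx P) (coordy P) (coordx P) a b = 0 ->
  dobstruction (coordx P) (coordy P) (coordy P) a b = 0 -> a = 0 /\ b = 0.
Proof.
move=> /(convex_polygonP hn)[pos|pos] [ox oy] dx dy; first exact: (dobstruction_inj hn pos ox oy dx dy).
set x := coordx P; set y := coordy P; pose yN i := - y i.
have e1 z : dobstruction x yN z a (- b) = - dobstruction x y z a b.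
  rewrite -sumrN; apply: eq_bigr => i _.
  by rewrite /ear edge_cross_flip invrN /yN mulrN -!mulNr; congr (_ / _); ring.
have e2 : dobstruction x yN yN a (- b) = dobstruction x y y a b.
  apply: eq_bigr => i _.
  by rewrite /ear edge_cross_flip invrN /yN mulrN -!mulNr; congr (_ / _); ring.
have [-> b0] : a = 0 /\ - b = 0.
  apply: (dobstruction_inj hn pos).
  - by rewrite obstruction_x_flip ox oppr0.
  - by rewrite obstruction_y_flip.
  - by rewrite e1 dx oppr0.
  - by rewrite e2.
by split=> //; apply/eqP; rewrite -oppr_eq0 b0.
Qed.

Lemma dobstruction_num_surj P (l1 l2 : R) : convex_polygon P -> obstruction0 P ->
  exists a b, dobstruction_num (coordx P) (coordy P) (coordx P) a b = l1 /\
              dobstruction_num (coordx P) (coordy P) (coordy P) a b = l2.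
Proof.
move=> cP oP; set x := coordx P; set y := coordy P.
have PA := prod_ear_convex_neq0 cP.
have numE z a b : dobstruction_num x y z a b = dobstruction x y z a b * \prod_i ear x y i.
  by rewrite /dobstruction_num sum_prod_others // => i; exact: ear_convex_neq0.
have lin z a b : dobstruction_num x y z a b =
    a * dobstruction_num x y z 1 0 + b * dobstruction_num x y z 0 1.
  by rewrite /dobstruction_num !mulr_sumr -big_split /=; apply: eq_bigr => i _; ring.
have inj a b : dobstruction_num x y x a b = 0 -> dobstruction_num x y y a b = 0 -> a = 0 /\ b = 0.
  rewrite !numE => /eqP + /eqP; rewrite !mulf_eq0 !(negPf PA) !orbF => /eqP h1 /eqP h2.
  exact: (dobstruction_convex_inj cP oP h1 h2).
move: (lin x) (lin y) inj.
set f := dobstruction_num x y x; set g := dobstruction_num x y y => linf ling inj.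
have det0 : f 1 0 * g 0 1 - f 0 1 * g 1 0 != 0.
  apply/eqP => det0.
  have [h1 h2] : f 0 1 = 0 /\ - f 1 0 = 0.
    apply: inj; first by rewrite linf; ring.
    by rewrite ling; apply/eqP; rewrite -oppr_eq0; apply/eqP; rewrite -[RHS]det0; ring.
  have [h3 h4] : g 0 1 = 0 /\ - g 1 0 = 0.
    apply: inj; last by rewrite ling; ring.
    by rewrite linf -[RHS]det0; ring.
  have /eqP := oner_neq0 R; apply.
  suff [] : (1 : R) = 0 /\ (0 : R) = 0 by [].
  apply: inj; apply/eqP; rewrite -oppr_eq0; first by rewrite h2.
  by rewrite h4.
exists ((l1 * g 0 1 - f 0 1 * l2) / (f 1 0 * g 0 1 - f 0 1 * g 1 0)).
exists ((f 1 0 * l2 - g 1 0 * l1) / (f 1 0 * g 0 1 - f 0 1 * g 1 0)).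
by rewrite (linf (_ / _)) (ling (_ / _)); split; field.
Qed.

Definition varx (i : 'I_n) : {mpoly R[n * 2]} := 'X_(mxvec_index i 0).
Definition vary (i : 'I_n) : {mpoly R[n * 2]} := 'X_(mxvec_index i 1).
Definition obs_polyx := obstruction_num varx vary varx.
Definition obs_polyy := obstruction_num varx vary vary.

Lemma peval_varx P : (fun p => peval p P) \o varx = coordx P.
Proof. by apply: funext => i /=; rewrite /peval mevalXU mxvecE. Qed.

Lemma peval_vary P : (fun p => peval p P) \o vary = coordy P.
Proof. by apply: funext => i /=; rewrite /peval mevalXU mxvecE. Qed.

Lemma peval_obs_poly P :
  peval obs_polyx P = obstruction_num (coordx P) (coordy P) (coordx P) /\
  peval obs_polyy P = obstruction_num (coordx P) (coordy P) (coordy P).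
Proof.
by rewrite -peval_varx -peval_vary; split; apply: (obstruction_num_morph (meval _)).
Qed.

Lemma forever_convex_obs P : forever_convex P <->
  convex_polygon P /\ (peval obs_polyx P = 0 /\ peval obs_polyy P = 0).
Proof.
have [-> ->] := peval_obs_poly P; rewrite (forever_convexP hn).
by split=> -[cP h]; split=> //; apply/(obstruction0_numP cP).
Qed.

Lemma forever_convex_algebraic : algebraic_in (@convex_polygon R n) (@forever_convex R n).
Proof.
exists [set obs_polyx; obs_polyy]; apply/seteqP; split=> P.
  by move/forever_convex_obs => [cP [h1 h2]]; split=> // p [->|->].
move=> [cP h]; apply/forever_convex_obs; split=> //.
by split; apply: h; [left|right].
Qed.

Definition along (gamma : 'I_(n * 2) -> {poly R}) (p : {mpoly R[n * 2]}) : {poly R} :=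
  mmap (@polyC R) gamma p.

Lemma along_horner gamma p t : (along gamma p).[t] = p.@[fun k => (gamma k).[t]].
Proof.
rewrite /along /mmap horner_sum mevalE; apply: eq_bigr => m _.
rewrite hornerM hornerC /mmap1 horner_prod; congr (_ * _).
by apply: eq_bigr => i _; rewrite horner_exp.
Qed.

(** Move [P] by the projective maps with parameters ['X * a] and ['X * b], cleared of denominators
    so that the curve is polynomial; [dobstruction_num_surj] supplies [(a, b)] with the wanted
    derivatives. *)
Lemma transverse_curve P (l1 l2 : R) : forever_convex P ->
  exists (gamma : 'I_(n * 2) -> {poly R}) (ex ey : {poly R}),
  [/\ forall p, (along gamma p).[0] = peval p P,
      along gamma obs_polyx = 'X * ex, along gamma obs_polyy = 'X * ey,
      ex.[0] = l1 & ey.[0] = l2].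
Proof.
move=> fP; have /forever_convex_obs[cP] := fP; have [-> ->] := peval_obs_poly P.
move=> num0; have oP : obstruction0 P by apply/obstruction0_numP.
have [a [b [da db]]] := dobstruction_num_surj l1 l2 cP oP.
set x := coordx P in num0 da db; set y := coordy P in num0 da db.
pose X i : {poly R} := (x i)%:P; pose Y i : {poly R} := (y i)%:P.
pose aX : {poly R} := 'X * a%:P; pose bX : {poly R} := 'X * b%:P.
pose gx := proj_curve X Y X aX bX; pose gy := proj_curve X Y Y aX bX.
pose G : 'M[{poly R}]_(n, 2) := \matrix_(i, j) if j == 0 then gx i else gy i.
pose gamma k := mxvec G 0 k.
pose PI := \prod_i (1 + (aX * X i + bX * Y i)).
have PI0 : PI.[0] = 1.
  by rewrite horner_prod big1 // => i _; rewrite /aX /bX !(hornerE, mul0r) /= !addr0.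
have PIn0 : PI != 0 by apply/eqP => h; move/eqP: PI0; rewrite h horner0 eq_sym oner_eq0.
have gz z i : (proj_curve X Y (fun i => (z i)%:P) aX bX i).[0] = z i.
  by rewrite /proj_curve hornerM hornerC horner_prod big1 ?mulr1 // => j _; rewrite /aX /bX !(hornerE, mul0r) /= !addr0.
have alongE z : along gamma (obstruction_num varx vary z) =
    obstruction_num gx gy (along gamma \o z).
  rewrite /along (obstruction_num_morph (mmap (@polyC R) gamma)).
  by congr obstruction_num; apply: funext => i /=; rewrite mmapX mmap1U /gamma mxvecE mxE.
have gamx : along gamma \o varx = gx.
  by apply: funext => i /=; rewrite /along mmapX mmap1U /gamma mxvecE mxE.
have gamy : along gamma \o vary = gy.
  by apply: funext => i /=; rewrite /along mmapX mmap1U /gamma mxvecE mxE.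
have key z : obstruction_num x y z = 0 ->
   obstruction_num gx gy (proj_curve X Y (fun i => (z i)%:P) aX bX) =
   'X * (PI ^+ (2 * n - 4) * ((dobstruction_num x y z a b)%:P +
         'X * (ddobstruction_num x y z a b)%:P)).
  move=> z0; apply: (mulfI (expf_neq0 3 PIn0)).
  rewrite obstruction_num_curve; last by lia.
  rewrite -/PI (_ : (2 * n - 1)%N = (3 + (2 * n - 4))%N); last by lia.
  rewrite exprD -[LHS]mulrA; congr (_ * _); rewrite [RHS]mulrCA; congr (_ * _).
  have morph := obstruction_num_morph (@polyC R) x y z.
  rewrite z0 rmorph0 in morph.
  rewrite (_ : obstruction_num X Y _ = 0) ?add0r; last exact: esym morph.
  rewrite /dobstruction_num /ddobstruction_num !rmorph_sum !mulr_sumr mulrDr !mulr_sumr.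
  have earP i : \prod_(j < n | j != i) (ear x y j)%:P = \prod_(j | j != i) ear X Y j.
    apply: eq_bigr => j _.
    by rewrite /ear /edge_cross /edgex /edgey /= !(rmorphB, rmorphM).
  by congr (_ + _); apply: eq_bigr => i _;
    rewrite !(rmorphM, rmorphB, rmorphD, rmorph_prod) /= earP /aX /bX /X /Y; ring.
exists gamma, (PI ^+ (2 * n - 4) * ((dobstruction_num x y x a b)%:P +
         'X * (ddobstruction_num x y x a b)%:P)),
  (PI ^+ (2 * n - 4) * ((dobstruction_num x y y a b)%:P +
         'X * (ddobstruction_num x y y a b)%:P)).
split.
- move=> p; rewrite along_horner /peval; apply: meval_eq => k.
  case/mxvec_indexP: k => i j; rewrite /gamma !mxvecE mxE.
  case: j => -[|[|//]] hj /=; rewrite gz /x /y /coordx /coordy; congr (P i _); exact: val_inj.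
- by rewrite alongE gamx key; case: num0.
- by rewrite alongE gamy key; case: num0.
- by rewrite !hornerE PI0 expr1n da !hornerE.
- by rewrite !hornerE PI0 expr1n db !hornerE.
Qed.

End UpperBound.

(** * Bound on the length of chains *)

Section ChainLength.
Variables (R : realType) (n : nat) (hn : (5 <= n)%N).

Lemma poly_all_roots_eq0 (p : {poly R}) : (forall t, p.[t] = 0) -> p = 0.
Proof.
move=> h; apply/eqP/negPn/negP => p0.
have := max_poly_roots (rs := [seq i%:R | i <- iota 0 (size p)]) p0.
rewrite size_map size_iota ltnn => H; suff: false by []. apply: H.
  by apply/allP => t _; rewrite /root h.
by rewrite map_inj_uniq ?iota_uniq //; move=> i j /eqP; rewrite eqr_nat => /eqP.
Qed.

(* Two more functions vanish to exactly first order, in independent directions,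
   along the set: taking lowest-order terms along transverse curves reduces a
   relation involving them to one on the set. *)
Lemma forever_convex_chain_le d Z : @irreducible_chain R n (@forever_convex R n) d Z ->
  (d <= 2 * n - 2)%N.
Proof.
move=> [irr incr]; rewrite leqNgt; apply/negP => dn.
pose Zn i : set 'M[R]_(n, 2) := Z (inord i).
have step i : (i < d)%N -> exists p, vanishes_on (Zn i) p /\ ~ vanishes_on (Zn i.+1) p.
  move=> id; have [sub nsub] : Zn i `<` Zn i.+1.
    by apply: incr; rewrite !inordK // ltnS ltnW.
  have [P [ZP nZP]] : exists P, Zn i.+1 P /\ ~ Zn i P.
    by apply: contrapT => h; apply: nsub => P ZP; apply: contrapT => nP; apply: h; exists P.
  have [[F EF] _] := irr (inord i).
  have VP : forever_convex P.
    by have [[F' EF'] _] := irr (inord i.+1); move: ZP; rewrite /Zn EF' => -[].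
  have [p Fp pP] : exists2 p, F p & peval p P <> 0.
    apply: contrapT => h; apply: nZP; rewrite /Zn EF; split=> // p Fp.
    by apply: contrapT => pP; apply: h; exists p.
  exists p; split; first by move=> Q; rewrite /Zn EF => -[_ hQ]; exact: hQ.
  by move=> h; apply: pP; apply: h.
have step' i : exists p, (i < d)%N -> vanishes_on (Zn i) p /\ ~ vanishes_on (Zn i.+1) p.
  by have [/step[p hp]|id] := boolP (i < d)%N; [exists p | exists 0].
have [f hf] := choice step'.
(* The functions separating the members of the chain, followed by the two equations of the variety:
   [d + 2 > 2 n] polynomials in [2 n] variables. *)
pose g i := if (i < d)%N then f i else if i == d then obs_polyx R n else obs_polyy R n.
have [k [c [[a0 ca0] rel]]] : exists k (c : {ffun 'I_(d.+2) -> 'I_k} -> R),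
    (exists a, c a != 0) /\ \sum_a c a *: \prod_(i < d.+2) g i ^+ (a i) = 0.
  by apply: (algebraic_dependence (fun i : 'I_d.+2 => g i)); lia.
pose e (a : {ffun 'I_(d.+2) -> 'I_k}) (j : nat) : nat := a (inord j).
(* The least total degree in the two equations among the monomials of the relation. *)
have [a1 ca1 amin] := arg_minnP (fun a => (e a d + e a d.+1)%N) (P := fun a => c a != 0) ca0.
set r := (e a1 d + e a1 d.+1)%N in amin.
have gd : g d = obs_polyx R n by rewrite /g ltnn eqxx.
have gd1 : g d.+1 = obs_polyy R n by rewrite /g ltnNge leqnSn /= eqn_leq ltnn.
have gj j : (j < d)%N -> g j = f j by rewrite /g => ->.
pose mon (a : {ffun 'I_(d.+2) -> 'I_k}) := \prod_(j < d) f j ^+ e a j.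
have relE : \sum_(a | c a != 0) c a *: (mon a * obs_polyx R n ^+ e a d * obs_polyy R n ^+ e a d.+1) = 0.
  rewrite -[RHS]rel [RHS](bigID (fun a => c a != 0)) /= [X in _ = _ + X]big1 ?addr0; last first.
    by move=> a /negPn/eqP ->; rewrite scale0r.
  apply: eq_bigr => a _; congr (_ *: _).
  have -> : \prod_(i < d.+2) g i ^+ a i = \prod_(i < d.+2) g i ^+ e a i.
    by apply: eq_bigr => i _; rewrite /e inord_val.
  rewrite !big_ord_recr /= gd gd1; congr (_ * _ * _).
  by apply: eq_bigr => j _; rewrite gj.
(* Along a curve through [P] on which the two equations are ['X] and [t * 'X] to first order, this
   sum is the coefficient of ['X ^+ r] in the relation. *)
have lead P (t : R) : Zn d P ->
    \sum_(a | (c a != 0) && (e a d + e a d.+1 == r)%N) c a * peval (mon a) P * t ^+ e a d.+1 = 0.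
  move=> ZP.
  have VP : forever_convex P.
    by have [[F' EF'] _] := irr (inord d); move: ZP; rewrite /Zn EF' => -[].
  have [gamma [ex [ey [g0 gx gy ex0 ey0]]]] := transverse_curve hn 1 t VP.
  have : 'X ^+ r * \sum_(a | c a != 0) (c a)%:P * (along gamma (mon a) * ex ^+ e a d *
      ey ^+ e a d.+1 * 'X ^+ (e a d + e a d.+1 - r)) = 0.
    have := congr1 (along gamma) relE.
    rewrite /along rmorph0 rmorph_sum => E; rewrite -[RHS]E mulr_sumr.
    apply: eq_bigr => a ca; rewrite /= -mul_mpolyC !rmorphM /= mmapC !rmorphXn /=.
    rewrite -/(along gamma _) -/(along gamma (obs_polyx R n)) -/(along gamma (obs_polyy R n)) gx gy.
    have -> : 'X ^+ r * ((c a)%:P * (along gamma (mon a) * ex ^+ e a d * ey ^+ e a d.+1 *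
       'X ^+ (e a d + e a d.+1 - r))) = 'X ^+ (r + (e a d + e a d.+1 - r)) *
       ((c a)%:P * (along gamma (mon a) * ex ^+ e a d * ey ^+ e a d.+1)) by rewrite exprD; ring.
    by rewrite subnKC ?amin // exprD !exprMn; ring.
  move/eqP; rewrite mulf_eq0 expf_eq0 polyX_eq0 andbF /= => /eqP E.
  have := congr1 (fun p => p.[0]) E; rewrite /= horner0 horner_sum => {}E.
  rewrite -[RHS]E [RHS](bigID (fun a => (e a d + e a d.+1 == r)%N)) /= [X in _ = _ + X]big1 ?addr0.
    apply: eq_bigr => a /andP[_ /eqP ar].
    by rewrite ar subnn expr0 mulr1 !hornerM hornerC !horner_exp ex0 ey0 g0 expr1n; ring.
  move=> a /andP[ca ar]; rewrite !hornerM !horner_exp hornerX expr0n subn_eq0.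
  by rewrite leqNgt ltn_neqAle eq_sym ar amin //= !mulr0.
(* Fixing both exponents of the equations selects one coefficient of that sum as a polynomial in
   [t]; the monomials left are told apart by their first [d] exponents. *)
pose S a := [&& c a != 0, (e a d + e a d.+1 == r)%N & e a d.+1 == e a1 d.+1].
have Sa1 : S a1 by rewrite /S ca1 !eqxx.
suff : c a1 = 0 by move/eqP: ca1.
apply: (@flag_monomials_free R n _ e c Zn f d _ _ S) => //.
- by have [_ [[P hP] _]] := irr (inord 0); exists P.
- move=> i id; have [h1 h2] := hf i id; have [_ h3] := irr (inord i.+1); split=> //.
  by have [] : Zn i `<` Zn i.+1 by apply: incr; rewrite !inordK // ltnS ltnW.
- move=> a b /and3P[_ /eqP ha /eqP ha'] /and3P[_ /eqP hb /eqP hb'] hab.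
  have hj j : (j < d.+2)%N -> e a j = e b j.
    rewrite !ltnS leq_eqVlt => /orP[/eqP->|]; first by rewrite ha' hb'.
    rewrite ltnS leq_eqVlt => /orP[/eqP->|]; last exact: hab.
    by move: ha hb; rewrite ha' hb'; lia.
  apply/ffunP => i; apply: val_inj; have := hj i (ltn_ord i).
  by rewrite /e inord_val.
- move=> P ZP.
  pose p := \poly_(b < k) \sum_(a | (c a != 0) && (e a d + e a d.+1 == r)%N && (e a d.+1 == b))
     c a * peval (mon a) P.
  have p0 : p = 0.
    apply: poly_all_roots_eq0 => t; rewrite horner_poly -[RHS](lead P t ZP).
    rewrite [RHS](partition_big (fun a : {ffun 'I_(d.+2) -> 'I_k} => a (inord d.+1)) xpredT) //=.
    apply: eq_bigr => b _; rewrite mulr_suml.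
    rewrite (eq_bigl (fun a => (c a != 0) && (e a d + e a d.+1 == r)%N && (a (inord d.+1) == b))) //.
    by apply: eq_bigr => a /andP[_ /eqP <-].
  have := congr1 (fun p : {poly R} => p`_(e a1 d.+1)) p0.
  rewrite /= coef0 coef_poly ltn_ord => E.
  rewrite -[RHS]E /peval raddf_sum /=; apply: eq_big => [a|a _].
    by rewrite /S andbA.
  by rewrite mevalZ.
Qed.

End ChainLength.

(** * Noetherianity and chains *)

Lemma nat_seq_min (u : nat -> nat) N : exists2 i, (N <= i)%N & forall j, (N <= j)%N -> (u i <= u j)%N.
Proof.
have ex : exists v, `[< exists2 i, (N <= i)%N & u i = v >] by exists (u N); apply/asboolP; exists N.
have [v /asboolP[i Ni <-] vmin] := ex_minnP ex; exists i => // j Nj.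
by apply: vmin; apply/asboolP; exists j.
Qed.

(** Pass repeatedly to a position of the least value beyond the last chosen index. *)
Lemma nat_seq_monotone_subseq (u : nat -> nat) : exists phi : nat -> nat,
  (forall i j, (i < j)%N -> (phi i < phi j)%N) /\ forall i j, (i <= j)%N -> (u (phi i) <= u (phi j))%N.
Proof.
have /choice[g hg] : forall N, exists i, (N <= i)%N /\ forall j, (N <= j)%N -> (u i <= u j)%N.
  by move=> N; have [i h1 h2] := nat_seq_min u N; exists i.
pose fix phi k := if k is k'.+1 then g (phi k').+1 else g 0%N.
have inc k : (phi k < phi k.+1)%N by have [] := hg (phi k).+1.
have incr i j : (i < j)%N -> (phi i < phi j)%N by exact: homo_ltn ltn_trans inc _ _.
exists phi; split=> // i j; rewrite leq_eqVlt => /orP[/eqP->//|ij].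
case: i ij => [|i] ij; first by have [_] := hg 0%N; apply.
have [_] := hg (phi i).+1; apply.
by apply: (@leq_trans (phi i.+1)); [exact: inc | exact/ltnW/incr].
Qed.

(** Extract a weakly increasing subsequence one variable at a time. *)
Lemma dickson N (m : nat -> 'X_{1..N}) : exists i j, (i < j)%N /\ (m i <= m j)%MM.
Proof.
have key k : exists phi : nat -> nat, (forall i j, (i < j)%N -> (phi i < phi j)%N) /\
   forall l : 'I_N, (l < k)%N -> forall i j, (i <= j)%N -> (m (phi i) l <= m (phi j) l)%N.
  elim: k => [|k [phi [inc hphi]]]; first by exists id; split.
  have [kN|kN] := ltnP k N; last first.
    by exists phi; split=> // l lk; apply: hphi; apply: leq_trans kN.
  have [psi [inc' hpsi]] := nat_seq_monotone_subseq (fun i => m (phi i) (Ordinal kN)).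
  exists (phi \o psi); split=> [i j ij|l]; first by apply/inc/inc'.
  rewrite ltnS leq_eqVlt => /orP[/eqP lk i j ij|lk i j ij] /=.
    by rewrite (_ : l = Ordinal kN); [exact: hpsi | exact: val_inj].
  apply: hphi => //; move: ij; rewrite leq_eqVlt => /orP[/eqP->//|ij].
  exact/ltnW/inc'.
have [phi [inc hphi]] := key N.
exists (phi 0%N), (phi 1%N); split; first exact: inc.
by apply/mnm_lepP => l; exact: hphi.
Qed.

Section Noetherian.
Variables (R : realType) (n : nat).
Implicit Types (V W Z : set 'M[R]_(n, 2)) (P : 'M[R]_(n, 2)).

Lemma algebraic_in_refl V : algebraic_in V V.
Proof. by exists set0; apply/seteqP; split=> [P VP|P []//]; split. Qed.

Lemma algebraic_in_trans V W Z : algebraic_in V W -> algebraic_in W Z -> algebraic_in V Z.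
Proof.
move=> [F ->] [G ->]; exists (F `|` G); apply/seteqP; split=> P /=.
  by move=> [[VP hF] hG]; split=> // p [/hF|/hG].
by move=> [VP h]; split; [split=> // p Fp; apply: h; left | move=> p Gp; apply: h; right].
Qed.

Lemma algebraic_in_sub V W : algebraic_in V W -> W `<=` V.
Proof. by move=> [F ->] P []. Qed.

Lemma algebraic_in_separate V W P : algebraic_in V W -> V P -> ~ W P ->
  exists p, vanishes_on W p /\ peval p P <> 0.
Proof.
move=> [F ->] VP nW; apply: contrapT => h; apply: nW; split=> // p Fp.
apply: contrapT => pP; apply: h; exists p; split=> // Q [_]; exact.
Qed.

(* Hilbert's basis theorem, in the form of the descending chain condition for
   zero sets: choose separating polynomials of least leading monomial, apply
   Dickson's lemma to these monomials and reduce. *)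
Lemma algebraic_dcc V (W : nat -> set 'M[R]_(n, 2)) :
  (forall k, algebraic_in V (W k)) -> ~ (forall k, W k.+1 `<` W k).
Proof.
move=> alg dec.
have mono i j : (i <= j)%N -> W j `<=` W i.
  elim: j => [|j IH]; first by rewrite leqn0 => /eqP ->.
  rewrite leq_eqVlt => /orP[/eqP->//|/IH h]; apply: subset_trans h.
  by have [] := dec j.
pose I k (p : {mpoly R[n * 2]}) := vanishes_on (W k.+1) p /\ ~ vanishes_on (W k) p.
have /choice[f hf] : forall k, exists p, I k p /\ forall p', I k p' -> ~~ (mlead p' < mlead p)%O.
  move=> k.
  have [p Ip] : exists p, I k p.
    have [_ nsub] := dec k.
    have [P [WP nWP]] : exists P, W k P /\ ~ W k.+1 P.
      by apply: contrapT => h; apply: nsub => P WP; apply: contrapT => nP; apply: h; exists P.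
    have [p [vp pP]] := algebraic_in_separate (alg k.+1) (algebraic_in_sub (alg k) WP) nWP.
    by exists p; split=> // h; apply: pP; apply: h.
  move: {2}(mlead p) (erefl (mlead p)) => m em.
  elim/(well_founded_ind (@ltom_wf (n * 2))): m p em Ip => m IH p em Ip.
  have [[p' [Ip' lt]]|no] := pselect (exists p', I k p' /\ (mlead p' < mlead p)%O).
    by apply: (IH (mlead p') _ p' erefl Ip'); rewrite -em.
  by exists p; split=> // p' Ip'; apply/negP => lt; apply: no; exists p'.
have [i [j [ij le]]] := dickson (fun k => mlead (f k)).
have [[vi nvi] _] := hf i; have [[vj nvj] minj] := hf j.
have fi0 : f i != 0 by apply/eqP => h; apply: nvi => P _; rewrite h /peval meval0.
pose c := mleadc (f j) / mleadc (f i).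
(* As [i < j], [f i] vanishes on [W j]; so [h] agrees with [f j] there while its leading term
   cancels, against the choice of [f j]. *)
pose h := f j - c *: ('X_[mlead (f j) - mlead (f i)] * f i).
have ci0 : mleadc (f i) != 0 by rewrite mleadc_eq0.
have hv P : W j P -> peval h P = peval (f j) P.
  move=> WP; rewrite /h /peval mevalB mevalZ mevalM -!/(peval _ _) vi ?mulr0 ?subr0 //.
  exact: (mono i.+1 j).
have Ih : I j h.
  split=> [P WP|vh]; first by rewrite hv ?vj //; exact: (mono j j.+1).
  by apply: nvj => P WP; rewrite -hv // vh.
have h0 : h != 0 by apply/eqP => e; case: Ih => _; apply => P _; rewrite e /peval meval0.
have lead_q : (mlead (f j) - mlead (f i) + mlead (f i))%MM = mlead (f j) by rewrite submK.
have leh : (mlead h <= mlead (f j))%O.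
  apply: le_trans (mleadB_le _ _) _; rewrite leUx lexx /=.
  apply: le_trans (mleadZ_le _ _) _.
  by apply: le_trans (mleadM_le _ _) _; rewrite mleadXm lead_q.
have /negP := minj h Ih; apply; rewrite lt_neqAle leh andbT.
apply/eqP => e; have := mlead_supp h0; rewrite e mcoeff_msupp => /eqP; apply.
have co : ('X_[mlead (f j) - mlead (f i)] * f i)@_(mlead (f j)) = mleadc (f i).
  by rewrite mulrC -[in RHS](mcoeffMX _ (mlead (f j) - mlead (f i))) lead_q.
by rewrite /h mcoeffB mcoeffZ co /c divfK // subrr.
Qed.

Definition irreducible_cover V r (Y : nat -> set 'M[R]_(n, 2)) :=
  (forall i, (i < r)%N -> zariski_irreducible (Y i) /\ algebraic_in V (Y i)) /\
  (forall P, V P -> exists2 i, (i < r)%N & Y i P).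

(** Noetherian induction: a set without a decomposition is the union of two proper closed subsets,
    one of which has none either; iteration contradicts [algebraic_dcc]. *)
Lemma irreducible_decomposition V : exists r Y, irreducible_cover V r Y.
Proof.
apply: contrapT => badV.
pose bad W := algebraic_in V W /\ ~ exists r Y, irreducible_cover W r Y.
have step W : bad W -> exists W', bad W' /\ W' `<` W.
  move=> [algW nW].
  have W0 : W !=set0.
    apply: contrapT => h; apply: nW; exists 0%N, (fun _ => set0); split=> // P WP.
    by case: h; exists P.
  have [A [B [algA [algB [WAB nA nB]]]]] : exists A B, algebraic_in W A /\ algebraic_in W B /\
      [/\ W = A `|` B, W <> A & W <> B].
    apply: contrapT => h; apply: nW; exists 1%N, (fun _ => W); split=> [i _|P WP]; last by exists 0%N.
    split; last exact: algebraic_in_refl.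
    split=> // A B algA algB WAB; have [->|nA] := pselect (W = A); first by left.
    by right; apply: contrapT => nB; apply: h; exists A, B.
  have sA := algebraic_in_sub algA; have sB := algebraic_in_sub algB.
  have strict C : C `<=` W -> W <> C -> C `<` W.
    by move=> s nC; split=> // s'; apply: nC; apply/seteqP.
  have tA := algebraic_in_trans algW algA; have tB := algebraic_in_trans algW algB.
  have [[ra [YA [iA cA]]]|nA'] := pselect (exists r Y, irreducible_cover A r Y); last first.
    by exists A; split; [split | exact: strict].
  have [[rb [YB [iB cB]]]|nB'] := pselect (exists r Y, irreducible_cover B r Y); last first.
    by exists B; split; [split | exact: strict].
  case: nW; exists (ra + rb)%N, (fun i => if (i < ra)%N then YA i else YB (i - ra)%N); split.
    move=> i ir; case: ifPn => [ia|]; first by have [h1 h2] := iA i ia; split=> //; apply: algebraic_in_trans h2.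
    rewrite -leqNgt => ia; have [|h1 h2] := iB (i - ra)%N; first by rewrite ltn_subLR.
    by split=> //; apply: algebraic_in_trans h2.
  move=> P; rewrite WAB => -[/cA[i ia YP]|/cB[i ib YP]].
    by exists i; rewrite ?ia // (leq_trans ia) // leq_addr.
  by exists (ra + i)%N; rewrite ?ltn_add2l // ltnNge leq_addr /= addKn.
have /choice[g hg] : forall W : {W | bad W}, exists W' : {W | bad W}, sval W' `<` sval W.
  by move=> [W bW]; have [W' [bW' lt]] := step W bW; exists (exist _ W' bW').
have bV : bad V by split=> //; exact: algebraic_in_refl.
pose W k := iter k g (exist _ V bV).
apply: (@algebraic_dcc V (fun k => sval (W k))) => k; first by case: (svalP (W k)).
exact: hg.
Qed.

Lemma irreducible_prime_prod Z r (p : nat -> {mpoly R[n * 2]}) : zariski_irreducible Z ->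
  vanishes_on Z (\prod_(i < r) p i) -> exists2 i, (i < r)%N & vanishes_on Z (p i).
Proof.
move=> irr; elim: r => [|r IH].
  rewrite big_ord0 => h; have [[P ZP] _] := irr; have := h P ZP.
  by rewrite /peval meval1 => /eqP; rewrite oner_eq0.
rewrite big_ord_recr /= => /(irreducible_prime irr)[/IH[i ir h]|h].
  by exists i => //; apply: leqW.
by exists r.
Qed.

(** Otherwise choose for each [i] a polynomial vanishing on [Y i] but not on [Z]; the product
    vanishes on [Z], against primality. *)
Lemma irreducible_sub_cover V Z r Y : zariski_irreducible Z -> Z `<=` V ->
  irreducible_cover V r Y -> exists2 i, (i < r)%N & Z `<=` Y i.
Proof.
move=> irr ZV [iY cY]; apply: contrapT => no.
have /choice[p hp] : forall i, exists p, (i < r)%N -> vanishes_on (Y i) p /\ ~ vanishes_on Z p.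
  move=> i; have [ir|_] := boolP (i < r)%N; last by exists 0.
  have [P [ZP nP]] : exists P, Z P /\ ~ Y i P.
    apply: contrapT => h; apply: no; exists i => // P ZP; apply: contrapT => nP.
    by apply: h; exists P.
  have [_ algY] := iY i ir; have [p [vp pP]] := algebraic_in_separate algY (ZV P ZP) nP.
  by exists p => _; split=> // h; apply: pP; apply: h.
have [|i ir vi] := @irreducible_prime_prod Z r p irr.
  move=> P ZP; have [i ir YP] := cY P (ZV P ZP).
  rewrite (bigD1 (Ordinal ir)) //= pevalM; have [vi _] := hp i ir.
  by rewrite vi // mul0r.
by have [_] := hp i ir.
Qed.

Lemma set1_irreducible P : zariski_irreducible [set P].
Proof.
split; first by exists P.
move=> A B /algebraic_in_sub sA /algebraic_in_sub sB E.
have : (A `|` B) P by rewrite -E.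
case=> [AP|BP]; [left|right]; apply/seteqP; split=> [Q ->|Q] //; [exact: sA|exact: sB].
Qed.

Lemma set1_algebraic V P : V P -> algebraic_in V [set P].
Proof.
move=> VP; exists [set p | exists k, p = 'X_k - (mxvec P 0 k)%:MP]; apply/seteqP; split=> Q.
  by move=> ->; split=> // _ [k ->]; rewrite /peval mevalB mevalXU mevalC subrr.
move=> [_ h]; apply: (can_inj mxvecK); apply/rowP => k.
have := h _ (ex_intro _ k erefl); rewrite /peval mevalB mevalXU mevalC => /eqP.
by rewrite subr_eq0 => /eqP.
Qed.

Definition nat_chain V d (Zs : nat -> set 'M[R]_(n, 2)) :=
  (forall i, (i <= d)%N -> algebraic_in V (Zs i) /\ zariski_irreducible (Zs i)) /\
  (forall i j, (i < j)%N -> (j <= d)%N -> Zs i `<` Zs j).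

Lemma proper_subset_trans (A B C : set 'M[R]_(n, 2)) : A `<` B -> B `<` C -> A `<` C.
Proof.
move=> [AB nAB] [BC nBC]; split; first exact: subset_trans BC.
by move=> CA; apply: nBC; apply: subset_trans AB.
Qed.

(* Each slice [a d = t d c * b d] contains a chain of length [d]; its top lies in
   one of finitely many components of [V], and a component inside a slice
   determines the slice, so for some [c] the component extends the chain. *)
Lemma chain_of_coordinates d V (a b : nat -> {mpoly R[n * 2]}) (t : nat -> nat -> R) :
  (forall j, (j < d)%N -> injective (t j)) ->
  (forall j P, (j < d)%N -> V P -> peval (b j) P <> 0) ->
  (forall c : nat -> nat, exists2 P, V P &
     forall j, (j < d)%N -> peval (a j) P = t j (c j) * peval (b j) P) ->
  exists Zs, nat_chain V d Zs.
Proof.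
elim: d V => [|d IH] V inj b0 box.
  have [P VP _] := box (fun _ => 0%N); exists (fun _ => [set P]); split=> [i _|i j].
    by split; [exact: set1_algebraic | exact: set1_irreducible].
  by move=> ij; rewrite leqn0 => /eqP j0; rewrite j0 in ij.
pose sl c := [set P | V P /\ peval (a d) P = t d c * peval (b d) P].
have algsl c : algebraic_in V (sl c).
  exists [set (a d - (t d c) *: b d)]; apply/seteqP; split=> P /= [VP h]; split=> //.
    by move=> _ ->; rewrite /peval mevalB mevalZ -!/(peval _ _) h subrr.
  by have := h _ erefl; rewrite /peval mevalB mevalZ => /eqP; rewrite subr_eq0 => /eqP.
have /choice[Z hZ] : forall c, exists Zs, nat_chain (sl c) d Zs.
  move=> c; apply: IH.
  - by move=> j jd; apply: inj; apply: leqW.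
  - by move=> j P jd [VP _]; apply: b0 => //; apply: leqW.
  - move=> e; have [P VP h] := box (fun j => if j == d then c else e j).
    exists P; first by split=> //; rewrite h // eqxx.
    by move=> j jd; rewrite h ?ltn_eqF //; apply: leqW.
have [r [Y cov]] := irreducible_decomposition V.
have /choice[i hi] : forall c, exists i, (i < r)%N /\ Z c d `<=` Y i.
  move=> c; have [_ irr] := (hZ c).1 d (leqnn d).
  have [|k kr ZY] := irreducible_sub_cover irr _ cov; last by exists k.
  apply: subset_trans (algebraic_in_sub (algsl c)).
  exact: algebraic_in_sub ((hZ c).1 d (leqnn d)).1.
have [[c nsub]|all_sub] := pselect (exists c, ~ Y (i c) `<=` sl c).
  have [ir ZY] := hi c; have [irrY algY] := cov.1 _ ir.
  exists (fun k => if (k <= d)%N then Z c k else Y (i c)); split.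
    move=> k _; case: ifPn => [kd|_]; last by [].
    by have [h1 h2] := (hZ c).1 k kd; split=> //; apply: algebraic_in_trans h1.
  have top : Z c d `<` Y (i c).
    split=> // h; apply: nsub; apply: subset_trans h _.
    exact: algebraic_in_sub ((hZ c).1 d (leqnn d)).1.
  move=> k l kl; rewrite leq_eqVlt => /orP[/eqP ld|ld].
    subst l; rewrite ltnn (kl : (k <= d)%N); move: kl; rewrite ltnS leq_eqVlt => /orP[/eqP->//|kd].
    by apply: proper_subset_trans top; apply: (hZ c).2.
  have kd : (k <= d)%N by lia.
  by rewrite kd (ld : (l <= d)%N); apply: (hZ c).2.
have sub c : Y (i c) `<=` sl c by apply: contrapT => h; apply: all_sub; exists c.
(* Two of [r + 1] slices share a component, which then lies in both; [t d] being injective, they are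
   disjoint. *)
pose F (k : 'I_r.+1) : 'I_r := Ordinal (hi k).1.
have /injectivePn[k [l kl]] : ~~ injectiveb F.
  by apply/negP => /injectiveP /leq_card; rewrite !card_ord ltnn.
move/(congr1 val) => /= e.
have [[P YP] _] := (cov.1 _ (hi k).1).1.
have [VP h1] := sub k P YP; rewrite e in YP; have [_ h2] := sub l P YP.
case/eqP: kl; apply: val_inj; apply: (inj d) => //.
have /eqP bP := b0 d P (ltnSn d) VP.
by apply: (mulIf bP); rewrite -h1 -h2.
Qed.

Lemma nat_chainE V d Zs : nat_chain V d Zs -> @irreducible_chain R n V d (fun i => Zs i).
Proof.
move=> [h1 h2]; split=> [i|i j ij]; first by apply: h1; rewrite -ltnS.
by apply: h2 => //; rewrite -ltnS.
Qed.

End Noetherian.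

(** * Polygons with prescribed projective coordinates *)

Section Perron.
Variables (R : realType) (n : nat) (hn : (5 <= n)%N).
Variables x y : 'I_n -> R.
Hypothesis pos : pos_polygon x y.
Local Notation s := (@ordS n).
Local Notation q := (@ord_pred n).
Local Notation A := (ear x y).
Local Notation M := (glick_op x y).
Local Notation val a b c i := (a * x i + b * y i + c).

Definition perron_coef i j : R := diag_form x y i (x j) (y j) / A i.
(** The operator [M + 1] on values at the vertices: the identity cancels the diagonal coefficients,
    which are [-1], and leaves a nonnegative matrix. *)
Definition perron (G : 'I_n -> R) j : R := \sum_(i | i != j) G i * perron_coef i j.

Let A0 i : A i != 0. Proof. by rewrite gt_eqF // ear_gt0. Qed.

Lemma perron_coef_gt0 i j : j != i -> j != q i -> j != s i -> 0 < perron_coef i j.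
Proof. by move=> ji jq js; rewrite divr_gt0 ?ear_gt0 // diag_form_gt0. Qed.

Lemma perron_coef_ge0 i j : i != j -> 0 <= perron_coef i j.
Proof.
move=> ij; have [e|jq] := eqVneq j (q i).
  by rewrite /perron_coef e /diag_form !subrr !mulr0 subrr mul0r.
have [e|js] := eqVneq j (s i).
  by rewrite /perron_coef e /diag_form [X in X - _]mulrC subrr mul0r.
by rewrite ltW // perron_coef_gt0 // eq_sym.
Qed.

Lemma perron_glick a b c j : perron (fun i => val a b c i) j = M a b c (x j) (y j) + val a b c j.
Proof.
rewrite /perron /glick_op [in RHS](bigD1 j) //=.
have -> : diag_form x y j (x j) (y j) = - A j.
  by rewrite /diag_form /ear /edge_cross /edgex /edgey ord_predK; ring.
rewrite mulrN mulNr mulfK // addrAC addNr add0r.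
by apply: eq_bigr => i _; rewrite mulrA.
Qed.

Lemma perron_affine a b c : exists a' b' c',
  forall j, perron (fun i => val a b c i) j = val a' b' c' j.
Proof.
exists (a - \sum_i val a b c i * (y (s i) - y (q i)) / A i),
  (b + \sum_i val a b c i * (x (s i) - x (q i)) / A i),
  (c + M a b c 0 0) => j.
rewrite perron_glick.
have -> : M a b c (x j) (y j) = M a b c 0 0
   + y j * (\sum_i val a b c i * (x (s i) - x (q i)) / A i)
   - x j * (\sum_i val a b c i * (y (s i) - y (q i)) / A i).
  rewrite !mulr_sumr -big_split -sumrB /=; apply: eq_bigr => i _.
  by rewrite /diag_form; ring.
ring.
Qed.

Lemma perron_ge0 (G : 'I_n -> R) j : (forall i, 0 <= G i) -> 0 <= perron G j.
Proof. by move=> G0; apply: sumr_ge0 => i ij; rewrite mulr_ge0 // perron_coef_ge0. Qed.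

Lemma perron_eq0 (G : 'I_n -> R) j : (forall i, 0 <= G i) -> perron G j = 0 ->
  forall i, i != j -> i != q j -> i != s j -> G i = 0.
Proof.
move=> G0 /eqP; rewrite psumr_eq0 => [/allP h i ij iq is_|i ij]; last first.
  by rewrite mulr_ge0 // perron_coef_ge0.
have /implyP/(_ ij) := h i (mem_index_enum i).
rewrite mulf_eq0 [X in _ || X]gt_eqF ?orbF; first by move/eqP.
apply: perron_coef_gt0; first by rewrite eq_sym.
  by apply: contra_neq is_ => ->; rewrite ord_predK.
by apply: contra_neq iq => ->; rewrite ordSK.
Qed.

(** A zero of the image at a vertex forces the form to vanish at all vertices other than this one
    and its neighbours. A zero of the second image thus gives two consecutive zeros of the first,
    hence three zeros of an affine form. *)
Lemma perron2_gt0 a b c j : (forall i, 0 <= val a b c i) -> (exists i, val a b c i != 0) ->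
  0 < perron (perron (fun i => val a b c i)) j.
Proof.
move=> G0 [i Gi]; set G := fun i => val a b c i.
have TG0 k : 0 <= perron G k by exact: perron_ge0.
rewrite lt_neqAle perron_ge0 // andbT eq_sym; apply/eqP => /(perron_eq0 TG0) h.
pose k := s (s j).
have hk : perron G k = 0 by apply: h; rewrite /k; ord_neq.
have hsk : perron G (s k) = 0 by apply: h; rewrite /k; ord_neq.
have z1 : G (s (s k)) = 0 by apply: (perron_eq0 G0 hk); ord_neq.
have z2 : G (s (s (s k))) = 0 by apply: (perron_eq0 G0 hk); ord_neq.
have z3 : G (q k) = 0 by apply: (perron_eq0 G0 hsk); ord_neq.
have [a0 b0] : a = 0 /\ b = 0.
  by apply: (@affine_eq0_far _ _ x y pos (s (s k)) (q k) a b c) => //; ord_neq.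
have c0 : c = 0 by move: z1; rewrite /G a0 b0 !mul0r !add0r.
by move: Gi; rewrite a0 b0 c0 !mul0r !addr0 eqxx.
Qed.

Local Notation w0 w := (w 0 (0 : 'I_4)).
Local Notation w1 w := (w 0 (1 : 'I_4)).
Local Notation w2 w := (w 0 (2 : 'I_4)).
Local Notation w3 w := (w 0 (3 : 'I_4)).

Lemma continuous_quad (a b c d e f k : R) :
  continuous (fun w : 'rV[R]_4 => w0 w * a + w1 w * b + w2 w * c + k
     - w3 w * (w0 w * d + w1 w * e + w2 w * f) : R).
Proof.
have C (i : 'I_4) : continuous (fun w : 'rV[R]_4 => w 0 i : R) by move=> w; exact: coord_continuous.
have CM (g h : 'rV[R]_4 -> R) : continuous g -> continuous h -> continuous (fun w => g w * h w).
  by move=> cg ch w; apply: continuousM; [exact: cg|exact: ch].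
have CD (g h : 'rV[R]_4 -> R) : continuous g -> continuous h -> continuous (fun w => g w + h w).
  by move=> cg ch w; apply: continuousD; [exact: cg|exact: ch].
have CN (g : 'rV[R]_4 -> R) : continuous g -> continuous (fun w => - g w).
  by move=> cg w; apply: continuousN; exact: cg.
have CC (u : R) : continuous (fun _ : 'rV[R]_4 => u) by move=> w; exact: cst_continuous.
have L u v t := CD _ _ (CD _ _ (CM _ _ (C 0) (CC u)) (CM _ _ (C 1) (CC v))) (CM _ _ (C 2) (CC t)).
exact: CD _ _ (CD _ _ (L a b c) (CC k)) (CN _ (CM _ _ (C 3) (L d e f))).
Qed.

(** The Collatz-Wielandt set: coefficients of a normalized nonnegative form [g], together with a
    number [r] such that [r g <= (M + 1) g] at the vertices. *)
Definition perron_set : set 'rV[R]_4 := [set w |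
  (forall i, 0 <= val (w0 w) (w1 w) (w2 w) i) /\
  \sum_i val (w0 w) (w1 w) (w2 w) i = 1 /\ 0 <= w3 w /\
  forall j, w3 w * val (w0 w) (w1 w) (w2 w) j <=
     perron (fun i => val (w0 w) (w1 w) (w2 w) i) j].

Lemma perron_linear a b c j : perron (fun i => val a b c i) j =
  a * perron x j + b * perron y j + c * perron (fun=> 1) j.
Proof.
rewrite /perron !mulr_sumr -!big_split /=; apply: eq_bigr => i _; ring.
Qed.

Lemma perron_set_closed : closed perron_set.
Proof.
have cl (a b c d e f k : R) : closed [set w : 'rV[R]_4 | 0 <= w0 w * a + w1 w * b + w2 w * c + k
     - w3 w * (w0 w * d + w1 w * e + w2 w * f)].
  apply: (closed_comp (f := fun w : 'rV[R]_4 => w0 w * a + w1 w * b + w2 w * c + k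
     - w3 w * (w0 w * d + w1 w * e + w2 w * f)) (D := [set u | 0 <= u])).
    by move=> w _; exact: continuous_quad.
  exact: closed_ge.
have [sx esx] : exists u, \sum_i x i = u by eexists.
have [sy esy] : exists u, \sum_i y i = u by eexists.
have [N eN] : exists u : R, n%:R = u by eexists.
have -> : perron_set = (\bigcap_(i in [set: 'I_n]) [set w : 'rV[R]_4 |
    0 <= w0 w * x i + w1 w * y i + w2 w * 1 + 0 - w3 w * (w0 w * 0 + w1 w * 0 + w2 w * 0)])
  `&` [set w : 'rV[R]_4 | 0 <= w0 w * sx + w1 w * sy + w2 w * N + (- 1)
     - w3 w * (w0 w * 0 + w1 w * 0 + w2 w * 0)]
  `&` [set w : 'rV[R]_4 | 0 <= w0 w * (- sx) + w1 w * (- sy) + w2 w * (- N) + 1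
     - w3 w * (w0 w * 0 + w1 w * 0 + w2 w * 0)]
  `&` [set w : 'rV[R]_4 | 0 <= w3 w]
  `&` (\bigcap_(j in [set: 'I_n]) [set w : 'rV[R]_4 |
    0 <= w0 w * perron x j + w1 w * perron y j + w2 w * perron (fun=> 1) j + 0
     - w3 w * (w0 w * x j + w1 w * y j + w2 w * 1)]).
  have S (w : 'rV[R]_4) : \sum_i val (w0 w) (w1 w) (w2 w) i =
     w0 w * sx + w1 w * sy + w2 w * N.
    by rewrite -esx -esy -eN !big_split /= -!mulr_sumr sumr_const card_ord mulr_natr.
  apply/seteqP; split=> w /=.
    move=> [h1 [h2 [h3 h4]]]; rewrite S in h2.
    do !split => //; first by move=> i _ /=; have := h1 i; lra.
    - lra.
    - lra.
    - by move=> j _ /=; have := h4 j; rewrite perron_linear; lra.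
  move=> [[[[h1 h2] h3] h4] h5]; split; first by move=> i; have := h1 i I; rewrite /=; lra.
  split; first by rewrite S; lra.
  by split=> // j; have := h5 j I; rewrite /= perron_linear; lra.
apply: closedI; first (apply: closedI; first (apply: closedI; first apply: closedI)).
- by apply: closed_bigI => i _; exact: cl.
- exact: cl.
- exact: cl.
- apply: (closed_comp (f := fun w : 'rV[R]_4 => w3 w) (D := [set u | 0 <= u])).
    by move=> w _; exact: coord_continuous.
  exact: closed_ge.
- by apply: closed_bigI => j _; exact: cl.
Qed.

(** Values in [[0, 1]] at three consecutive vertices bound the coefficients by Cramer's rule;
    summing the last condition over the vertices bounds [r]. *)
Lemma perron_set_bounded : exists B, forall w, perron_set w -> forall k, `|w 0 k| <= B.
Proof.
have i0 : 'I_n by exact: (@Ordinal n 0 ltac:(lia)).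
pose Ba := (`|edgey y i0| + `|edgey y (q i0)|) / A i0.
pose Bb := (`|edgex x i0| + `|edgex x (q i0)|) / A i0.
pose Bc := 1 + Ba * `|x i0| + Bb * `|y i0|.
pose Br := \sum_j \sum_(i | i != j) perron_coef i j.
have Ai := ear_gt0 hn pos i0.
exists (Ba + Bb + Bc + Br) => w [h1 [h2 [h3 h4]]].
set a := w0 w in h1 h2 h4; set b := w1 w in h1 h2 h4; set c := w2 w in h1 h2 h4.
have le1 i : val a b c i <= 1 by rewrite -h2 (bigD1 i) //= lerDl sumr_ge0.
have Ba0 : 0 <= Ba by rewrite divr_ge0 ?(ltW Ai) // addr_ge0.
have Bb0 : 0 <= Bb by rewrite divr_ge0 ?(ltW Ai) // addr_ge0.
have Bc0 : 0 <= Bc by rewrite addr_ge0 ?addr_ge0 ?ler01 // mulr_ge0.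
have Br0 : 0 <= Br by apply: sumr_ge0 => j _; apply: sumr_ge0 => i ij; exact: perron_coef_ge0.
have diff i j : `|val a b c i - val a b c j| <= 1.
  by rewrite ler_norml; have := h1 i; have := h1 j; have := le1 i; have := le1 j; lra.
have ha : `|a| <= Ba.
  rewrite /Ba ler_pdivlMr // -{1}(gtr0_norm Ai) -normrM.
  have -> : a * A i0 = edgey y i0 * (val a b c i0 - val a b c (q i0))
      - edgey y (q i0) * (val a b c (s i0) - val a b c i0).
    by rewrite /ear /edge_cross /edgex /edgey ord_predK; ring.
  apply: le_trans (ler_normB _ _) _; rewrite !normrM.
  by apply: lerD; rewrite -[leRHS]mulr1; apply: ler_wpM2l.
have hb : `|b| <= Bb.
  rewrite /Bb ler_pdivlMr // -{1}(gtr0_norm Ai) -normrM.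
  have -> : b * A i0 = edgex x (q i0) * (val a b c (s i0) - val a b c i0)
      - edgex x i0 * (val a b c i0 - val a b c (q i0)).
    by rewrite /ear /edge_cross /edgex /edgey ord_predK; ring.
  apply: le_trans (ler_normB _ _) _; rewrite !normrM addrC.
  by apply: lerD; rewrite -[leRHS]mulr1; apply: ler_wpM2l.
have hc : `|c| <= Bc.
  have -> : c = val a b c i0 - a * x i0 - b * y i0 by ring.
  apply: le_trans (ler_normB _ _) _; rewrite normrM; apply: lerD; last by rewrite ler_wpM2r.
  apply: le_trans (ler_normB _ _) _; rewrite normrM; apply: lerD; last by rewrite ler_wpM2r.
  by rewrite ger0_norm // le1.
have hr : `|w3 w| <= Br.
  rewrite ger0_norm // -[leLHS]mulr1 -h2 mulr_sumr; apply: ler_sum => j _.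
  apply: le_trans (h4 j) _; apply: ler_sum => i ij.
  by rewrite -[leRHS]mul1r ler_wpM2r // perron_coef_ge0.
move=> k.
have [->|[->|[->|->]]] : k = 0 \/ (k = 1 \/ (k = 2 \/ k = 3)).
- case: k => -[|[|[|[|//]]]] hk; [left|right;left|right;right;left|right;right;right]; exact: val_inj.
all: rewrite -/a -/b -/c; lra.
Qed.

(** Take [r] maximal and write [T] for [perron]. If [T g - r g] were nonzero, its second image would
    be positive and [T (T g)] would admit a larger [r]. As [T] is [M + 1], the eigenvalue of [M] is
    [r - 1]. *)
Lemma perron_eigenvector : exists a b c mu,
  (forall i, 0 < val a b c i) /\ forall j, M a b c (x j) (y j) = mu * val a b c j.
Proof.
have n0 : 0 < n%:R :> R by rewrite ltr0n; lia.
have nonempty : perron_set !=set0.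
  exists (\row_k if k == 2 then n%:R^-1 else 0); rewrite /perron_set /= !mxE /=.
  have e i : 0 * x i + 0 * y i + n%:R^-1 = n%:R^-1 :> R by ring.
  split; first by move=> i; rewrite e invr_ge0 ltW.
  split.
    under eq_bigr => i _ do rewrite e.
    by rewrite sumr_const card_ord -[LHS]mulr_natr mulVf // gt_eqF.
  split=> // j; rewrite mul0r; apply: perron_ge0 => i; by rewrite e invr_ge0 ltW.
have cpt : compact perron_set.
  have [B hB] := perron_set_bounded.
  apply: bounded_closed_compact perron_set_closed.
  have B0 : 0 <= B by have [w ws] := nonempty; exact: le_trans (normr_ge0 _) (hB w ws 0).
  exists B; split; first exact: ger0_real.
  move=> K BK w ws /=; rewrite (_ : `|w| = mx_norm w) // mx_normrE; apply/bigmax_leP.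
  split; first exact: le_trans (ltW BK).
  move=> [i k] _ /=; rewrite (ord1 i); exact: le_trans (hB w ws k) (ltW BK).
have cont : {within perron_set, continuous (fun w : 'rV[R]_4 => w3 w)}.
  by apply: continuous_subspaceT => w; exact: coord_continuous.
have [w /set_mem [h1 [h2 [h3 h4]]] wmax] := EVT_max_rV nonempty cpt cont.
exists (w0 w), (w1 w), (w2 w), (w3 w - 1).
set a := w0 w in h1 h2 h4 *; set b := w1 w in h1 h2 h4 *; set c := w2 w in h1 h2 h4 *.
set r := w3 w in h3 h4 wmax *.
have nz : exists i, val a b c i != 0.
  apply/existsP; rewrite -[X in is_true X]negbK negb_exists; apply/negP => /forallP z.
  move: h2; rewrite big1 => [/esym/eqP|i _]; first by rewrite oner_eq0.
  by apply/eqP; rewrite -[X in is_true X]negbK z.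
have T2 j := perron2_gt0 j h1 nz.
have eig j : perron (fun i => val a b c i) j = r * val a b c j.
  apply/eqP/negPn/negP => nj.
  have [a' [b' [c' eT]]] := perron_affine a b c.
  have [a2 [b2 [c2 eT2]]] := perron_affine a' b' c'.
  have eTf : perron (fun i => val a b c i) = (fun i => val a' b' c' i) by apply: funext.
  have eT2f : perron (fun i => val a' b' c' i) = (fun i => val a2 b2 c2 i) by apply: funext.
  have pos2 i : 0 < val a2 b2 c2 i by rewrite -eT2 -eTf.
  pose z i := val (a' - r * a) (b' - r * b) (c' - r * c) i.
  have zE i : z i = perron (fun i => val a b c i) i - r * val a b c i by rewrite eT /z; ring.
  have z0 i : 0 <= z i by rewrite zE subr_ge0.
  have znz : exists i, z i != 0 by exists j; rewrite zE subr_eq0.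
  have zpos i : 0 < perron (perron z) i by exact: perron2_gt0.
  have perronB F G t k : perron (fun i => F i - t * G i) k = perron F k - t * perron G k.
    by rewrite /perron mulr_sumr -sumrB; apply: eq_bigr => l _; ring.
  have zz i : perron (perron z) i = perron (fun i => val a2 b2 c2 i) i - r * val a2 b2 c2 i.
    have ez : z = fun i => val a' b' c' i - r * val a b c i.
      by apply: funext => k; rewrite zE eT.
    have epz : perron z = fun i => val a2 b2 c2 i - r * val a' b' c' i.
      by apply: funext => k; rewrite ez perronB eT2 eT.
    by rewrite epz perronB eT2.
  (* Exceeds every ratio of [T (T g)] to [T (T z)], so [r + m^-1] is admissible for [T (T g)]. *)
  pose m := \sum_i val a2 b2 c2 i / perron (perron z) i + 1.
  have m0 : 0 < m.
    rewrite ltr_wpDl ?ltr01 // sumr_ge0 // => i _; apply: divr_ge0; apply: ltW; [exact: pos2|exact: zpos].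
  have le i : m^-1 * val a2 b2 c2 i <= perron (perron z) i.
    rewrite ler_pdivrMl // -ler_pdivrMr // /m (bigD1 i) //= -[leRHS]addrA lerDl.
    apply: addr_ge0; last exact: ler01.
    apply: sumr_ge0 => k _.
    by apply: divr_ge0; apply: ltW; [exact: pos2|exact: zpos].
  pose N := \sum_i val a2 b2 c2 i.
  have N0 : 0 < N by rewrite /N (bigD1 j) //= ltr_pwDl // sumr_ge0 // => i _; exact: ltW.
  pose w' : 'rV[R]_4 := \row_k nth 0 [:: a2 / N; b2 / N; c2 / N; r + m^-1] k.
  have vE i : val (w0 w') (w1 w') (w2 w') i = val a2 b2 c2 i / N.
    by rewrite !mxE /=; ring.
  have w3E : w3 w' = r + m^-1 by rewrite mxE.
  have : w3 w' <= r.
    apply: wmax; apply/mem_set; split; first by move=> i; rewrite vE divr_ge0 // ltW.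
    split; first by under eq_bigr => i _ do rewrite vE; rewrite -mulr_suml divff // gt_eqF.
    split; first by rewrite w3E addr_ge0 // invr_ge0 ltW.
    move=> i; rewrite vE w3E mulrA ler_pdivrMr //.
    have -> : perron (fun i => val (w0 w') (w1 w') (w2 w') i) i * N = perron (fun i => val a2 b2 c2 i) i.
      rewrite /perron mulr_suml; apply: eq_bigr => k _; rewrite vE.
      by rewrite mulrAC mulrVK // unitfE gt_eqF.
    by have := le i; rewrite zz; lra.
  by rewrite w3E gerDl leNgt invr_gt0 m0.
split=> j.
  have e2 : perron (perron (fun i => val a b c i)) j = r * (r * val a b c j).
    rewrite -eig -[RHS]/(r * _) /perron mulr_sumr; apply: eq_bigr => i _.
    by rewrite -/(perron (fun i => val a b c i) i) eig mulrA.
  have := T2 j; rewrite e2 => h; rewrite lt_neqAle h1 andbT.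
  by apply: contraTneq h => <-; rewrite !mulr0 ltxx.
have := eig j; rewrite perron_glick; lra.
Qed.

End Perron.

(** The affine form [M 1 - mu] vanishes at all vertices, so its linear part is zero. *)
Lemma obstruction0_of_glick (R : realFieldType) n (hn : (5 <= n)%N) (x y : 'I_n -> R) mu :
  pos_polygon x y -> (forall j, glick_op x y 0 0 1 (x j) (y j) = mu) ->
  obstruction_x x y = 0 /\ obstruction_y x y = 0.
Proof.
move=> pos h; have i0 : 'I_n by exact: (@Ordinal n 0 ltac:(lia)).
have z j : - obstruction_y x y * x j + obstruction_x x y * y j + (glick_op x y 0 0 1 0 0 - mu) = 0.
  by rewrite -(h j) (glick_op_one _ _ (x j)); ring.
have [oy ox] : - obstruction_y x y = 0 /\ obstruction_x x y = 0.
  by apply: (affine_eq0_far pos _ _ (z i0) (z (ordS i0)) (z (ordS (ordS i0)))); ord_neq.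
by split=> //; apply/eqP; rewrite -oppr_eq0 oy.
Qed.

Lemma orient_coord (R : realType) n (P : 'M[R]_(n, 2)) i j k :
  orient (row i P) (row j P) (row k P) =
  (coordx P j - coordx P i) * (coordy P k - coordy P i) -
  (coordy P j - coordy P i) * (coordx P k - coordx P i).
Proof. by rewrite /orient !mxE. Qed.

(** * Polygons with vanishing obstruction from homogeneous coordinates *)

Section Projective.
Variables (R : realFieldType) (T : Type) (v1 v2 v3 : T -> R).

Definition det3 i j k : R :=
  v1 i * (v2 j * v3 k - v3 j * v2 k) - v2 i * (v1 j * v3 k - v3 j * v1 k)
  + v3 i * (v1 j * v2 k - v2 j * v1 k).
End Projective.

Section Construction.
Variables (R : realType) (n : nat) (hn : (5 <= n)%N).
Local Notation s := (@ordS n).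
Local Notation q := (@ord_pred n).
Variables v1 v2 v3 : 'I_n -> R.
Local Notation det := (det3 v1 v2 v3).
(** Equals [1] at the frame vectors [z0], [z1], [z2] below; dividing by it gives a first affine
    chart in which the polygon is convex. *)
Local Notation h i := (v1 i - v2 i + v3 i).
Hypothesis detpos : forall i j, j != i -> j != s i -> 0 < det i (s i) j.
Hypothesis hpos : forall i, 0 < h i.

Lemma orient_quotient (x y z : 'I_n -> R) i j k : z i != 0 -> z j != 0 -> z k != 0 ->
  (x j / z j - x i / z i) * (y k / z k - y i / z i) -
  (y j / z j - y i / z i) * (x k / z k - x i / z i) = det3 x y z i j k / (z i * z j * z k).
Proof. by move=> zi zj zk; rewrite /det3; field; rewrite zi zj zk. Qed.

Variables z0 z1 z2 : 'I_n.
Hypothesis v_z0 : [/\ v1 z0 = 1, v2 z0 = 0 & v3 z0 = 0].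
Hypothesis v_z1 : [/\ v1 z1 = 0, v2 z1 = 0 & v3 z1 = 1].
Hypothesis v_z2 : [/\ v1 z2 = 0, v2 z2 = -1 & v3 z2 = 0].
Variables x0 y0 x1 y1 x2 y2 : R.
Hypothesis opos : 0 < (x1 - x0) * (y2 - y0) - (y1 - y0) * (x2 - x0).

(* The eigenvector supplied by [perron_eigenvector] is the line to be sent to
   infinity; the frame [z0, z1, z2] is sent to three prescribed points. *)
Lemma polygon_of_frame : exists P : 'M[R]_(n, 2),
  [/\ forever_convex P,
      [/\ coordx P z0 = x0, coordx P z1 = x1 & coordx P z2 = x2],
      [/\ coordy P z0 = y0, coordy P z1 = y1 & coordy P z2 = y2] &
      exists (d : R) (w : 'I_n -> R), [/\ 0 < d, forall i, 0 < w i &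
        forall i j k, orient (row i P) (row j P) (row k P) = d * det i j k / (w i * w j * w k)]].
Proof.
pose X i := v1 i / h i; pose Y i := v2 i / h i.
have hn0 i : h i != 0 by rewrite gt_eqF.
have oXY i j k : (X j - X i) * (Y k - Y i) - (Y j - Y i) * (X k - X i) =
    det i j k / (h i * h j * h k).
  transitivity (det3 v1 v2 (fun l => h l) i j k / (h i * h j * h k)).
    exact: (@orient_quotient v1 v2 (fun l => h l)).
  by congr (_ / _); rewrite /det3; ring.
have posXY : pos_polygon X Y.
  by move=> i j ji js; rewrite /side_form oXY divr_gt0 ?detpos // !mulr_gt0.
have [a [b [c [mu [gpos eig]]]]] := perron_eigenvector hn posXY.
pose g i := a * X i + b * Y i + c.
(* The eigenvector as a linear form in [v1], [v2], [v3]; its zero line is sent to infinity. *)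
have [w wgh] : exists w : 'I_n -> R, forall i, w i = g i * h i by exists (fun i => g i * h i).
have wpos i : 0 < w i by rewrite wgh; exact: mulr_gt0 (gpos i) (hpos i).
have wn0 i : w i != 0 by rewrite gt_eqF.
have wE i : w i = (a + c) * v1 i + (b - c) * v2 i + c * v3 i.
  by rewrite wgh /g /X /Y; field.
have w0 : w z0 = a + c by case: v_z0 => e1 e2 e3; rewrite wE e1 e2 e3; ring.
have w1 : w z1 = c by case: v_z1 => e1 e2 e3; rewrite wE e1 e2 e3; ring.
have w2 : w z2 = c - b by case: v_z2 => e1 e2 e3; rewrite wE e1 e2 e3; ring.
(* The linear map taking each frame vector to [w] times the prescribed point in homogeneous
   coordinates has [w] as its third coordinate. *)
pose nx i := v1 i * w z0 * x0 + v3 i * w z1 * x1 - v2 i * w z2 * x2.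
pose ny i := v1 i * w z0 * y0 + v3 i * w z1 * y1 - v2 i * w z2 * y2.
pose P : 'M[R]_(n, 2) := \matrix_(i, j) if j == 0 then nx i / w i else ny i / w i.
have Px : coordx P = fun i => nx i / w i by apply: funext => i; rewrite /coordx mxE.
have Py : coordy P = fun i => ny i / w i by apply: funext => i; rewrite /coordy mxE.
pose d := w z0 * w z1 * w z2 * ((x1 - x0) * (y2 - y0) - (y1 - y0) * (x2 - x0)).
have dpos : 0 < d by rewrite /d !mulr_gt0.
have dn0 : d != 0 by rewrite gt_eqF.
have oP i j k : (coordx P j - coordx P i) * (coordy P k - coordy P i) -
   (coordy P j - coordy P i) * (coordx P k - coordx P i) = d * det i j k / (w i * w j * w k).
  rewrite Px Py orient_quotient //; congr (_ / _).
  have e l : w l = v1 l * w z0 + v3 l * w z1 - v2 l * w z2.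
    by rewrite w0 w1 w2 wE; ring.
  rewrite /det3 /nx /ny [w i]e [w j]e [w k]e /d /det3.
  move: (w z0) (w z1) (w z2) => W0 W1 W2; ring.
have posP : pos_polygon (coordx P) (coordy P).
  by move=> i j ji js; rewrite /side_form oP divr_gt0 // !mulr_gt0 ?detpos.
(* Sending the zero line of [g] to infinity divides forms by [g], which turns the eigenvalue
   equation of [g] into that of the constant form. *)
have gl j : glick_op (coordx P) (coordy P) 0 0 1 (coordx P j) (coordy P j) = mu.
  have gn0 l : g l != 0 by apply/negbT/gt_eqF; exact: gpos.
  have gj := gn0 j.
  apply: (mulIf gj); rewrite -eig mulr_suml; apply: eq_bigr => i _.
  rewrite !mul0r !add0r mul1r.
  have eA (u v : 'I_n -> R) : ear u v i = (u i - u (q i)) * (v (s i) - v (q i)) -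
     (v i - v (q i)) * (u (s i) - u (q i)).
    by rewrite /ear /edge_cross /edgex /edgey ord_predK; ring.
  rewrite /diag_form !eA !oP !oXY.
  have detn0 : det (q i) i (s i) != 0.
    rewrite gt_eqF // -{2}[i]ord_predK; apply: detpos; last by rewrite ord_predK; ord_neq.
    by ord_neq.
  have := hn0 i; have := hn0 j; have := hn0 (q i); have := hn0 (s i).
  have := gn0 i; have := gn0 (q i); have := gn0 (s i).
  move: gj detn0 dn0; rewrite !wgh -/(g i).
  move: (det (q i) (s i) j) (det (q i) i (s i)) => D1 D2.
  move: (h i) (h j) (h (q i)) (h (s i)) (g i) (g j) (g (q i)) (g (s i)) => h1 h2 h3 h4 g1 g2 g3 g4.
  move=> k1 k2 k3 k4 k5 k6 k7 k8 k9 k10.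
  by field; rewrite k1 k2 k3 k4 k5 k6 k7 k8 k9 k10.
have [ox oy] := obstruction0_of_glick hn posP gl.
have P0 i x y : nx i / w i = x -> ny i / w i = y -> coordx P i = x /\ coordy P i = y.
  by rewrite Px Py.
have [? ?] : coordx P z0 = x0 /\ coordy P z0 = y0.
  by case: v_z0 => e1 e2 e3; apply: P0; rewrite /nx /ny e1 e2 e3; field.
have [? ?] : coordx P z1 = x1 /\ coordy P z1 = y1.
  by case: v_z1 => e1 e2 e3; apply: P0; rewrite /nx /ny e1 e2 e3; field.
have [? ?] : coordx P z2 = x2 /\ coordy P z2 = y2.
  by case: v_z2 => e1 e2 e3; apply: P0; rewrite /nx /ny e1 e2 e3; field.
exists P; split=> //.
  by apply/(forever_convexP hn); split=> //; apply/(convex_polygonP hn); left.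
exists d, w; split=> // i j k.
by rewrite -oP orient_coord.
Qed.

End Construction.

(** * A convex arc completed by two points at infinity *)

Section Configuration.
Variables (R : realType) (n : nat) (hn : (5 <= n)%N).
Local Notation s := (@ordS n).

(* A convex arc [(1 : tau m : sigma m)] together with the two points at infinity
   of the coordinate axes: its projective coordinates with respect to the frame
   formed by the vertices [0, 1, n - 2, n - 1] are the [tau m] and [sigma m]. *)
Definition cfg1 (i : 'I_n) : R := if (i <= n - 3)%N then 1 else 0.
Definition cfg2 (tau : nat -> R) (i : 'I_n) : R :=
  if (i <= n - 3)%N then tau i else if i == (n - 1)%N :> nat then -1 else 0.
Definition cfg3 (sigma : nat -> R) (i : 'I_n) : R :=
  if (i <= n - 3)%N then sigma i else if i == (n - 2)%N :> nat then 1 else 0.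

Section Convexity.
Variables tau sigma : nat -> R.
Hypothesis tau0 : tau 0%N = 0.
Hypothesis sigma0 : sigma 0%N = 0.
Hypothesis tau_lt : forall i j, (i < j)%N -> tau i < tau j.
Hypothesis sigma_lt : forall i j, (i < j)%N -> sigma i < sigma j.
Hypothesis arc_convex : forall i j, (i < n)%N -> (j < n)%N -> j != i -> j != i.+1 ->
  0 < (tau i.+1 - tau i) * (sigma j - sigma i) - (sigma i.+1 - sigma i) * (tau j - tau i).

Lemma cfg_arc (i : 'I_n) : (i <= n - 3)%N ->
  [/\ cfg1 i = 1, cfg2 tau i = tau i & cfg3 sigma i = sigma i].
Proof. by move=> h; rewrite /cfg1 /cfg2 /cfg3 h. Qed.

Lemma cfg_vertical (i : 'I_n) : i = (n - 2)%N :> nat ->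
  [/\ cfg1 i = 0, cfg2 tau i = 0 & cfg3 sigma i = 1].
Proof.
move=> h; rewrite /cfg1 /cfg2 /cfg3 h eqxx.
by rewrite (_ : (n - 2 <= n - 3)%N = false) 1?(_ : (n - 2 == n - 1)%N = false) //; lia.
Qed.

Lemma cfg_horizontal (i : 'I_n) : i = (n - 1)%N :> nat ->
  [/\ cfg1 i = 0, cfg2 tau i = -1 & cfg3 sigma i = 0].
Proof.
move=> h; rewrite /cfg1 /cfg2 /cfg3 h eqxx.
by rewrite (_ : (n - 1 <= n - 3)%N = false) 1?(_ : (n - 1 == n - 2)%N = false) //; lia.
Qed.

Lemma cfg_detpos i j : j != i -> j != s i -> 0 < det3 cfg1 (cfg2 tau) (cfg3 sigma) i (s i) j.
Proof.
move=> ji js.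
have ji' : j <> i :> nat by move/val_inj/eqP; apply/negP.
have js' : j <> s i :> nat by move/val_inj/eqP; apply/negP.
have hi := ltn_ord i; have hj := ltn_ord j.
have vs : s i = (if i == (n - 1)%N :> nat then 0 else i.+1)%N :> nat.
  rewrite /=; case: eqP => [->|h]; first by rewrite (_ : (n - 1).+1 = n) ?modnn //; lia.
  by rewrite modn_small //; lia.
rewrite vs in js'.
have sigma_gt0 m : (0 < m)%N -> 0 < sigma m by rewrite -sigma0; exact: sigma_lt.
have caseN (k : 'I_n) : (k <= n - 3)%N \/ (k = n - 2 :> nat)%N \/ (k = n - 1 :> nat)%N.
  by have := ltn_ord k; lia.
have [ia|[iv|ih]] := caseN i.
- have [a1 a2 a3] := cfg_arc ia.
  have vs1 : s i = i.+1 :> nat by rewrite vs; case: eqP => // h; lia.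
  have js1 : j <> i.+1 :> nat by rewrite -vs1; move/val_inj/eqP; apply/negP.
  have [sa|[sv|sh]] := caseN (s i); last by lia.
  + have [b1 b2 b3] := cfg_arc sa; rewrite vs1 in b2 b3.
    rewrite /det3 a1 a2 a3 b1 b2 b3.
    have [ja|[jv|jh]] := caseN j.
    * have [-> -> ->] := cfg_arc ja.
      have := @arc_convex i j hi hj; rewrite (introN eqP ji') (introN eqP js1).
      by move=> /(_ isT isT); lra.
    * have [-> -> ->] := cfg_vertical jv; have := tau_lt (ltnSn i); lra.
    * have [-> -> ->] := cfg_horizontal jh; have := sigma_lt (ltnSn i); lra.
  + have [b1 b2 b3] := cfg_vertical sv.
    rewrite /det3 a1 a2 a3 b1 b2 b3.
    have [ja|[jv|jh]] := caseN j.
    * have [-> -> ->] := cfg_arc ja.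
      have lt : (j < i)%N by lia.
      by have := tau_lt lt; lra.
    * by lia.
    * have [-> -> ->] := cfg_horizontal jh; lra.
- have [a1 a2 a3] := cfg_vertical iv.
  have [b1 b2 b3] : [/\ cfg1 (s i) = 0, cfg2 tau (s i) = -1 & cfg3 sigma (s i) = 0].
    by apply: cfg_horizontal; rewrite vs; case: eqP => h; lia.
  rewrite /det3 a1 a2 a3 b1 b2 b3.
  have ja : (j <= n - 3)%N by move: js'; case: eqP => h; lia.
  by have [-> -> ->] := cfg_arc ja; lra.
- have [a1 a2 a3] := cfg_horizontal ih.
  have s0 : s i = 0%N :> nat by rewrite vs ih eqxx.
  have [b1 b2 b3] : [/\ cfg1 (s i) = 1, cfg2 tau (s i) = tau (s i) & cfg3 sigma (s i) = sigma (s i)].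
    by apply: cfg_arc; rewrite s0.
  rewrite /det3 a1 a2 a3 b1 b2 b3 s0 tau0 sigma0.
  rewrite ih eqxx in js'.
  have [ja|[jv|jh]] := caseN j; last by lia.
    have [-> -> ->] := cfg_arc ja; have := @sigma_gt0 j; have : (0 < j)%N by lia.
    by move=> -> /(_ isT); lra.
  by have [-> -> ->] := cfg_vertical jv; lra.
Qed.

Lemma cfg_hpos i : (forall m, 0 < 1 - tau m + sigma m) ->
  0 < cfg1 i - cfg2 tau i + cfg3 sigma i.
Proof.
move=> H; have [ia|[iv|ih]] : (i <= n - 3)%N \/ (i = n - 2 :> nat)%N \/ (i = n - 1 :> nat)%N.
- by have := ltn_ord i; lia.
- by have [-> -> ->] := cfg_arc ia.
- by have [-> -> ->] := cfg_vertical iv; lra.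
- by have [-> -> ->] := cfg_horizontal ih; lra.
Qed.

End Convexity.

(** * Perturbations of the points of a parabola *)

Section Perturbation.
Variables (delta : R) (u w : nat -> R).
Hypothesis delta0 : 0 < delta.
Hypothesis deltaN : delta * n%:R ^+ 2 = 10^-1.
Hypothesis hu : forall m, 0 <= u m <= delta.
Hypothesis hw : forall m, 0 <= w m <= delta.
Local Notation tau m := (m%:R + u m).
Local Notation sigma m := (m%:R ^+ 2 + w m).

Lemma delta_small : delta * n%:R <= 10^-1 /\ delta <= 10^-1.
Proof.
have n5 : 5 <= n%:R :> R by rewrite ler_nat.
have h : delta * n%:R <= delta * n%:R ^+ 2.
  by rewrite ler_pM2l // expr2 ler_peMl ?ler0n //; lra.
have h' : delta <= delta * n%:R by rewrite ler_peMr ?ltW //; lra.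
by rewrite deltaN in h; split=> //; exact: le_trans h.
Qed.

Lemma tau_lt_perturbed i j : (i < j)%N -> tau i < tau j.
Proof.
move=> ij; have : i%:R + 1 <= j%:R :> R by rewrite natr1 ler_nat.
have [_ d] := delta_small; have /andP[a1 a2] := hu i; have /andP[b1 b2] := hu j; lra.
Qed.

Lemma sigma_lt_perturbed i j : (i < j)%N -> sigma i < sigma j.
Proof.
move=> ij; have h : i%:R + 1 <= j%:R :> R by rewrite natr1 ler_nat.
have i0 : 0 <= i%:R :> R by rewrite ler0n.
have : i%:R ^+ 2 + 1 <= j%:R ^+ 2 :> R by nra.
have [_ d] := delta_small; have /andP[a1 a2] := hw i; have /andP[b1 b2] := hw j; lra.
Qed.

Lemma frame_form_perturbed m : 0 < 1 - tau m + sigma m.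
Proof.
have : m%:R <= m%:R ^+ 2 :> R.
  by case: m => [|m]; rewrite ?expr0n //= expr2 ler_peMl ?ler0n ?ler1n.
have [_ d] := delta_small; have /andP[a1 a2] := hu m; have /andP[b1 b2] := hw m; lra.
Qed.

(** On the parabola itself the value is [(j - i) * (j - i - 1)], at least [2]; with [delta] of order
    [1 / n ^ 2] the perturbation terms add up to less than [1]. *)
Lemma arc_convex_perturbed i j : (i < n)%N -> (j < n)%N -> j != i -> j != i.+1 ->
  0 < (tau i.+1 - tau i) * (sigma j - sigma i) - (sigma i.+1 - sigma i) * (tau j - tau i).
Proof.
move=> hi hj ji js.
have [dN d1] := delta_small.
have bound (m p : nat) (f : nat -> R) : (forall m, 0 <= f m <= delta) -> `|f m - f p| <= delta.
  by move=> hf; rewrite ler_norml; have := hf m; have := hf p; move=> /andP[? ?] /andP[? ?]; lra.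
have e1 := bound i.+1 i u hu; have e2 := bound j i u hu.
have f1 := bound i.+1 i w hw; have f2 := bound j i w hw.
set e := u i.+1 - u i in e1; set d := u j - u i in e2.
set g := w i.+1 - w i in f1; set f := w j - w i in f2.
have I0 : 0 <= i%:R :> R by rewrite ler0n.
have J0 : 0 <= j%:R :> R by rewrite ler0n.
have In : i%:R + 1 <= n%:R :> R by rewrite natr1 ler_nat.
have Jn : j%:R + 1 <= n%:R :> R by rewrite natr1 ler_nat.
have main : 2 <= (j%:R - i%:R) * (j%:R - i%:R - 1) :> R.
  have [lt|ge] := ltnP j i.
    have h : j%:R + 1 <= i%:R :> R by rewrite natr1 ler_nat.
    by nra.
  have h : i%:R + 1 + 1 <= j%:R :> R by rewrite !natr1 ler_nat; lia.
  by nra.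
have absM (a b p r : R) : `|a| <= p -> `|b| <= r -> `|a * b| <= p * r.
  by move=> h1 h2; rewrite normrM; apply: ler_pM.
have K : `|j%:R - i%:R| <= n%:R :> R by rewrite ler_norml; lra.
have L : `|j%:R + i%:R| <= 2 * n%:R :> R by rewrite ler_norml; lra.
have L' : `|2 * i%:R + 1| <= 2 * n%:R :> R by rewrite ler_norml; lra.
have t1 := absM _ _ _ _ e1 (absM _ _ _ _ K L).
have t2 := absM _ _ _ _ e1 f2.
have t3 := absM _ _ _ _ L' e2.
have t4 := absM _ _ _ _ f1 K.
have t5 := absM _ _ _ _ f1 e2.
have dd : delta * delta <= 10^-1 by apply: (le_trans _ d1); rewrite ger_pMl //; lra.
have b1 : delta * (n%:R * (2 * n%:R)) = 2 * 10^-1 by rewrite -deltaN; ring.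
have b3 : 2 * n%:R * delta <= 2 * 10^-1 by rewrite -mulrA [n%:R * _]mulrC; lra.
rewrite b1 in t1.
have E : (tau i.+1 - tau i) * (sigma j - sigma i) - (sigma i.+1 - sigma i) * (tau j - tau i)
  = (j%:R - i%:R) * (j%:R - i%:R - 1) + e * ((j%:R - i%:R) * (j%:R + i%:R)) + f + e * f
    - (2 * i%:R + 1) * d - g * (j%:R - i%:R) - g * d.
  by rewrite -natr1 /e /d /g /f; ring.
rewrite E; move: t1 t2 t3 t4 t5 f2; rewrite !ler_norml.
move=> /andP[t1 _] /andP[t2 _] /andP[_ t3] /andP[_ t4] /andP[_ t5] /andP[f2 _].
have u3 := le_trans t3 b3; have u4 := le_trans t4 dN; have u5 := le_trans t5 dd.
lra.
Qed.

End Perturbation.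
End Configuration.

(** * Independent coordinates on the variety *)

Section LowerBound.
Variables (R : realType) (n : nat) (hn : (5 <= n)%N).
Local Notation s := (@ordS n).
Implicit Types P : 'M[R]_(n, 2).

Definition orient_poly i j k : {mpoly R[n * 2]} :=
  (varx R j - varx R i) * (vary R k - vary R i) - (vary R j - vary R i) * (varx R k - varx R i).

Lemma peval_varxE i P : peval (varx R i) P = coordx P i.
Proof. by rewrite /peval mevalXU mxvecE. Qed.

Lemma peval_varyE i P : peval (vary R i) P = coordy P i.
Proof. by rewrite /peval mevalXU mxvecE. Qed.

Lemma peval_orient i j k P : peval (orient_poly i j k) P = orient (row i P) (row j P) (row k P).
Proof.
rewrite orient_coord /peval mevalB !mevalM !mevalB -!/(peval _ _).
by rewrite !peval_varxE !peval_varyE.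
Qed.

Lemma orient_side_neq0 P i j : convex_polygon P -> j != i -> j != s i ->
  orient (row i P) (row (s i)  P) (row j P) <> 0.
Proof. by move=> cP ji js; case: (cP i) => /(_ j ji js) h e; rewrite e ltxx in h. Qed.

Lemma forever_convex_chain :
  exists Z, @irreducible_chain R n (@forever_convex R n) (2 * n - 2) Z.
Proof.
pose i0 : 'I_n := @Ordinal n 0 ltac:(lia).
pose o m : 'I_n := insubd i0 m.
have oE m : (m < n)%N -> o m = m :> nat by move=> h; rewrite val_insubd h.
pose a0 := o 0%N; pose a1 := o 1%N; pose b0 := o (n - 2)%N; pose b1 := o (n - 1)%N.
have a0E : a0 = 0%N :> nat by apply: oE; lia.
have a1E : a1 = 1%N :> nat by apply: oE; lia.
have b0E : b0 = (n - 2)%N :> nat by apply: oE; lia.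
have b1E : b1 = (n - 1)%N :> nat by apply: oE; lia.
have sa0 : s a0 = a1 by apply: val_inj; rewrite /= a0E modn_small ?a1E //; lia.
have sb0 : s b0 = b1 by apply: val_inj; rewrite /= b0E modn_small ?b1E //; lia.
have sb1 : s b1 = a0.
  by apply: val_inj; rewrite /= b1E a0E (_ : (n - 1).+1 = n) ?modnn //; lia.
(* Coordinates [0] to [5] belong to the three prescribed vertices; from [6] on, even and odd [j]
   stand for [tau] and [sigma] of the vertex [mm j]. *)
pose mm j := ((j - 6)./2 + 2)%N.
have mmE j : (j < 2 * n - 2)%N -> (6 <= j)%N -> (2 <= mm j <= n - 3)%N by rewrite /mm; lia.
pose base j : R := if (j < 6)%N then nth 0 [:: 0; 0; 1; 0; 0; 1] j
  else if odd j then (mm j)%:R ^+ 2 else (mm j)%:R.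
pose delta : R := (10 * n%:R ^+ 2)^-1.
have n0 : 0 < n%:R :> R by rewrite ltr0n; lia.
have delta0 : 0 < delta by rewrite invr_gt0 mulr_gt0 // exprn_gt0.
have deltaN : delta * n%:R ^+ 2 = 10^-1.
  by rewrite /delta; field; rewrite gt_eqF.
pose eps (c : nat) : R := delta / c.+1%:R.
have eps_inj : injective eps.
  move=> c c' /(mulfI (lt0r_neq0 delta0)) /invr_inj /eqP.
  by rewrite eqr_nat => /eqP[].
have epsP c : 0 <= eps c <= delta.
  apply/andP; split; first by rewrite divr_ge0 ?ler0n // ltW.
  by rewrite /eps ler_pdivrMr ?ltr0n // ler_peMr ?ler1n // ltW.
pose t j c := base j + eps c.
(* From [6] on, [pa j / pb j] is a projective invariant: the factors [d] and [w] of
   [polygon_of_frame] cancel, and its value on the configuration is [tau] or [sigma]. *)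
pose pa j := if (j < 6)%N then
    nth 0 [:: varx R a0; vary R a0; varx R b0; vary R b0; varx R b1; vary R b1] j
  else if odd j then orient_poly b1 a0 (o (mm j)) * orient_poly b0 b1 a1
  else orient_poly b0 a0 (o (mm j)) * orient_poly b0 b1 a1.
pose pb j := if (j < 6)%N then 1
  else if odd j then orient_poly b0 b1 (o (mm j)) * orient_poly b1 a0 a1
  else orient_poly b0 b1 (o (mm j)) * orient_poly a0 a1 b0.
suff [Z hZ] : exists Z, nat_chain (@forever_convex R n) (2 * n - 2) Z.
  by exists (fun i => Z i); exact: nat_chainE.
apply: (@chain_of_coordinates R n _ _ pa pb t).
- by move=> j _ c c' /addrI /eps_inj.
- move=> j P jn [cP _]; rewrite /pb; case: ltnP => j6.
    by rewrite /peval meval1; apply/eqP; exact: oner_neq0.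
  have /andP[m2 mn] := mmE j jn j6.
  have omE : o (mm j) = mm j :> nat by apply: oE; lia.
  have neq (k l : 'I_n) : k <> l :> nat -> k != l by move=> h; apply: contra_notN h => /eqP ->.
  have h1 : orient (row b0 P) (row b1 P) (row (o (mm j)) P) <> 0.
    by rewrite -sb0; apply: orient_side_neq0 => //; apply: neq; rewrite ?sb0 ?b0E ?b1E omE; lia.
  have h2 : orient (row b1 P) (row a0 P) (row a1 P) <> 0.
    by rewrite -sb1; apply: orient_side_neq0 => //; apply: neq; rewrite ?sb1 ?b1E ?a0E ?a1E; lia.
  have h3 : orient (row a0 P) (row a1 P) (row b0 P) <> 0.
    by rewrite -sa0; apply: orient_side_neq0 => //; apply: neq; rewrite ?sa0 ?b0E ?a0E ?a1E; lia.
  by case: ifP => _; rewrite pevalM !peval_orient => /eqP; rewrite mulf_eq0 => /orP[]/eqP.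
- move=> c.
  (* Inverts [mm] to find the coordinates of the vertex [m]; the frame vertices [0] and [1] stay in
     place. *)
  pose u m := if (m < 2)%N then 0 else eps (c (6 + 2 * (m - 2))%N).
  pose w m := if (m < 2)%N then 0 else eps (c (6 + 2 * (m - 2)).+1).
  have hu m : 0 <= u m <= delta.
    by rewrite /u; case: ifP => _ //; rewrite lexx ltW.
  have hw m : 0 <= w m <= delta.
    by rewrite /w; case: ifP => _ //; rewrite lexx ltW.
  pose tau m : R := m%:R + u m; pose sigma m : R := m%:R ^+ 2 + w m.
  have tau0 : tau 0%N = 0 by rewrite /tau /u addr0.
  have sigma0 : sigma 0%N = 0 by rewrite /sigma /w expr0n addr0.
  have tau1 : tau 1%N = 1 by rewrite /tau /u addr0.
  have sigma1 : sigma 1%N = 1 by rewrite /sigma /w expr1n addr0.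
  have detpos := cfg_detpos hn tau0 sigma0 (tau_lt_perturbed hn delta0 deltaN hu)
    (sigma_lt_perturbed hn delta0 deltaN hw) (arc_convex_perturbed hn delta0 deltaN hu hw).
  have hpos i := @cfg_hpos R n hn tau sigma i (frame_form_perturbed hn delta0 deltaN hu hw).
  have arc (i : 'I_n) := @cfg_arc R n tau sigma i.
  have v0 : [/\ cfg1 R a0 = 1, cfg2 tau a0 = 0 & cfg3 sigma a0 = 0].
    by have [] := arc a0; rewrite a0E // tau0 sigma0.
  have v1 := @cfg_vertical R n hn tau sigma b0 b0E.
  have v2 := @cfg_horizontal R n hn tau sigma b1 b1E.
  have opos : 0 < ((1 + eps (c 2%N)) - eps (c 0%N)) * ((1 + eps (c 5%N)) - eps (c 1%N)) -
      (eps (c 3%N) - eps (c 1%N)) * (eps (c 4%N) - eps (c 0%N)).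
    have [_ d1] := delta_small hn delta0 deltaN.
    have := epsP (c 0%N); have := epsP (c 1%N); have := epsP (c 2%N).
    have := epsP (c 3%N); have := epsP (c 4%N); have := epsP (c 5%N).
    move: (eps (c 0%N)) (eps (c 1%N)) (eps (c 2%N)) (eps (c 3%N)) (eps (c 4%N)) (eps (c 5%N)).
    move=> e0 e1 e2 e3 e4 e5 /andP[? ?] /andP[? ?] /andP[? ?] /andP[? ?] /andP[? ?] /andP[? ?].
    have p1 : (9/10) * (9/10) <= (1 + e2 - e0) * (1 + e5 - e1).
      by apply: ler_pM; lra.
    have : `|(e3 - e1) * (e4 - e0)| <= 10^-1 * 10^-1.
      by rewrite normrM; apply: ler_pM => //; rewrite ler_norml; lra.
    by rewrite ler_norml => /andP[_ h]; lra.
  have [P [fP [X0 X1 X2] [Y0 Y1 Y2] [d [om [d0 om0 oP]]]]] :=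
    polygon_of_frame hn detpos hpos v0 v1 v2 opos.
  exists P => // j jn; rewrite /pa /pb /t /base; case: ltnP => j6.
    rewrite /peval meval1 mulr1.
    case: j jn j6 => [|[|[|[|[|[|//]]]]]] _ _ /=; rewrite -/(peval _ P) ?peval_varxE ?peval_varyE ?add0r //.
  have /andP[m2 mn] := mmE j jn j6.
  have omE : o (mm j) = mm j :> nat by apply: oE; lia.
  have vm : [/\ cfg1 R (o (mm j)) = 1, cfg2 tau (o (mm j)) = tau (mm j) & cfg3 sigma (o (mm j)) = sigma (mm j)].
    by have := arc (o (mm j)); rewrite omE; apply.
  have v1' : [/\ cfg1 R a1 = 1, cfg2 tau a1 = 1 & cfg3 sigma a1 = 1].
    by have [] := arc a1; rewrite a1E ?tau1 ?sigma1 //; lia.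
  have on0 i : om i != 0 by rewrite gt_eqF.
  have dn0 : d != 0 by rewrite gt_eqF.
  case: v0 v1 v2 vm v1' => [p1 p2 p3] [q1 q2 q3] [r1 r2 r3] [m1 m2' m3] [s1 s2 s3].
  case: ifP => jodd; rewrite !pevalM !peval_orient !oP /det3 ?p1 ?p2 ?p3 ?q1 ?q2 ?q3
     ?r1 ?r2 ?r3 ?m1 ?m2' ?m3 ?s1 ?s2 ?s3.
    have -> : (mm j)%:R ^+ 2 + eps (c j) = sigma (mm j).
      rewrite /sigma /w ltnNge m2 /= (_ : (6 + 2 * (mm j - 2)).+1 = j) //.
      by rewrite /mm; lia.
    by field; rewrite !on0.
  have -> : (mm j)%:R + eps (c j) = tau (mm j).
    rewrite /tau /u ltnNge m2 /= (_ : (6 + 2 * (mm j - 2))%N = j) //.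
    by rewrite /mm; lia.
  by field; rewrite !on0.
Qed.

End LowerBound.

Unset Implicit Arguments.

Theorem mainTheorem2 (R : realType) (n : nat) (hn : (5 <= n)%N) :
  algebraic_in (@convex_polygon R n) (@forever_convex R n) /\
  zariski_dim (@forever_convex R n) (2 * n - 2).
Proof.
split; first exact: forever_convex_algebraic.
split; first exact: forever_convex_chain.
by move=> m Z; exact: forever_convex_chain_le.
Qed.
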